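(* Let $d\ge 2$ be a fixed integer, and let $F=F(n,d)$ be the event that the random $d$-process $\mathcal P(d,n)$ fails to saturate. Then, as $n\to\infty$, $$\mathbf P(F)\sim\begin{cases}\dfrac{d-1}{\log n} & \text{when } dn \text{ is even},\\[2mm] \dfrac{(d-1)(d-2)}{\log^2 n} & \text{when } dn\text{ is odd}.\end{cases}$$
   Context: The $d$-process $\mathcal P(d,n)$ is the following random process. Start with the empty graph on $n$ vertices. At each step add one edge, chosen uniformly at random from all pairs of distinct vertices that are not yet edges and both of whose vertices currently have degree less than $d$. The process stops when no such pair exists; the final graph is $G_{\rm final}$. The process is said to saturate if $G_{\rm final}$ is $d$-regular, or has $n-1$ vertices of degree $d$ and one remaining vertex of degree $d-1$. All logarithms are natural; $d$ is constant and $n\to\infty$ (in each case through those $n$ for which $dn$ has the stated parity). $a_n\sim b_n$ means $a_n/b_n\to1$. *)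

(* Defs.v *)
From HB Require Import structures.
From mathcomp Require Import all_boot all_order all_algebra.
From mathcomp Require Import reals.

Set Implicit Arguments.
Unset Strict Implicit.
Unset Printing Implicit Defensive.

Import Order.TTheory GRing.Theory Num.Theory.

Local Open Scope ring_scope.

(* A graph on the vertex set 'I_n is given by its set of edges; the edges that
   can ever be added (see [available]) are 2-element sets of vertices, so the
   graphs reached from the empty one are simple. *)
Definition graph (n : nat) : finType := {set {set 'I_n}}.

Definition degree (n : nat) (G : graph n) (v : 'I_n) : nat :=
  #|[set e in G | v \in e]|.

Definition available (d n : nat) (G : graph n) : {set {set 'I_n}} :=
  [set e : {set 'I_n} | [&& #|e| == 2%N, e \notin G
                          & [forall (v | v \in e), (degree G v < d)%N]]].

Definition saturated (d n : nat) (G : graph n) : bool :=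
  [forall v, degree G v == d] ||
  [exists v, (degree G v == d.-1) &&
             [forall (w | w != v), degree G w == d]].

(* Transition probability from G to H: the process stays forever at a graph
   where no edge is available. *)
Definition step_prob (R : realType) (d n : nat) (G H : graph n) : R :=
  if available d G == set0 then (H == G)%:R
  else \sum_(e in available d G) (H == e |: G)%:R / #|available d G|%:R.

(* [process_law R d t G] is the probability that the (absorbed) d-process
   on n vertices is at G after t steps. *)
Fixpoint process_law (R : realType) (d n t : nat) : graph n -> R :=
  if t is t'.+1 then
    fun H => \sum_(G : graph n) process_law R d t' G * step_prob R d G H
  else fun H => (H == set0)%:R.

(* Every step before the process stops adds a new 2-element set, so it has
   stopped after 'C(n, 2) steps, cf. [final_law_stopped]. *)
Definition final_law (R : realType) (d n : nat) : graph n -> R :=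
  process_law R d 'C(n, 2).

Definition prob_final (R : realType) (d n : nat) (E : {set graph n}) : R :=
  \sum_(G in E) final_law R d G.

Definition not_saturating (d n : nat) : {set graph n} :=
  [set G | ~~ saturated d G].

Lemma step_prob_ge0 (R : realType) (d n : nat) (G H : graph n) :
  0 <= step_prob R d G H.
Proof.
rewrite /step_prob; case: ifP => // _.
by apply: sumr_ge0 => e _; rewrite divr_ge0.
Qed.

Lemma sum_step_prob (R : realType) (d n : nat) (G : graph n) :
  \sum_(H : graph n) step_prob R d G H = 1.
Proof.
have delta (K : graph n) : \sum_(H : graph n) (H == K)%:R = 1 :> R.
  rewrite (bigD1 K) //= eqxx big1 ?addr0 // => H /negbTE -> //.
rewrite /step_prob; case: eqVneq => [_|A0]; first exact: delta.
rewrite exchange_big /=.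
under eq_bigr do rewrite -mulr_suml delta mul1r.
by rewrite sumr_const -[_ *+ _]mulr_natl divff // pnatr_eq0 cards_eq0.
Qed.

Lemma process_law_ge0 (R : realType) (d n t : nat) (G : graph n) :
  0 <= process_law R d t G.
Proof.
elim: t G => [|t IH] G //=.
by apply: sumr_ge0 => H _; rewrite mulr_ge0 ?step_prob_ge0.
Qed.

Lemma sum_process_law (R : realType) (d n t : nat) :
  \sum_(G : graph n) process_law R d t G = 1.
Proof.
elim: t => [|t IH] /=.
  rewrite (bigD1 (set0 : graph n)) //= eqxx big1 ?addr0 // => H.
  by move=> /negbTE ->.
rewrite exchange_big /= -[RHS]IH; apply: eq_bigr => G _.
by rewrite -mulr_sumr sum_step_prob mulr1.
Qed.

Lemma process_law_support (R : realType) (d n t : nat) (G : graph n) :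
  process_law R d t G != 0 ->
  (G \subset [set e : {set 'I_n} | #|e| == 2%N]) /\
  (available d G = set0 \/ #|G| = t).
Proof.
elim: t G => [|t IH] H /=.
  case: (eqVneq H set0) => [->|]; last by rewrite eqxx.
  by split; [exact: sub0set | right; rewrite cards0].
move=> nz.
have [G lG sG] : exists2 G : graph n,
    process_law R d t G != 0 & step_prob R d G H != 0.
  case: (pickP [pred G : graph n | process_law R d t G * step_prob R d G H != 0]).
    by move=> G /=; rewrite mulf_eq0 negb_or => /andP[]; exists G.
  by move=> no; case/eqP: nz; apply: big1 => G _; apply/eqP/negbFE/no.
have [sub st] := IH _ lG.
move: sG; rewrite /step_prob.
case: (eqVneq (available d G) set0) => [A0|A0].
  by case: (eqVneq H G) => [-> _|]; [split=> //; left | rewrite eqxx].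
move=> nz'.
have [e eA eH] : exists2 e, e \in available d G & H = e |: G.
  case: (pickP [pred e | (e \in available d G) && (H == e |: G)]).
    by move=> e /= /andP[eA /eqP]; exists e.
  move=> no; case/eqP: nz'; apply: big1 => e eA.
  by have := no e; rewrite /= eA /= => ->; rewrite mul0r.
move: (eA); rewrite inE => /and3P[e2 eG _].
split; first by rewrite eH subUset sub1set inE e2.
case: st => [A0'|<-]; first by rewrite A0' eqxx in A0.
by right; rewrite eH cardsU1 eG.
Qed.

Lemma final_law_stopped (R : realType) (d n : nat) (G : graph n) :
  final_law R d G != 0 -> available d G = set0.
Proof.
move=> /process_law_support[sub [//|cG]].
have GE : G = [set e : {set 'I_n} | #|e| == 2%N].
  by apply/eqP; rewrite eqEcard sub cG card_draws card_ord leqnn.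
apply/setP => e; rewrite !inE; apply/negP => /and3P[e2].
by rewrite GE inE e2.
Qed.

(* Loaded only here because the notations of classical_sets for sets clash with
   those of finset used above. *)
From mathcomp Require Import all_classical all_analysis.
Import numFieldNormedType.Exports.
Local Open Scope classical_set_scope.

Definition asymp_equiv (R : realType) (F : set_system nat) (a b : nat -> R) :
  Prop := (fun n => a n / b n) @ F --> (1 : R).

(* Main.v *)
Require Import Defs.
From mathcomp Require Import all_boot all_order all_algebra.
From mathcomp Require Import reals sequences exp.
From mathcomp Require Import zify ring lra.

Set Implicit Arguments.
Unset Strict Implicit.
Unset Printing Implicit Defensive.

Import Order.TTheory GRing.Theory Num.Theory.

Local Open Scope ring_scope.

(**
  Write the deficiency of a vertex for d minus its degree, and u for the number
  of unsaturated vertices, those of positive deficiency. A step picks an almost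
  uniform pair of unsaturated vertices, so each of them is hit with probability
  about 2 / u. Let s be 2 when d * n is even and 3 when it is odd. Near the end
  almost every unsaturated vertex has deficiency 1, and by parity the process
  fails mainly when the last unsaturated vertex has deficiency s. A vertex of
  deficiency s which is never hit again is this last vertex with probability
  about 1 / u, because (1 - 2 / u) / (u - 2) = 1 / u. Hence the failure
  probability is close to the proportion of vertices of deficiency s among the
  unsaturated ones, read at any late moment. If time advances by 2 / u at each
  step, every vertex is hit like a Poisson process of rate 1, so at time t the
  proportion is about (d-1)!/(d-s)! divided by t ^ (s - 1); and t is close to
  log n when the number of unsaturated vertices is a power of log n. This gives
  (d-1) / log n and (d-1)(d-2) / log^2 n.

  Nothing is conditioned on and no path space is built: all probabilities are
  values of the backward recursion [expect], and [expect_le] says that a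
  function of the graph, possibly also of a clock, bounds such a value as soon
  as it does not increase on average in one step. The proof consists of two
  such functions.

  The end game, [endgame_upper] and [endgame_lower]: from every graph, the
  probability of failure differs from the proportion [share] by at most a
  constant times [risk]. The risk is a weighted count of the configurations of
  one, two or three vertices on which the heuristic above goes wrong: a
  deficiency above s, two unsaturated vertices that are or may become adjacent,
  and so on. No new configuration of this kind ever appears, and one of j
  vertices survives until u vertices are left with probability of order u^j, so
  the weight u^(delta-j) decreases on average by a factor 1 - delta / (2 u) per
  step. This gain pays for all errors made by [share].

  The first phase, [burn_in]: the numbers of vertices of each deficiency stay
  close to n * exp (- t) * t^(d-k) / (d-k)! until u is a power of log n. Here
  the bounding function is a quadratic form in the deviations, [energy], scaled
  by exp (2 t); it contracts because the system of rates is triangular, and the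
  variance it collects is dominated by an increment of exp t. When the bounding
  function reaches 1 there is nothing left to prove, so every estimate may
  assume that the deviations are small.

  The last part inserts the counts found at the end of the first phase into
  [share] and [risk] ([late_share], [risk_le]), which gives an error of relative
  order 1 / sqrt (log n) ([failure_estimate]).
*)

(** * The process as a backward recursion *)

(** The expected value of [g] after [m] more steps from [G]. Conditioning on the
    first step instead of the last lets one-step inequalities propagate. *)
Fixpoint expect (R : realType) (d n : nat) (g : graph n -> R) (m : nat)
    (G : graph n) : R :=
  if m is m'.+1 then \sum_(H : graph n) step_prob R d G H * expect d g m' H
  else g G.

(** Two invariants of the process; the first makes the sum of the degrees even,
    the second lets truncated differences with [d] behave as true ones. *)
Definition admissible (d n : nat) (G : graph n) : bool :=
  [forall e in G, #|e| == 2%N] && [forall v, (degree G v <= d)%N].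

Section Process.

Context (R : realType) (d n : nat).
Implicit Types (G H : graph n) (g : graph n -> R) (e : {set 'I_n}) (v w : 'I_n).

(** Chapman-Kolmogorov: the forward law and the backward recursion meet at any
    intermediate time. *)
Lemma sum_process_law_expect g t m :
  \sum_(G : graph n) process_law R d t G * expect d g m G
  = expect d g (t + m) set0.
Proof.
elim: t m => [|t IH] m.
  rewrite (bigD1 (set0 : graph n)) //= eqxx mul1r big1 ?addr0 // => G.
  by move=> /negbTE ->; rewrite mul0r.
rewrite addSnnS -IH /=.
under eq_bigr do rewrite mulr_suml.
rewrite exchange_big /=; apply: eq_bigr => G _.
by rewrite mulr_sumr; apply: eq_bigr => H _; rewrite mulrA.
Qed.

Lemma prob_final_expect (E : {set graph n}) :
  prob_final R d E = expect d (fun G => (G \in E)%:R) 'C(n, 2) set0.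
Proof.
rewrite -[X in expect _ _ X]addn0 -sum_process_law_expect /prob_final.
rewrite big_mkcond /=; apply: eq_bigr => G _.
by case: (G \in E); rewrite ?mulr1 ?mulr0.
Qed.

Lemma expect_stop g m G : available d G = set0 -> expect d g m G = g G.
Proof.
move=> A0; elim: m => // m IH /=.
rewrite (bigD1 G) //= big1 ?addr0 => [|H HG]; rewrite /step_prob A0 eqxx.
  by rewrite eqxx mul1r.
by rewrite (negbTE HG) mul0r.
Qed.

Lemma expect_step g m G : available d G != set0 ->
  expect d g m.+1 G
  = (\sum_(e in available d G) expect d g m (e |: G)) / #|available d G|%:R.
Proof.
move=> A0 /=; rewrite /step_prob (negbTE A0).
under eq_bigr do rewrite mulr_suml.
rewrite exchange_big mulr_suml; apply: eq_bigr => e _ /=.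
rewrite (bigD1 (e |: G)) //= eqxx mul1r mulrC big1 ?addr0 // => H.
by move=> /negbTE ->; rewrite !mul0r.
Qed.

Lemma expectN g m G : expect d (fun H => - g H) m G = - expect d g m G.
Proof.
elim: m G => //= m IH G; rewrite -sumrN; apply: eq_bigr => H _.
by rewrite IH mulrN.
Qed.

Lemma availableP e G :
  reflect [/\ #|e| = 2%N, e \notin G & forall v, v \in e -> (degree G v < d)%N]
          (e \in available d G).
Proof.
rewrite inE; apply: (iffP and3P) => [[/eqP e2 eG /forallP h]|[e2 eG h]].
  by split=> // v ve; have := h v; rewrite ve.
by split=> //; [exact/eqP | apply/forallP => v; apply/implyP => /h].
Qed.

Lemma degreeU1 e G v : e \notin G ->
  degree (e |: G) v = (degree G v + (v \in e))%N.
Proof.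
move=> eG; rewrite /degree; case: (boolP (v \in e)) => ve.
  have -> : [set f in e |: G | v \in f] = e |: [set f in G | v \in f].
    apply/setP => f; rewrite !inE; by case: (eqVneq f e) => [->|].
  by rewrite cardsU1 inE (negbTE eG) /= addnC.
rewrite addn0; congr #|pred_of_set _|; apply/setP => f; rewrite !inE.
by case: (eqVneq f e) => [->|] //=; rewrite (negbTE ve) andbF.
Qed.

Lemma degree_available e G v : e \in available d G ->
  degree (e |: G) v = (degree G v + (v \in e))%N.
Proof. by case/availableP => _ eG _; exact: degreeU1. Qed.

Lemma admissible_edge G e : admissible d G -> e \in G -> #|e| = 2%N.
Proof. by move=> /andP[/forall_inP h _] /h/eqP. Qed.

Lemma admissible_degree G v : admissible d G -> (degree G v <= d)%N.
Proof. by move=> /andP[_ /forallP]. Qed.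

Lemma admissible_step G e :
  admissible d G -> e \in available d G -> admissible d (e |: G).
Proof.
move=> aG eA; apply/andP; split.
  apply/forall_inP => f; rewrite !inE => /orP[/eqP ->|/(admissible_edge aG) ->//].
  by case/availableP: eA => ->.
apply/forallP => v; rewrite (degree_available _ eA).
case/availableP: eA => _ _ /(_ v); case: (v \in e) => [/(_ isT)|_].
  by rewrite addn1.
by rewrite addn0 admissible_degree.
Qed.

Lemma admissible0 : admissible d (set0 : graph n).
Proof.
apply/andP; split; first by apply/forall_inP => e; rewrite inE.
apply/forallP => v; rewrite /degree (_ : [set _ in _ | _] = set0) ?cards0 //.
by apply/setP => e; rewrite !inE.
Qed.

Lemma handshake G : admissible d G -> (\sum_v degree G v = 2 * #|G|)%N.
Proof.
move=> aG; under eq_bigr => v _.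
  rewrite /degree -sum1_card big_mkcond /=.
  under eq_bigr => e _ do rewrite inE.
  over.
rewrite exchange_big /=.
transitivity (\sum_(e in G) 2)%N; last by rewrite sum_nat_const mulnC.
rewrite [RHS]big_mkcond /=; apply: eq_bigr => e _.
case: ifP => eG /=; last by rewrite big1.
by rewrite -(admissible_edge aG eG) -sum1_card [RHS]big_mkcond.
Qed.

Lemma full_available0 G : admissible d G -> ('C(n, 2) <= #|G|)%N ->
  available d G = set0.
Proof.
move=> aG cG; have GE : G = [set e : {set 'I_n} | #|e| == 2%N].
  apply/eqP; rewrite eqEcard card_draws card_ord cG andbT.
  by apply/subsetP => e eG; rewrite inE (admissible_edge aG eG).
apply/setP => e; rewrite in_set0; apply/negP => /availableP[e2].
by rewrite GE inE e2.
Qed.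

(** Comparison principle. [Phi] has to dominate the expectation directly, or not
    to increase on average over one step. The argument [x] is a clock whose
    increments depend on the path, so that it cannot be read off the graph; as it
    is universally quantified in the induction it may be advanced at will. *)
Lemma expect_le g (clock : graph n -> R) (I : R -> graph n -> Prop)
    (Phi : R -> graph n -> R) :
  (forall x G, I x G -> admissible d G) ->
  (forall x G, I x G ->
    (forall m, ('C(n, 2) <= #|G| + m)%N -> expect d g m G <= Phi x G)
    \/ [/\ available d G != set0,
        forall e, e \in available d G -> I (x + clock G) (e |: G)
      & \sum_(e in available d G) Phi (x + clock G) (e |: G)
          <= #|available d G|%:R * Phi x G]) ->
  forall m x G, I x G -> ('C(n, 2) <= #|G| + m)%N -> expect d g m G <= Phi x G.
Proof.
move=> Iadm step; elim=> [|m IH] x G IG cG.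
  case: (step _ _ IG) => [|[A0 _ _]]; first exact.
  by rewrite full_available0 ?eqxx // in A0; [exact: Iadm IG | rewrite addn0 in cG].
case: (step _ _ IG) => [|[A0 Inext le]]; first exact.
rewrite expect_step // ler_pdivrMr ?ltr0n ?card_gt0 // mulrC.
apply: le_trans le; apply: ler_sum => e eA; apply: IH; first exact: Inext.
by case/availableP: eA => _ eG _; rewrite cardsU1 eG add1n addSnnS.
Qed.

Definition unsat G : {set 'I_n} := [set v | (degree G v < d)%N].
Definition adj G v : nat := #|[set w in unsat G | [set v; w] \in G]|.

Lemma adj_lt G v : admissible d G -> v \in unsat G -> (adj G v < d)%N.
Proof.
move=> aG; rewrite inE; apply: leq_ltn_trans.
rewrite /adj /degree -(@card_in_imset _ _ (fun w => [set v; w])).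
  apply: subset_leq_card; apply/subsetP => _ /imsetP[w + ->].
  by rewrite !inE eqxx => /andP[_ ->].
move=> w1 w2; rewrite !inE => /andP[_ w1G] /andP[_ w2G] E.
have nv w : [set v; w] \in G -> w != v.
  move=> /(admissible_edge aG); apply: contra_eqN => /eqP ->.
  by rewrite setUid cards1.
have : w1 \in [set v; w2] by rewrite -E !inE eqxx orbT.
by rewrite !inE (negbTE (nv _ w1G)) => /eqP.
Qed.

Definition hits G v : nat := #|[set e in available d G | v \in e]|.

(** The partners of [v] are the other unsaturated vertices, except those that
    are already adjacent to it. *)
Lemma hitsE G v : admissible d G -> v \in unsat G ->
  (hits G v + adj G v + 1 = #|unsat G|)%N.
Proof.
move=> aG vS.
have nv w : [set v; w] \in G -> w != v.
  move=> /(admissible_edge aG); apply: contra_eqN => /eqP ->.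
  by rewrite setUid cards1.
pose N := [set w in unsat G | (w != v) && ([set v; w] \notin G)].
have -> : hits G v = #|N|.
  rewrite -(@card_in_imset _ _ (fun w => [set v; w])).
    congr #|pred_of_set _|; apply/setP => e; apply/idP/imsetP.
      rewrite inE => /andP[/availableP[/eqP/cards2P[x [y [xy ->]]] eG h]].
      rewrite !inE => /orP[]/eqP vE; [exists y | exists x].
      - by rewrite !inE h ?inE ?eqxx ?orbT //= vE eq_sym xy.
      - by rewrite vE.
      - by rewrite !inE h ?inE ?eqxx ?orbT //= vE xy setUC.
      - by rewrite vE setUC.
    case=> w; rewrite !inE => /and3P[wS wv wG] ->.
    rewrite !inE eqxx !andbT cards2 (eq_sym v w) wv wG /=; apply/forallP => z.
    by rewrite !inE; apply/implyP => /orP[]/eqP-> //; move: vS; rewrite inE.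
  move=> w1 w2; rewrite !inE => /and3P[_ w1v _] /and3P[_ w2v _] E.
  have : w1 \in [set v; w2] by rewrite -E !inE eqxx orbT.
  by rewrite !inE (negbTE w1v) => /eqP.
rewrite (cardsD1 v (unsat G)) vS addnC /adj; congr addn.
rewrite -(cardsID [set w | [set v; w] \in G] (unsat G :\ v)) addnC.
congr addn; apply: eq_card => w; rewrite !inE.
  by case: (boolP ([set v; w] \in G)) => [/nv ->|_]; rewrite ?andbF ?andbT.
by case: (w == v); case: ([set v; w] \in G); rewrite ?andbF ?andbT.
Qed.

Lemma sum_available (F : 'I_n -> R) G :
  \sum_(e in available d G) \sum_(v in e) F v
  = \sum_(v in unsat G) (hits G v)%:R * F v.
Proof.
transitivity (\sum_(e in available d G) \sum_(v in unsat G) (v \in e)%:R * F v).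
  apply: eq_bigr => e /availableP[_ _ h].
  rewrite (big_mkcond (fun v => v \in e)) [RHS]big_mkcond; apply: eq_bigr => v _.
  rewrite inE; case: (boolP (v \in e)) => [/h -> /=|_]; first by rewrite mul1r.
  by rewrite mul0r if_same.
rewrite exchange_big; apply: eq_bigr => v _ /=.
rewrite -mulr_suml; congr (_ * _).
rewrite /hits -sum1_card natr_sum big_mkcond [RHS]big_mkcond /=.
by apply: eq_bigr => e _; rewrite [in RHS]inE; case: (e \in available d G); case: (v \in e).
Qed.

Lemma card_available G : admissible d G ->
  (2 * #|available d G| + \sum_(v in unsat G) adj G v
   = #|unsat G| * (#|unsat G| - 1))%N.
Proof.
move=> aG; have -> : (2 * #|available d G| = \sum_(v in unsat G) hits G v)%N.
  apply/eqP; rewrite -(eqr_nat R); apply/eqP; rewrite natr_sum.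
  have := sum_available (fun=> 1) G; rewrite (eq_bigr (fun v => (hits G v)%:R));
    last by move=> v _; rewrite mulr1.
  move=> <-; rewrite mulnC natrM -sumr_const mulr_suml.
  by apply: eq_bigr => e /availableP[e2 _ _]; rewrite sumr_const e2 mul1r.
rewrite -big_split /= -sum_nat_const; apply: eq_bigr => v vS.
by rewrite -(hitsE aG vS) addnK.
Qed.

End Process.

Definition deficit (d n : nat) (G : graph n) (v : 'I_n) : nat := (d - degree G v)%N.

(** * A slowly varying weight *)

(** Of the order of [u ^ delta]; as a product it has explicit ratios. *)
Definition slow (R : realType) (delta : R) (u : nat) : R :=
  \prod_(i < u) (1 + delta / i.+1%:R).

Definition weight (R : realType) (delta : R) (u j : nat) : R :=
  slow delta u / u%:R ^+ j.

Section Slow.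
Context (R : realType) (delta : R).
Hypotheses (delta_gt0 : 0 < delta) (delta_le1 : delta <= 1).

Lemma slowS u : slow delta u.+1 = slow delta u * (1 + delta / u.+1%:R).
Proof. by rewrite /slow big_ord_recr. Qed.

Lemma slow_ge1 u : 1 <= slow delta u.
Proof.
elim: u => [|u IH]; first by rewrite /slow big_ord0.
rewrite slowS -[leLHS]mulr1; apply: ler_pM => //.
by rewrite lerDl divr_ge0 // ltW.
Qed.

Lemma slow_gt0 u : 0 < slow delta u.
Proof. exact: lt_le_trans ltr01 (slow_ge1 u). Qed.

Lemma slowSS u : slow delta u * (1 + 2 * delta / u.+2%:R) <= slow delta u.+2.
Proof.
rewrite !slowS -[leRHS]mulrA ler_pM2l ?slow_gt0 //.
have u1 : 0 < u.+1%:R :> R by rewrite ltr0n.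
have u2 : 0 < u.+2%:R :> R by rewrite ltr0n.
have le : delta / u.+2%:R <= delta / u.+1%:R.
  by rewrite ler_pM2l // lef_pV2 ?posrE // ler_nat.
have g0 : 0 <= delta / u.+2%:R by rewrite divr_ge0 // ltW.
have p0 : 0 <= delta / u.+1%:R by rewrite divr_ge0 // ltW.
rewrite -mulrA; move: le g0 p0; set p := delta / _; set q := delta / _ => *; nra.
Qed.

Lemma weightS u j : (0 < u)%N -> weight delta u.+1 j.+1 <= weight delta u j.+1.
Proof.
move=> u0; rewrite /weight slowS.
have u1 : 0 < u%:R :> R by rewrite ltr0n.
have u2 : 0 < u.+1%:R :> R by rewrite ltr0n.
have h1 : (1 + delta / u.+1%:R) * u.+1%:R^-1 <= u%:R^-1.
  rewrite ler_pdivrMr // [leRHS]mulrC ler_pdivlMr // mulrDl mul1r mulrAC -natr1.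
  have : delta * u%:R / (u%:R + 1) <= 1 by rewrite natr1 ler_pdivrMr // mul1r (le_trans (ler_piMl _ delta_le1)) ?ler_nat // ltW.
  lra.
have h2 : (u.+1%:R ^+ j)^-1 <= (u%:R ^+ j)^-1 :> R.
  by rewrite lef_pV2 ?posrE ?exprn_gt0 // lerXn2r ?nnegrE ?ltW // ltr_nat.
rewrite !exprS !invfM -mulrA ler_pM2l ?slow_gt0 // mulrA.
apply: ler_pM; rewrite ?mulr_ge0 ?invr_ge0 ?exprn_ge0 ?addr_ge0 ?divr_ge0 //; exact: ltW.
Qed.

Lemma weight_ge0 u j : 0 <= weight delta u j.
Proof. by rewrite divr_ge0 ?(ltW (slow_gt0 _)) // exprn_ge0. Qed.

Lemma weight_le u v j : (0 < u)%N -> (u <= v)%N -> weight delta v j.+1 <= weight delta u j.+1.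
Proof.
move=> u0 /subnKC <-; elim: (v - u)%N => [|k IH]; first by rewrite addn0.
by rewrite addnS; apply: le_trans IH; apply: weightS; rewrite addn_gt0 u0.
Qed.

Lemma weight_ge u j : (u%:R ^+ j)^-1 <= weight delta u j.
Proof.
by rewrite -[leLHS]mul1r ler_wpM2r ?slow_ge1 // invr_ge0 exprn_ge0.
Qed.

Lemma bernoulli (x : R) j : x <= 1 -> 1 - j%:R * x <= (1 - x) ^+ j.
Proof.
move=> x1; elim: j => [|j IH]; first by rewrite mul0r subr0 expr0.
rewrite exprS -natr1; have : 0 <= 1 - x by rewrite subr_ge0.
have [x0|x0] := leP 0 x; last first.
  have h : 1 <= (1 - x) ^+ j by apply: exprn_ege1; rewrite lerDl oppr_ge0 ltW.
  have : 0 <= j%:R :> R by [].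
  nra.
have : 0 <= j%:R :> R by [].
nra.
Qed.

(** A configuration of [j] vertices is spared with probability about
    [1 - 2 * j / u] while the power [u ^- j] gains the factor [1 + 2 * j / u] when
    [u] drops by 2; what remains is the loss [2 * delta / u] of [slow], of which a
    quarter survives the lower order terms. [A] stands for the number of available
    edges and [a] for those that meet the configuration. The factor
    [1 - delta / 12] accounts for vertices that are hit but stay unsaturated. *)
Lemma weight_decay (u d j : nat) (A a : R) : (j <= 3)%N ->
  12 * (d%:R + 4) <= delta * u.+2%:R -> (0 < u)%N ->
  2 * A <= u.+2%:R ^+ 2 -> 0 <= A ->
  j%:R * (u.+2%:R - d%:R - 3) <= a ->
  weight delta u j * (A - a * (1 - delta / 12))
    <= weight delta u.+2 j * ((1 - delta / 2 / u.+2%:R) * A).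
Proof.
move=> j3 hu u0 hA A0 ha.
have tu : 0 < u%:R :> R by rewrite ltr0n.
have d0 : 0 <= d%:R :> R by [].
set t := u.+2%:R in hu hA ha *.
have t0 : 0 < t by rewrite ltr0n.
have tE : u%:R = t - 2 by rewrite /t -[u.+2]addn2 natrD addrK.
have t2 : 0 < t - 2 by rewrite -tE.
have dt : 12 * (d%:R + 4) <= t by apply: le_trans hu _; rewrite ler_piMl // ltW.
have t1 : 48 <= t by lra.
have jr : 0 <= j%:R :> R by [].
have jr3 : j%:R <= 3 :> R by rewrite (ler_nat _ j 3).
have iv0 : 0 < t^-1 by rewrite invr_gt0.
have tiv : t * t^-1 = 1 by rewrite divff // gt_eqF.
have s0 := slow_gt0 u.
have dl1 : delta <= 1 by [].
have sSS := slowSS u; rewrite -/t in sSS.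
(* the same inequality with the ratio of the two weights made explicit *)
have main : A - a * (1 - delta / 12)
    <= (1 + 2 * delta / t) * (1 - 2 / t) ^+ j * ((1 - delta / 2 / t) * A).
  have ha' : A * (2 * j%:R * (t - d%:R - 3) * t^-1 ^+ 2) <= a.
    apply: le_trans ha.
    have -> : A * (2 * j%:R * (t - d%:R - 3) * t^-1 ^+ 2)
       = (2 * A * t^-1 ^+ 2) * (j%:R * (t - d%:R - 3)) by ring.
    rewrite -[leRHS]mul1r ler_wpM2r //.
      rewrite mulr_ge0 //; lra.
    by rewrite exprVn ler_pdivrMr ?exprn_gt0 // mul1r.
  have B : 1 - j%:R * (2 / t) <= (1 - 2 / t) ^+ j.
    by apply: bernoulli; rewrite ler_pdivrMr // mul1r; lra.
  have key : 1 - 2 * j%:R * (t - d%:R - 3) * t^-1 ^+ 2 * (1 - delta / 12)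
     <= (1 + 2 * delta / t) * (1 - 2 / t) ^+ j * (1 - delta / 2 / t).
    apply: (@le_trans _ _ ((1 + delta / t) * (1 - j%:R * (2 / t)))).
      set x := t^-1 in iv0 tiv *; clearbody x t.
      have -> : 2 * j%:R * (t - d%:R - 3) * x ^+ 2 * (1 - delta / 12)
        = 2 * j%:R * (t * x) * x * (1 - delta / 12)
          - 2 * j%:R * (d%:R + 3) * x ^+ 2 * (1 - delta / 12) by ring.
      rewrite tiv.
      have h1 : 12 * (d%:R + 4) * x <= delta.
        have : 12 * (d%:R + 4) * x <= delta * t * x by rewrite ler_wpM2r // ltW.
        by rewrite -[X in _ <= X -> _]mulrA tiv mulr1.
      have h2 : 0 <= d%:R * x by rewrite mulr_ge0 // ltW.
      have h3 : 2 * j%:R * (d%:R + 3) * x ^+ 2 * (1 - delta / 12)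
          <= 2 * j%:R * (d%:R + 3) * x ^+ 2.
        rewrite -[leRHS]mulr1 ler_wpM2l //; last by lra.
        by apply: mulr_ge0 (sqr_ge0 _); rewrite !mulr_ge0 ?addr_ge0.
      have h4 : x * (2 * j%:R * (delta / 12) + 2 * j%:R * (d%:R + 3) * x
           + 2 * j%:R * delta * x) <= x * delta.
        rewrite (ler_wpM2l (ltW iv0)) //.
        have q : (d%:R + 3) * x + delta * x <= delta / 12 by nra.
        have q0 : 0 <= (d%:R + 3) * x + delta * x by nra.
        have : j%:R * ((d%:R + 3) * x + delta * x) <= 3 * (delta / 12).
          exact: ler_pM.
        have : j%:R * (delta / 12) <= 3 * (delta / 12).
          by rewrite ler_wpM2r // divr_ge0 // ltW.
        lra.
      lra.
    have e0 : 0 <= (1 - 2 / t) ^+ j.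
      by rewrite exprn_ge0 // subr_ge0 ler_pdivrMr // mul1r; lra.
    apply: (@le_trans _ _ ((1 + delta / t) * (1 - 2 / t) ^+ j)).
      by rewrite ler_wpM2l // addr_ge0 // divr_ge0 // ltW.
    rewrite mulrAC ler_wpM2r //.
    set x := t^-1 in iv0 tiv *; clearbody x t.
    have : 0 < delta * x by rewrite mulr_gt0.
    have x2 : x <= 1/2.
      have : 48 * x <= t * x by rewrite ler_wpM2r // ltW.
      lra.
    have : delta * x <= 1/2 by apply: le_trans x2; rewrite ler_piMl // ltW.
    set y := delta * x.
    have -> : 2 * delta * x = 2 * y by rewrite /y; ring.
    have -> : delta / 2 * x = y / 2 by rewrite /y; field.
    nra.
  rewrite [leRHS]mulrA; apply: le_trans (_ : _ <= A * _) _; last first.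
    by rewrite [leRHS]mulrC; apply: ler_wpM2l key.
  have c0 : 0 <= 1 - delta / 12.
    lra.
  have := ler_wpM2r c0 ha'; set M := _ * t^-1 ^+ 2.
  lra.
rewrite /weight tE.
have p0 : 0 < (t - 2) ^+ j by rewrite exprn_gt0.
have q0 : 0 < t ^+ j by rewrite exprn_gt0.
have rat : (t - 2) ^+ j = t ^+ j * (1 - 2 / t) ^+ j.
  by rewrite -exprMn mulrBr mulr1 mulrCA divff ?gt_eqF // mulr1.
apply: (@le_trans _ _ (slow delta u / (t - 2) ^+ j *
    ((1 + 2 * delta / t) * (1 - 2 / t) ^+ j * ((1 - delta / 2 / t) * A)))).
  by rewrite ler_wpM2l // divr_ge0 // ltW.
have -> : slow delta u / (t - 2) ^+ j *
    ((1 + 2 * delta / t) * (1 - 2 / t) ^+ j * ((1 - delta / 2 / t) * A))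
  = (slow delta u * (1 + 2 * delta / t)) / t ^+ j * ((1 - delta / 2 / t) * A).
  have n0 : (1 - 2 / t) ^+ j != 0.
    by move: p0; rewrite rat; case: eqVneq => // ->; rewrite mulr0 ltxx.
  have q1 : t ^+ j != 0 by rewrite gt_eqF.
  rewrite rat; move: q1 n0; set T := t ^+ j; set E := (1 - _) ^+ j.
  set al := 1 + _; set be := _ * A => T0 E0.
  by field; rewrite T0 E0.
rewrite ler_wpM2r //; last by rewrite ler_wpM2r // invr_ge0 ltW.
rewrite mulr_ge0 // subr_ge0 ler_pdivrMr // mul1r; nra.
Qed.

End Slow.

(** * Risky configurations *)

(** Two vertices that are not adjacent can be adjacent and both unsaturated
    later only if the edge between them leaves each a positive deficiency. *)
Definition linked (d n : nat) (G : graph n) (v w : 'I_n) : bool :=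
  ([set v; w] \in G) || ((1 < deficit d G v)%N && (1 < deficit d G w)%N).

(** What can spoil the heuristic that the failure probability is the chance that
    a vertex of deficiency [s] remains alone: a larger deficiency; a pair that may
    remain as two adjacent vertices of total deficiency at least [s]; three
    vertices that may remain pairwise adjacent, or two that may be adjacent next to
    a vertex of deficiency at least [s]. The term [2 * (_ \notin _)] anticipates the
    edge that a nonadjacent pair would have to receive. *)
Definition risky1 (d n s : nat) (G : graph n) (P : {set 'I_n}) : bool :=
  [exists v, (P == [set v]) && (s < deficit d G v)%N].

Definition risky2 (d n s : nat) (G : graph n) (P : {set 'I_n}) : bool :=
  [exists v, exists w, [&& v != w, P == [set v; w], linked d G v w &
     (s + 2 * ([set v; w] \notin G) <= deficit d G v + deficit d G w)%N]].

Definition risky3 (d n s : nat) (G : graph n) (P : {set 'I_n}) : bool :=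
  [exists v, exists w, exists z, [&& [&& v != w, v != z & w != z],
     P == [set v; w; z], linked d G v w &
     (s <= deficit d G z)%N || (linked d G v z && linked d G w z)]].

Definition risky (d n s : nat) (G : graph n) (P : {set 'I_n}) : bool :=
  (P \subset unsat d G) && [|| risky1 d s G P, risky2 d s G P | risky3 d s G P].

(** A hit divides the weight by the large factor [12 / delta], even when the
    vertex stays unsaturated, so that every hit counts as a loss. *)
Definition risk (R : realType) (d n s : nat) (delta : R) (G : graph n) : R :=
  \sum_(P : {set 'I_n} | risky d s G P)
    (12 / delta) ^+ (\sum_(v in P) deficit d G v) * weight delta #|unsat d G| #|P|.

Section Risk.

Context (R : realType) (d n s : nat).
Implicit Types (G H : graph n) (e P : {set 'I_n}) (v w z : 'I_n).

Lemma deficit_step G e v : e \in available d G ->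
  (deficit d (e |: G) v + (v \in e))%N = deficit d G v.
Proof.
move=> eA; rewrite /deficit (degree_available _ eA).
case/availableP: eA => _ _ /(_ v); case: (v \in e) => [/(_ isT)|_]; lia.
Qed.

Lemma deficit_step_le G e v : e \in available d G ->
  (deficit d (e |: G) v <= deficit d G v)%N.
Proof. by move=> /deficit_step <-; exact: leq_addr. Qed.

Lemma unsat_deficit G v : (v \in unsat d G) = (0 < deficit d G v)%N.
Proof. by rewrite inE /deficit subn_gt0. Qed.

Lemma unsat_step G e : e \in available d G ->
  unsat d (e |: G) \subset unsat d G.
Proof.
move=> eA; apply/subsetP => v; rewrite !unsat_deficit => /leq_trans; apply.
exact: deficit_step_le.
Qed.

(** A pair joined by this very step had deficiencies at least 2, since both ends
    are still unsaturated. *)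
Lemma linked_step G e v w : e \in available d G ->
  v \in unsat d (e |: G) -> w \in unsat d (e |: G) ->
  linked d (e |: G) v w -> linked d G v w.
Proof.
move=> eA; rewrite !unsat_deficit /linked !inE => v0 w0.
have ev := deficit_step v eA; have ew := deficit_step w eA.
case/orP => [/orP[/eqP E|->//]|/andP[v1 w1]].
  have [ve we] : v \in e /\ w \in e by rewrite -E !inE !eqxx orbT.
  by move: ev ew; rewrite ve we => ev ew; apply/orP; right; lia.
by rewrite -ev -ew !ltn_addr ?orbT.
Qed.

(** Configurations only disappear: the definitions already allow for the edges
    that a configuration could receive. This is what makes [risk] a sum of
    decaying terms without a source. *)
Lemma risky_step G e P : e \in available d G ->
  risky d s (e |: G) P -> risky d s G P.
Proof.
move=> eA /andP[Psub h]; apply/andP; split.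
  exact: subset_trans Psub (unsat_step eA).
have dle v := deficit_step_le v eA.
case/or3P: h => [/existsP[v /andP[PE sv]]|
   /existsP[v /existsP[w /and4P[vw PE lvw svw]]]|
   /existsP[v /existsP[w /existsP[z /and4P[vwz PE lvw h]]]]].
- apply/or3P/Or31/existsP; exists v; rewrite PE /=.
  exact: leq_trans sv (dle v).
- have [vU wU] : v \in unsat d (e |: G) /\ w \in unsat d (e |: G).
    by split; apply: (subsetP Psub); rewrite (eqP PE) !inE eqxx ?orbT.
  apply/or3P/Or32/existsP; exists v; apply/existsP; exists w.
  rewrite vw PE (linked_step eA vU wU lvw) /=.
  have ev := deficit_step v eA; have ew := deficit_step w eA.
  move: svw; rewrite [_ \in e |: G]inE in_set1.
  case: (eqVneq [set v; w] e) => [E|_] /=; last by case: (_ \in G) => /=; lia.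
  have [ve we] : v \in e /\ w \in e by rewrite -E !inE !eqxx orbT.
  by move: ev ew; rewrite ve we; case: (_ \in G) => /=; lia.
have [vU wU zU] : [/\ v \in unsat d (e |: G), w \in unsat d (e |: G)
    & z \in unsat d (e |: G)].
  by split; apply: (subsetP Psub); rewrite (eqP PE) !inE eqxx ?orbT.
apply/or3P/Or33/existsP; exists v; apply/existsP; exists w; apply/existsP; exists z.
rewrite vwz PE (linked_step eA vU wU lvw) /=.
case/orP: h => [h|/andP[h1 h2]]; first by rewrite (leq_trans h (dle z)).
by rewrite (linked_step eA vU zU h1) (linked_step eA wU zU h2) orbT.
Qed.

Lemma cards3 v w z : v != w -> v != z -> w != z -> #|[set v; w; z]| = 3%N.
Proof.
move=> vw vz wz; rewrite setUC cardsU1 cards2 vw !inE.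
by rewrite (eq_sym z v) (eq_sym z w) (negbTE vz) (negbTE wz).
Qed.

Lemma risky_card G P : risky d s G P -> (0 < #|P| <= 3)%N.
Proof.
case/andP => _ /or3P[/existsP[v /andP[/eqP -> _]]|
   /existsP[v /existsP[w /and4P[vw /eqP -> _ _]]]|
   /existsP[v /existsP[w /existsP[z /and4P[/and3P[vw vz wz] /eqP -> _ _]]]]].
- by rewrite cards1.
- by rewrite cards2 vw.
- by rewrite cards3.
Qed.

(** The vertices of deficiency 1 in the new edge are those that saturate. *)
Lemma unsat_step_card G e : e \in available d G ->
  (#|unsat d (e |: G)| + #|[set v in e | deficit d G v == 1]|
   = #|unsat d G|)%N.
Proof.
move=> eA; rewrite -cardsUI.
have -> : [set v in e | deficit d G v == 1%N] =
   unsat d G :\: unsat d (e |: G).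
  apply/setP => v; rewrite !inE.
  have := deficit_step v eA.
  have /implyP : (v \in e) ==> (degree G v < d)%N.
    by case/availableP: eA => _ _ h; apply/implyP => /h.
  rewrite /deficit; case: (v \in e) => [/(_ isT)|_]; lia.
rewrite setIDA setIC setDIl setDv setI0 cards0 addn0.
have := unsat_step eA => sub; congr #|pred_of_set _|.
apply/setP => v; rewrite in_setU in_setD; have := subsetP sub v.
by case: (v \in unsat d (e |: G)) => //= ->.
Qed.

Lemma unsat_step_ge G e : e \in available d G ->
  (#|unsat d G| <= #|unsat d (e |: G)| + 2)%N.
Proof.
move=> eA; rewrite -(unsat_step_card eA) leq_add2l.
case/availableP: eA => <- _ _; apply: subset_leq_card.
by apply/subsetP => v; rewrite inE => /andP[].
Qed.

Lemma available_unsat G : available d G != set0 -> (1 < #|unsat d G|)%N.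
Proof.
case/set0Pn => e /availableP[<- _ h]; apply: subset_leq_card.
by apply/subsetP => v /h; rewrite inE.
Qed.

Lemma card_set_sum (T : finType) (Q : pred T) :
  #|[set x | Q x]| = (\sum_x Q x)%N.
Proof.
by rewrite -sum1_card big_mkcond; apply: eq_bigr => x _; rewrite inE; case: (Q x).
Qed.

(** Counting edges by their ends in [P] counts an edge twice only when it lies
    inside [P], and there are at most three of those. *)
Lemma hit_count G P : admissible d G -> P \subset unsat d G -> (#|P| <= 3)%N ->
  #|P|%:R * (#|unsat d G|%:R - d%:R - 3)
    <= #|[set e in available d G | e :&: P != set0]|%:R :> R.
Proof.
move=> aG Psub P3.
have hd v : v \in P -> (#|unsat d G| <= hits d G v + d)%N.
  move=> vP; have vS := subsetP Psub _ vP.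
  have := hitsE aG vS; have := adj_lt aG vS; lia.
have le1 : (#|P| * #|unsat d G| <= \sum_(v in P) hits d G v + #|P| * d)%N.
  rewrite -!sum_nat_const -big_split /=; exact: leq_sum hd.
have le2 : (\sum_(v in P) hits d G v <=
    #|[set e in available d G | e :&: P != set0]| +
    #|[set e : {set 'I_n} | e \subset P & #|e| == 2%N]|)%N.
  under eq_bigr => v _ do rewrite /hits card_set_sum.
  rewrite !card_set_sum exchange_big -big_split /=; apply: leq_sum => e _.
  case: (boolP (e \in available d G)) => eA; last by rewrite big1.
  case/availableP: (eA) => e2 _ _; rewrite e2 eqxx andbT /=.
  have -> : (\sum_(v in P) (v \in e) = #|e :&: P|)%N.
    rewrite -sum1_card big_mkcond [RHS]big_mkcond; apply: eq_bigr => v _.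
    by rewrite inE; case: (v \in P); case: (v \in e).
  case: (eqVneq (e :&: P) set0) => [->|ne]; first by rewrite cards0.
  case: (boolP (e \subset P)) => sub; first by rewrite (setIidPl sub) e2.
  rewrite /= addn0 -ltnS -e2; apply: proper_card; apply/properP; split.
    exact: subsetIl.
  case/subsetPn: sub => [v ve vP]; exists v => //.
  by rewrite inE ve (negbTE vP).
rewrite cards_draws in le2.
have le3 : ('C(#|P|, 2) <= 3 * #|P|)%N.
  by case: #|P| P3 => [|[|[|[|]]]].
have : (#|P| * #|unsat d G| <= #|[set e in available d G | e :&: P != set0]|
   + 3 * #|P| + #|P| * d)%N by lia.
rewrite -(ler_nat R) !natrD !natrM; lra.
Qed.

End Risk.

(** * Decay of the risk *)
Definition level (d n : nat) (G : graph n) (k : nat) : {set 'I_n} :=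
  [set v | deficit d G v == k].

Definition risky_sets (d n s : nat) (G : graph n) (j : nat) : {set {set 'I_n}} :=
  [set P | risky d s G P && (#|P| == j)].

Section Drift.

Context (R : realType) (d n s : nat) (delta : R).
Hypotheses (delta_gt0 : 0 < delta) (delta_le1 : delta <= 1).
Implicit Types (G H : graph n) (e P : {set 'I_n}) (v w z : 'I_n).
Local Notation u G := #|unsat d G|.
Local Notation A G := #|available d G|.

Lemma card_available_le G : admissible d G ->
  2 * (A G)%:R <= (u G)%:R * ((u G)%:R - 1) :> R.
Proof.
move=> aG; have := card_available R aG.
have [->|u0] := posnP (u G); first by rewrite mul0n => /eqP; rewrite addn_eq0 => /andP[/eqP h _];
   rewrite mul0r -natrM h.
move=> h; have : (2 * A G <= u G * (u G - 1))%N by lia.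
by rewrite -(ler_nat R) !natrM natrB.
Qed.

Lemma risk_ge0 G : 0 <= risk d s delta G.
Proof.
apply: sumr_ge0 => P _; rewrite mulr_ge0 ?weight_ge0 // exprn_ge0 //.
by rewrite divr_ge0 // ltW.
Qed.

(** Each configuration decays by [weight_decay], and none appears by [risky_step]. *)
Lemma risk_decay G : admissible d G -> 12 * (d%:R + 4) <= delta * (u G)%:R ->
  \sum_(e in available d G) risk d s delta (e |: G)
    <= (1 - delta / 2 / (u G)%:R) * (A G)%:R * risk d s delta G.
Proof.
move=> aG hu; have dl1 : delta <= 1 by [].
have d0 : 0 <= d%:R :> R by [].
have u48 : 48 <= (u G)%:R :> R.
  by apply: le_trans (ler_piMl _ dl1) => //; lra.
have {u48}u3 : (2 < u G)%N by rewrite -(ltr_nat R); apply: lt_le_trans u48; lra.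
set gam := 12 / delta; have gam0 : 0 < gam by rewrite divr_gt0.
have gam1 : 1 <= gam by rewrite ler_pdivlMr // mul1r; lra.
pose dd H P := (\sum_(v in P) deficit d H v)%N.
apply: (@le_trans _ _ (\sum_(e in available d G) \sum_(P | risky d s G P)
   gam ^+ dd (e |: G) P * weight delta (u G - 2) #|P|)).
  apply: ler_sum => e eA; rewrite /risk -/gam.
  rewrite [leRHS](bigID (fun P => risky d s (e |: G) P)) /=.
  rewrite -[leLHS]addr0; apply: lerD; last first.
    by apply: sumr_ge0 => P _; rewrite mulr_ge0 ?weight_ge0 // exprn_ge0 // ltW.
  rewrite [leRHS](eq_bigl (risky d s (e |: G))); last first.
    move=> P; apply/andP/idP => [[]//|h]; split=> //; exact: risky_step eA h.
  apply: ler_sum => P rP; apply: ler_wpM2l; first by rewrite exprn_ge0 // ltW.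
  have /andP[P0 _] := risky_card rP; rewrite -(prednK P0).
  apply: weight_le => //; first by rewrite subn_gt0.
  by rewrite leq_subLR addnC; exact: unsat_step_ge.
rewrite exchange_big /= mulr_sumr; apply: ler_sum => P rP.
rewrite -mulr_suml.
have /andP[P0 P3] := risky_card rP.
pose a := #|[set e in available d G | e :&: P != set0]|%:R : R.
have hits_le : \sum_(e in available d G) gam ^+ dd (e |: G) P
    <= gam ^+ dd G P * ((A G)%:R - a * (1 - delta / 12)).
  have -> : gam ^+ dd G P * ((A G)%:R - a * (1 - delta / 12)) =
     \sum_(e in available d G) gam ^+ dd G P *
        (1 - (e :&: P != set0)%:R * (1 - delta / 12)).
    rewrite -mulr_sumr sumrB sumr_const -mulr_suml; congr (_ * (_ - _ * _)).
    rewrite /a card_set_sum natr_sum [RHS]big_mkcond; apply: eq_bigr => e _.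
    by case: (e \in available d G).
  apply: ler_sum => e eA.
  have ddE : (dd (e |: G) P + #|e :&: P| = dd G P)%N.
    rewrite /dd; under [RHS]eq_bigr => v _ do rewrite -(deficit_step v eA).
    rewrite big_split /=; congr addn.
    rewrite -sum1_card big_mkcond [RHS]big_mkcond; apply: eq_bigr => v _.
    by rewrite inE; case: (v \in P); case: (v \in e).
  case: (eqVneq (e :&: P) set0) => [E|ne] /=.
    by rewrite mul0r subr0 mulr1 -ddE E cards0 addn0.
  have lt0 : (dd (e |: G) P < dd G P)%N by rewrite -ddE -addn1 leq_add2l card_gt0.
  have g12 : gam * (delta / 12) = 1 by rewrite /gam; field; rewrite gt_eqF.
  rewrite -(subnKC lt0) addSn exprS exprD mul1r subKr mulrAC g12 mul1r.
  by rewrite ler_peMr ?exprn_ge0 ?exprn_ege1 // ltW.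
apply: le_trans (ler_wpM2r (weight_ge0 _ _ _) hits_le) _ => //.
rewrite -[leLHS]mulrA [leRHS]mulrCA; apply: ler_wpM2l; first by rewrite exprn_ge0 // ltW.
rewrite mulrC [leRHS]mulrC; have -> : u G = (u G - 2).+2 by lia.
rewrite [in leLHS](_ : ((u G - 2).+2 - 2)%N = (u G - 2)%N); last by lia.
apply: (@weight_decay R delta _ _ _ d) => //.
- by rewrite (_ : (u G - 2).+2 = u G) //; lia.
- by rewrite subn_gt0.
- rewrite (_ : (u G - 2).+2 = u G); last by lia.
  by apply: le_trans (card_available_le aG) _; rewrite expr2 ler_wpM2l // lerBlDr lerDl.
rewrite (_ : (u G - 2).+2 = u G); last by lia.
by apply: hit_count => //; case/andP: rP.
Qed.

(** Both factors of a weight beyond the power of [u] are at least 1. *)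
Lemma risk_ge G : (0 < u G)%N ->
  #|risky_sets d s G 1|%:R / (u G)%:R + #|risky_sets d s G 2|%:R / (u G)%:R ^+ 2
    + #|risky_sets d s G 3|%:R / (u G)%:R ^+ 3 <= risk d s delta G.
Proof.
move=> u0; have dl1 : delta <= 1 by [].
have gam1 : 1 <= 12 / delta by rewrite ler_pdivlMr // mul1r; lra.
apply: (@le_trans _ _ (\sum_(P | risky d s G P) ((u G)%:R ^+ #|P|)^-1)); last first.
  apply: ler_sum => P _; rewrite -[leLHS]mul1r; apply: ler_pM => //.
  - by rewrite invr_ge0 exprn_ge0.
  - exact: exprn_ege1.
  exact: weight_ge.
have E j : #|risky_sets d s G j|%:R / (u G)%:R ^+ j
   = \sum_(P | risky d s G P) (#|P| == j)%:R / (u G)%:R ^+ j :> R.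
  rewrite -mulr_suml; congr (_ / _); rewrite card_set_sum natr_sum [RHS]big_mkcond.
  by apply: eq_bigr => P _; case: (risky d s G P).
rewrite -[X in _ / X + _ + _]expr1 !E -!big_split /=; apply: ler_sum => P rP.
have := risky_card rP; case: #|P| => [|[|[|[|//]]]] //= _;
  by rewrite ?mul0r ?mul1r ?addr0 ?add0r.
Qed.

Lemma card_fibre (T : finType) (Q : {set T}) (f : T -> {set 'I_n})
    (Y : {set {set 'I_n}}) (k : nat) :
  (forall x, x \in Q -> f x \in Y) ->
  (forall P, P \in Y -> (#|[set x in Q | f x == P]| <= k)%N) ->
  (#|Q| <= k * #|Y|)%N.
Proof.
move=> QY hk.
rewrite -sum1_card (partition_big f (fun P => P \in Y)) //= mulnC -sum_nat_const.
apply: leq_sum => P /hk; rewrite -sum1_card.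
by under eq_bigl do rewrite inE.
Qed.

Lemma card_pairs (Q : {set 'I_n * 'I_n}) (Y : {set {set 'I_n}}) :
  (forall x, x \in Q -> [set x.1; x.2] \in Y) ->
  (forall P, P \in Y -> #|P| = 2%N) -> (#|Q| <= 4 * #|Y|)%N.
Proof.
move=> QY hY; apply: (@card_fibre _ _ (fun x => [set x.1; x.2])) => // P /hY P2.
have -> : 4%N = #|setX P P| by rewrite cardsX P2.
apply: subset_leq_card; apply/subsetP => -[v w] /=; rewrite !inE /=.
by move=> /andP[_ /eqP <-]; rewrite !inE !eqxx orbT.
Qed.

Lemma card_triples (Q : {set 'I_n * 'I_n * 'I_n}) (Y : {set {set 'I_n}}) :
  (forall x, x \in Q -> [set x.1.1; x.1.2; x.2] \in Y) ->
  (forall P, P \in Y -> #|P| = 3%N) -> (#|Q| <= 27 * #|Y|)%N.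
Proof.
move=> QY hY.
apply: (@card_fibre _ _ (fun x => [set x.1.1; x.1.2; x.2])) => // P /hY P3.
have -> : 27%N = #|setX (setX P P) P| by rewrite !cardsX P3.
apply: subset_leq_card; apply/subsetP => -[[v w] z] /=; rewrite !inE /=.
by move=> /andP[_ /eqP <-]; rewrite !inE !eqxx !orbT.
Qed.

End Drift.

(** * The proportion of critical vertices *)
Definition share (R : realType) (d n s : nat) (G : graph n) : R :=
  #|level d G s|%:R / #|unsat d G|%:R.

Section Share.

Context (R : realType) (d n s : nat).
Hypothesis s_gt0 : (0 < s)%N.
Implicit Types (G H : graph n) (e P : {set 'I_n}) (v w z : 'I_n).
Local Notation u G := #|unsat d G|.
Local Notation A G := #|available d G|.

Lemma sum_cst (T : finType) (S : {set T}) (x : R) : \sum_(v in S) x = x * #|S|%:R.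
Proof. by rewrite sumr_const mulr_natr. Qed.

Lemma level_unsat G v : v \in level d G s -> v \in unsat d G.
Proof. by rewrite unsat_deficit inE => /eqP ->. Qed.

Lemma level_step G e : e \in available d G ->
  level d (e |: G) s = (level d G s :\: e) :|: (level d G s.+1 :&: e).
Proof.
move=> eA; apply/setP => v; rewrite !inE; have := deficit_step v eA.
by case: (v \in e) => /=; lia.
Qed.

Lemma card_level_step G e : e \in available d G ->
  #|level d (e |: G) s|%:R = \sum_(v in level d G s) (v \notin e)%:R
     + \sum_(v in level d G s.+1) (v \in e)%:R :> R.
Proof.
move=> eA; rewrite (level_step eA) cardsU.
rewrite (_ : _ :&: (_ :&: e) = set0) ?cards0 ?subn0; last first.
  by apply/setP => v; rewrite !inE; case: (v \in e); rewrite ?andbF.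
rewrite natrD; congr (_ + _); rewrite -sum1_card natr_sum big_mkcond [RHS]big_mkcond;
apply: eq_bigr => v _; rewrite !inE.
  by case: (v \in e); case: eqP.
by case: (v \in e); case: eqP.
Qed.

Lemma hits_real G v : admissible d G -> v \in unsat d G ->
  (hits d G v)%:R = (u G)%:R - 1 - (adj d G v)%:R :> R.
Proof. by move=> aG vS; rewrite -(hitsE aG vS) !natrD; ring. Qed.

Lemma sum_notin G v : admissible d G -> v \in unsat d G ->
  \sum_(e in available d G) (v \notin e)%:R
  = (A G)%:R - ((u G)%:R - 1 - (adj d G v)%:R) :> R.
Proof.
move=> aG vS; rewrite -hits_real // /hits card_set_sum -sumr_const natr_sum.
rewrite [X in _ - X](_ : _ = \sum_(e in available d G) (v \in e)%:R :> R).
  by rewrite -sumrB; apply: eq_bigr => e _; case: (v \in e); rewrite ?subrr ?subr0.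
by rewrite [RHS]big_mkcond; apply: eq_bigr => e _; case: (e \in available d G).
Qed.

Lemma sum_in G v : admissible d G -> v \in unsat d G ->
  \sum_(e in available d G) (v \in e)%:R
  = (u G)%:R - 1 - (adj d G v)%:R :> R.
Proof.
move=> aG vS; rewrite -hits_real // /hits card_set_sum natr_sum big_mkcond.
by apply: eq_bigr => e _; case: (e \in available d G).
Qed.

(** An unhit vertex of level [s] keeps its place, and [u] drops by at most 2. If
    no unsaturated neighbour gets in the way the hit probability is at least
    [2 / u], and [(1 - 2 / u) / (u - 2) = 1 / u] gives the bound exactly. The error
    terms come from neighbours, which are hit less often, and from the level above,
    which feeds level [s]. *)
Lemma share_upper G : admissible d G -> (2 < u G)%N ->
  \sum_(e in available d G) share R d s (e |: G)
    <= (A G)%:R * share R d s G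
       + (\sum_(v in level d G s) (adj d G v)%:R
          + #|level d G s.+1|%:R * (u G)%:R) / ((u G)%:R - 2).
Proof.
move=> aG u2; set t := (u G)%:R : R.
have t2 : 2 < t by rewrite (ltr_nat R 2).
have t20 : 0 < t - 2 by rewrite subr_gt0.
have ste e : e \in available d G ->
    share R d s (e |: G) <= (\sum_(v in level d G s) (v \notin e)%:R
     + \sum_(v in level d G s.+1) (v \in e)%:R) / (t - 2).
  move=> eA; rewrite /share card_level_step //; apply: ler_wpM2l.
    by rewrite addr_ge0 // sumr_ge0.
  have := unsat_step_ge eA; rewrite -(ler_nat R) natrD => h.
  have h' : t - 2 <= (u (e |: G))%:R by rewrite lerBlDr.
  by rewrite lef_pV2 ?posrE //; apply: lt_le_trans h'.
apply: le_trans (ler_sum _ ste) _.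
rewrite -mulr_suml big_split /= exchange_big /= [X in _ + X]exchange_big /=.
rewrite (eq_bigr (fun v => (A G)%:R - (t - 1 - (adj d G v)%:R))); last first.
  by move=> v /level_unsat vS; rewrite sum_notin.
have h1 : \sum_(v in level d G s.+1) \sum_(e in available d G) (v \in e)%:R
    <= #|level d G s.+1|%:R * t.
  rewrite mulr_natl -sumr_const; apply: ler_sum => v.
  rewrite inE => vl; have vS : v \in unsat d G by rewrite unsat_deficit (eqP vl).
  rewrite sum_in //; have : 0 <= (adj d G v)%:R :> R by []. lra.
apply: (@le_trans _ _ ((\sum_(v in level d G s) ((A G)%:R - (t - 1 - (adj d G v)%:R))
   + #|level d G s.+1|%:R * t) / (t - 2))).
  by rewrite ler_wpM2r ?invr_ge0 ?(ltW t20) // lerD2l.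
rewrite ler_pdivrMr // mulrDl divfK ?gt_eqF // addrA lerD2r /share -/t.
rewrite sumrB sum_cst sumrB sum_cst.
set U := #|level d G s|%:R; set a := (A G)%:R; set S := \sum_(_ in _) _.
have hA : 2 * a <= t * (t - 1) by exact: card_available_le.
have -> : a * (U / t) * (t - 2) = a * U - (2 * a) * (U / t).
  by rewrite mulrBr; field; lra.
have : 2 * a * (U / t) <= U * (t - 1).
  have -> : U * (t - 1) = t * (t - 1) * (U / t) by field; lra.
  by rewrite ler_wpM2r // divr_ge0 //; lra.
lra.
Qed.

Definition heavy_pairs G : {set 'I_n * 'I_n} :=
  [set x | [&& x.1 \in level d G s, x.2 \in unsat d G, x.2 != x.1
             & (1 < deficit d G x.2)%N]].

(** Each vertex of deficiency at least 2 in the new edge slows the decrease of the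
    number of unsaturated vertices by one. *)
Lemma unsat_step_heavy G e : e \in available d G ->
  (u (e |: G) + 2 = u G + #|[set v in e | (1 < deficit d G v)%N]|)%N.
Proof.
move=> eA; rewrite -(unsat_step_card eA) -addnA; congr addn.
case/availableP: eA => e2 _ h; rewrite -{1}e2.
rewrite -(cardsID [set v | deficit d G v == 1%N] e); congr addn.
  by apply: eq_card => v; rewrite !inE.
apply: eq_card => v; rewrite !inE andbC; case: (boolP (v \in e)) => //= /h.
by rewrite -subn_gt0 /deficit; case: (d - _)%N => [|[]].
Qed.

(** Conversely [u] drops by exactly 2 unless another vertex of deficiency at least
    2 is hit, and the hit probability exceeds [2 / u] only through the adjacent
    pairs, which are missing from the available ones. *)
Lemma share_lower G : admissible d G -> (2 < u G)%N ->
  (A G)%:R * share R d s G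
    - (#|level d G s|%:R * \sum_(v in unsat d G) (adj d G v)%:R
       + 2 * ((u G)%:R - 1) * #|heavy_pairs G|%:R) / ((u G)%:R * ((u G)%:R - 2))
  <= \sum_(e in available d G) share R d s (e |: G).
Proof.
move=> aG u2; set t := (u G)%:R : R.
have t2 : 2 < t by rewrite (ltr_nat R 2).
have t20 : 0 < t - 2 by rewrite subr_gt0.
have t0 : 0 < t by lra.
pose c e := \sum_(w in e) (1 < deficit d G w)%:R : R.
(* u drops by 2 - c e; the linear lower bound of 1 / u is exact for c e = 0 and
   holds from c e = 1 on, but not in between *)
have ste e : e \in available d G ->
   \sum_(v in level d G s) ((v \notin e)%:R / (t - 2)
     - 2 / (t * (t - 2)) * ((v \notin e)%:R * c e)) <= share R d s (e |: G).
  move=> eA; rewrite /share card_level_step // [leRHS]mulrDl -[leLHS]addr0.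
  apply: lerD; last by rewrite divr_ge0 // sumr_ge0.
  rewrite mulr_suml; apply: ler_sum => v _.
  rewrite mulrCA -mulrBr; apply: ler_wpM2l => //.
  have := unsat_step_heavy eA => /(congr1 (fun k => k%:R : R)).
  rewrite !natrD -/t => cE.
  have cE' : c e = #|[set v0 in e | (1 < deficit d G v0)%N]|%:R.
    rewrite /c card_set_sum natr_sum big_mkcond; apply: eq_bigr => w _.
    by case: (w \in e).
  have c2 : c e <= 2.
    rewrite cE' (ler_nat R _ 2); case/availableP: (eA) => <- _ _.
    by apply: subset_leq_card; apply/subsetP => w; rewrite inE => /andP[].
  have c01 : c e = 0 \/ 1 <= c e.
    by rewrite cE'; case: #|_| => [|k]; [left | right; rewrite ler1n].
  have c0 : 0 <= c e by rewrite cE'.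
  move: cE; rewrite -cE' => cE.
  have -> : (u (e |: G))%:R = t - 2 + c e by lra.
  have -> : (t - 2)^-1 - 2 / (t * (t - 2)) * c e = (t - 2 * c e) / (t * (t - 2)).
    by field; apply/andP; split; lra.
  rewrite ler_pdivrMr ?mulr_gt0 // [leRHS]mulrC ler_pdivlMr; last by lra.
  by case: c01 => [->|c1]; nra.
apply: le_trans (ler_sum _ ste); rewrite exchange_big /=.
under [leRHS]eq_bigr => v _ do rewrite sumrB -mulr_suml -mulr_sumr.
apply: (@le_trans _ _ (\sum_(v in level d G s)
   (((A G)%:R - (t - 1)) / (t - 2) - 2 / (t * (t - 2)) *
      ((t - 1) * #|[set w in unsat d G | (w != v) && (1 < deficit d G w)%N]|%:R)))).
  rewrite sumrB sum_cst -mulr_sumr -mulr_sumr.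
  have -> : \sum_(v in level d G s)
      #|[set w in unsat d G | (w != v) && (1 < deficit d G w)%N]|%:R
      = #|heavy_pairs G|%:R :> R.
    rewrite card_set_sum natr_sum big_mkcond /=.
    rewrite (eq_bigr (fun v => \sum_w ([&& v \in level d G s, w \in unsat d G, w != v
             & (1 < deficit d G w)%N])%:R)); last first.
      move=> v _; rewrite card_set_sum natr_sum.
      by case: (v \in level d G s) => //; rewrite big1.
    by rewrite pair_big.
  rewrite /share -/t.
  have aE : 2 * (A G)%:R = t * (t - 1) - \sum_(v in unsat d G) (adj d G v)%:R :> R.
    have := card_available R aG; have u1 : (0 < u G)%N by lia.
    move=> /(congr1 (fun k => k%:R : R)).
    by rewrite natrD !natrM natr_sum natrB // -/t => <-; ring.
  set S := \sum_(_ in _) _ in aE *; set a := (A G)%:R in aE *.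
  have -> : S = t * (t - 1) - 2 * a by lra.
  rewrite le_eqVlt; apply/orP; left; apply/eqP; field.
  by apply/andP; split; lra.
apply: ler_sum => v vl; have vS := level_unsat vl.
apply: lerB.
  rewrite ler_wpM2r ?invr_ge0 ?(ltW t20) // sum_notin // -/t.
  have : 0 <= (adj d G v)%:R :> R by []. lra.
apply: ler_wpM2l; first by rewrite divr_ge0 // mulr_ge0 // ltW.
pose F w : R := ((w != v) && (1 < deficit d G w)%N)%:R.
apply: (@le_trans _ _ (\sum_(e in available d G) \sum_(w in e) F w)).
  apply: ler_sum => e _; rewrite /c mulr_sumr; apply: ler_sum => w we.
  by rewrite /F; case: (eqVneq w v) we => [-> ->|_ _]; rewrite ?mul0r //= ler_piMl // lern1 leq_b1.
rewrite sum_available card_set_sum natr_sum mulr_sumr big_mkcond /=.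
apply: ler_sum => w _; case: (boolP (w \in unsat d G)) => wS /=; last by rewrite mulr0.
rewrite /F ler_wpM2r // hits_real // -/t.
by have : 0 <= (adj d G w)%:R :> R by []; lra.
Qed.

End Share.

(** * The end game *)
Definition failure (R : realType) (d n : nat) (G : graph n) : R :=
  (G \in not_saturating d n)%:R.

Section Endgame.

Context (R : realType) (d n s : nat) (delta : R) (u0 : nat) (C : R).
Hypotheses (delta_gt0 : 0 < delta) (delta_le1 : delta <= 1).
Hypothesis s_def : s = (odd (d * n)).+2.
Hypotheses (u0_large : 12 * (d%:R + 4) <= delta * u0%:R).
Hypotheses (C_large : 432 / delta <= C) (C_large' : u0%:R ^+ 3 <= C).
Implicit Types (G H : graph n) (e P : {set 'I_n}) (v w z : 'I_n).
Local Notation u G := #|unsat d G|.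
Local Notation A G := #|available d G|.
Local Notation x G j := #|risky_sets d s G j|.
Local Notation fail := (@failure R d n).

Let s_gt1 : (1 < s)%N. Proof. by rewrite s_def. Qed.
Let s_gt0 : (0 < s)%N. Proof. exact: ltnW. Qed.

Lemma expect_01 (g : graph n -> R) m G : (forall H, 0 <= g H <= 1) ->
  0 <= expect d g m G <= 1.
Proof.
move=> hg; elim: m G => [|m IH] G //=; apply/andP; split.
  by apply: sumr_ge0 => H _; rewrite mulr_ge0 ?step_prob_ge0 //; case/andP: (IH H).
rewrite -(sum_step_prob R d G); apply: ler_sum => H _.
by rewrite ler_piMr ?step_prob_ge0 //; case/andP: (IH H).
Qed.

Lemma failure_01 G : 0 <= fail G <= 1.
Proof. by rewrite /failure ler0n lern1 leq_b1. Qed.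

Lemma u0_ge : (2 * d + 48 <= u0)%N.
Proof.
have dl1 : delta <= 1 by [].
have d0 : 0 <= d%:R :> R by [].
have : 12 * (d%:R + 4) <= u0%:R :> R.
  by apply: le_trans u0_large _; rewrite ler_piMl.
move=> h; rewrite -(ler_nat R) natrD natrM; lra.
Qed.

Lemma share_ge0 G : 0 <= share R d s G.
Proof. by rewrite divr_ge0. Qed.

Lemma share_le1 G : share R d s G <= 1.
Proof.
rewrite /share; have [->|u_gt0] := posnP (u G); first by rewrite invr0 mulr0.
rewrite ler_pdivrMr ?ltr0n // mul1r ler_nat; apply: subset_leq_card.
by apply/subsetP => v; exact: level_unsat.
Qed.

(** The deficiencies add up to [d * n] minus twice the number of edges. *)
Lemma odd_deficits G : admissible d G ->
  odd (\sum_v deficit d G v) = odd (d * n).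
Proof.
move=> aG; have : (\sum_v deficit d G v + 2 * #|G| = n * d)%N.
  rewrite -(handshake aG) -big_split /= (eq_bigr (fun=> d)).
    by rewrite sum_nat_const card_ord.
  by move=> v _; rewrite subnK // admissible_degree.
by move=> /(congr1 odd); rewrite oddD oddM /= addbF mulnC.
Qed.

Lemma sum_deficits G : (\sum_v deficit d G v = \sum_(v in unsat d G) deficit d G v)%N.
Proof.
rewrite [RHS]big_mkcond; apply: eq_bigr => v _; rewrite unsat_deficit.
by case: (deficit d G v).
Qed.

Lemma stopped_clique G v w : available d G = set0 ->
  v \in unsat d G -> w \in unsat d G -> v != w -> [set v; w] \in G.
Proof.
move=> A0 vS wS vw; apply: contraT => vwG.
have : [set v; w] \in available d G.
  apply/availableP; split; rewrite ?cards2 ?vw // => z.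
  by rewrite !inE => /orP[]/eqP ->; [move: vS | move: wS]; rewrite inE.
by rewrite A0 inE.
Qed.

(** The unsaturated vertices of a stopped graph form a clique, and an unsaturated
    vertex has fewer than [d] neighbours. *)
Lemma stopped_card G : admissible d G -> available d G = set0 -> (u G <= d)%N.
Proof.
move=> aG A0; have [->//|/set0Pn[v vS]] := eqVneq (unsat d G) set0.
  by rewrite cards0.
have := hitsE aG vS; have := adj_lt aG vS.
have -> : hits d G v = 0%N.
  by apply/eqP; rewrite cards_eq0 -subset0 -A0; apply/subsetP => e; rewrite inE => /andP[].
lia.
Qed.

Lemma admissible_edge_neq G v w : admissible d G -> [set v; w] \in G -> v != w.
Proof.
by move=> aG /(admissible_edge aG); apply: contra_eqN => /eqP ->; rewrite setUid cards1.
Qed.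

(** Once at most [u0] vertices are unsaturated the weight of a single
    configuration is bounded below, so the bound of the end game is trivial there
    unless no configuration is left at all. *)
Lemma risky_small G P : risky d s G P -> (u G <= u0)%N -> 1 <= C * risk d s delta G.
Proof.
move=> rP uu; have dl1 : delta <= 1 by [].
have uP : (0 < u G)%N.
  have /andP[P0 _] := risky_card rP; apply: leq_trans P0 _.
  by apply: subset_leq_card; case/andP: rP.
have t0 : 0 < (u G)%:R :> R by rewrite ltr0n.
have C0 : 0 <= C by apply: le_trans C_large'; rewrite exprn_ge0.
have gam1 : 1 <= 12 / delta by rewrite ler_pdivlMr // mul1r; lra.
have : ((u G)%:R ^+ 3)^-1 <= risk d s delta G.
  rewrite /risk (bigD1 P) //= -[leLHS]addr0; apply: lerD; last first.
    by apply: sumr_ge0 => Q _; rewrite mulr_ge0 ?weight_ge0 // exprn_ge0 //; lra.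
  rewrite -[leLHS]mul1r; apply: ler_pM => //.
  - by rewrite invr_ge0 exprn_ge0.
  - exact: exprn_ege1.
  apply: le_trans (weight_ge _ _ _) => //.
  rewrite lef_pV2 ?posrE ?exprn_gt0 //; apply: ler_weXn2l; first by rewrite ler1n.
  by case/andP: (risky_card rP).
move=> /(ler_wpM2l C0); apply: le_trans.
rewrite ler_pdivlMr ?exprn_gt0 // mul1r; apply: le_trans C_large'.
by apply: lerXn2r; rewrite ?nnegrE // ler_nat.
Qed.

Lemma risky_pair G v w : v \in unsat d G -> w \in unsat d G -> v != w ->
  linked d G v w -> (s + 2 * ([set v; w] \notin G) <= deficit d G v + deficit d G w)%N ->
  [set v; w] \in risky_sets d s G 2.
Proof.
move=> vS wS vw lvw h; rewrite inE cards2 vw eqxx andbT /risky; apply/andP; split.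
  by apply/subsetP => z; rewrite !inE => /orP[]/eqP ->; [move: vS | move: wS]; rewrite inE.
apply/or3P/Or32; apply/existsP; exists v; apply/existsP; exists w.
by rewrite vw eqxx lvw.
Qed.

Lemma risky_triple G v w z : v \in unsat d G -> w \in unsat d G -> z \in unsat d G ->
  v != w -> v != z -> w != z -> linked d G v w ->
  (s <= deficit d G z)%N || (linked d G v z && linked d G w z) ->
  [set v; w; z] \in risky_sets d s G 3.
Proof.
move=> vS wS zS vw vz wz lvw h; rewrite inE cards3 // eqxx andbT /risky; apply/andP; split.
  apply/subsetP => y; rewrite !inE => /orP[/orP[]|]/eqP ->;
  by [move: vS; rewrite inE | move: wS; rewrite inE | move: zS; rewrite inE].
apply/or3P/Or33; apply/existsP; exists v; apply/existsP; exists w; apply/existsP; exists z.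
by rewrite vw vz wz eqxx lvw.
Qed.

Lemma odd2_le c : (1 < c)%N -> ((odd c).+2 <= c)%N.
Proof.
by case: c => [|[|[|c]]] // _; rewrite !ltnS (leq_trans (leq_b1 _)).
Qed.

(** A stopped graph that is not saturated has a single unsaturated vertex, of
    deficiency at least [s] by parity, or two adjacent ones of total deficiency at
    least [s], again by parity, or three pairwise adjacent ones. The first case
    with deficiency [s] is counted by [share], all others by [risk]. *)
Lemma stopped_upper G : admissible d G -> available d G = set0 ->
  fail G <= share R d s G + C * risk d s delta G.
Proof.
move=> aG A0; have ud := stopped_card aG A0.
have uu0 : (u G <= u0)%N by have := u0_ge; move: ud; clear; lia.
have C0 : 0 <= C by apply: le_trans C_large'; rewrite exprn_ge0.
have nn : 0 <= C * risk d s delta G by rewrite mulr_ge0 ?risk_ge0.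
rewrite /failure inE; case: (boolP (saturated d G)) => [|ns] /=.
  by rewrite addr_ge0 ?share_ge0.
have risk1 P : risky d s G P -> 1 <= share R d s G + C * risk d s delta G.
  by move=> /risky_small /(_ uu0) h; rewrite (le_trans h) // lerDr share_ge0.
have satE v : v \notin unsat d G -> degree G v = d.
  by rewrite inE => h; apply/eqP; rewrite eqn_leq (admissible_degree _ aG) leqNgt.
have [u0E|] := posnP (u G).
  case/negP: ns; apply/orP; left; apply/forallP => v; apply/eqP/satE.
  by move/eqP: u0E; rewrite cards_eq0 => /eqP ->; rewrite inE.
have par := odd_deficits aG; rewrite sum_deficits in par.
case uE : (u G) => [//|[|[|k]]] _.
- move/eqP/cards1P: uE => [v SE]; rewrite SE big_set1 in par.
  have vS : v \in unsat d G by rewrite SE set11.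
  have v0 := vS; rewrite unsat_deficit in v0.
  have v1 : deficit d G v != 1%N.
    apply: contra ns => /eqP v1; apply/orP; right; apply/existsP; exists v.
    apply/andP; split; first by move: v1 v0; rewrite /deficit; clear => v1 v0; apply/eqP; lia.
    apply/forallP => w; apply/implyP => wv; apply/eqP/satE.
    by rewrite SE inE.
  have sv : (s <= deficit d G v)%N.
    by rewrite s_def -par odd2_le // ltn_neqAle eq_sym v1.
  have [vs|sv'] := eqVneq (deficit d G v) s.
    have -> : share R d s G = 1.
      rewrite /share SE cards1 (_ : level d G s = [set v]) ?cards1 ?divr1 //.
      apply/setP => w; rewrite !inE; apply/eqP/eqP => [ws|-> //].
      have : w \in unsat d G by rewrite unsat_deficit ws.
      by rewrite SE inE => /eqP.
    by rewrite lerDl.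
  apply: (risk1 [set v]); rewrite /risky SE subxx /=; apply/orP; left.
  by apply/existsP; exists v; rewrite eqxx /= ltn_neqAle eq_sym sv' sv.
- move/eqP/cards2P: uE => [v [w [vw SE]]].
  have [vS wS] : v \in unsat d G /\ w \in unsat d G.
    by rewrite SE !inE !eqxx orbT.
  have E := stopped_clique A0 vS wS vw.
  rewrite SE big_setU1 ?inE //= big_set1 in par.
  have : [set v; w] \in risky_sets d s G 2.
    apply: risky_pair => //; first by rewrite /linked E.
    rewrite E muln0 addn0 s_def -par odd2_le //.
    by move: vS wS; rewrite !unsat_deficit => vS wS; rewrite -(addn1 1) leq_add.
  by rewrite inE => /andP[/risk1].
have : (2 < u G)%N by rewrite uE.
case/card_gt2P => [v [w [z [[vS wS zS] [vw wz zv]]]]].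
have L y y' : y \in unsat d G -> y' \in unsat d G -> y != y' -> linked d G y y'.
  by move=> yS yS' yy; rewrite /linked (stopped_clique A0 yS yS' yy).
have : [set v; w; z] \in risky_sets d s G 3.
  have vz : v != z by rewrite eq_sym.
  by apply: risky_triple => //; rewrite !L ?orbT.
by rewrite inE => /andP[/risk1].
Qed.

Lemma stopped_lower G : admissible d G -> available d G = set0 ->
  share R d s G - C * risk d s delta G <= fail G.
Proof.
move=> aG A0.
have C0 : 0 <= C by apply: le_trans C_large'; rewrite exprn_ge0.
have nn : 0 <= C * risk d s delta G by rewrite mulr_ge0 ?risk_ge0.
rewrite lerBlDr; apply: le_trans (_ : _ <= fail G) _; last by rewrite lerDl.
rewrite /failure inE; case: (boolP (saturated d G)) => [sat|_]; last exact: share_le1.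
rewrite /share (_ : level d G s = set0) ?cards0 ?mul0r //.
apply/setP => v; rewrite !inE; apply/negP => /eqP vs; move: vs.
rewrite /deficit; case/orP: sat => [/forallP/(_ v)/eqP -> | /existsP[w /andP[wd /forallP h]]].
  by rewrite subnn; move: s_gt1; clear; lia.
have := h v; case: (eqVneq v w) => [->|_] /=; first by move=> _; move/eqP: wd => ->; move: s_gt1; clear; lia.
by move=> /eqP ->; rewrite subnn; move: s_gt1; clear; lia.
Qed.

Lemma card_level_risky G : (#|level d G s.+1| <= x G 1)%N.
Proof.
rewrite -(card_imset _ (@set1_inj _)); apply: subset_leq_card.
apply/subsetP => _ /imsetP[v vl ->]; rewrite inE cards1 eqxx andbT.
apply/andP; split; first by rewrite sub1set; exact: level_unsat vl.
apply/or3P/Or31/existsP; exists v; rewrite eqxx /=.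
by move: vl; rewrite inE => /eqP ->.
Qed.

Lemma card_adj_risky G : admissible d G ->
  (\sum_(v in level d G s) adj d G v <= 4 * x G 2)%N.
Proof.
move=> aG; pose Q := [set y : 'I_n * 'I_n | [&& y.1 \in level d G s, y.2 \in unsat d G
   & [set y.1; y.2] \in G]].
have -> : (\sum_(v in level d G s) adj d G v = #|Q|)%N.
  rewrite card_set_sum -(pair_big xpredT xpredT (fun v w =>
     ([&& v \in level d G s, w \in unsat d G & [set v; w] \in G] : nat))) /=.
  rewrite big_mkcond; apply: eq_bigr => v _; rewrite /adj card_set_sum.
  by case: (v \in level d G s) => //; rewrite big1.
apply: card_pairs => [[v w]|P]; last by rewrite inE => /andP[_ /eqP].
rewrite inE /= => /and3P[vl wS vwG]; apply: risky_pair => //.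
- exact: level_unsat vl.
- exact: admissible_edge_neq vwG.
- by rewrite /linked vwG.
by rewrite vwG muln0 addn0; move: vl; rewrite inE => /eqP ->; exact: leq_addr.
Qed.

Lemma card_heavy_risky G : (#|heavy_pairs d s G| <= 4 * x G 2)%N.
Proof.
apply: card_pairs => [[v w]|P]; last by rewrite inE => /andP[_ /eqP].
rewrite inE /= => /and4P[vl wS wv w1].
have vs : deficit d G v = s by move: vl; rewrite inE => /eqP.
apply: risky_pair => //; first exact: level_unsat vl.
- by rewrite eq_sym.
- by rewrite /linked vs s_gt1 w1 orbT.
by rewrite vs; case: (_ \in G); move: w1; clear; lia.
Qed.

Lemma card_triple_risky G : admissible d G ->
  (#|level d G s| * \sum_(v in unsat d G) adj d G v <= 8 * x G 2 + 27 * x G 3)%N.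
Proof.
move=> aG.
pose T := [set y : 'I_n * 'I_n * 'I_n | [&& y.2 \in level d G s,
   y.1.1 \in unsat d G, y.1.2 \in unsat d G, [set y.1.1; y.1.2] \in G,
   y.1.1 != y.2 & y.1.2 != y.2]].
have T27 : (#|T| <= 27 * x G 3)%N.
  apply: card_triples => [[[v w] z]|P]; last by rewrite inE => /andP[_ /eqP].
  rewrite inE /= => /and5P[zl vS wS vwG /andP[vz wz]]; apply: risky_triple => //.
  - exact: level_unsat zl.
  - exact: admissible_edge_neq vwG.
  - by rewrite /linked vwG.
  by move: zl; rewrite inE => /eqP ->; rewrite leqnn.
suff : (#|level d G s| * \sum_(v in unsat d G) adj d G v
    <= 2 * \sum_(v in level d G s) adj d G v + #|T|)%N.
  by have := card_adj_risky aG; lia.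
have LE : (#|level d G s| * \sum_(v in unsat d G) adj d G v =
  \sum_z \sum_v \sum_w [&& z \in level d G s, v \in unsat d G, w \in unsat d G
      & [set v; w] \in G])%N.
  rewrite -sum_nat_const big_mkcond; apply: eq_bigr => z _.
  case: (z \in level d G s); last by rewrite big1 // => v _; rewrite big1.
  rewrite big_mkcond; apply: eq_bigr => v _ /=; rewrite /adj card_set_sum.
  by case: (v \in unsat d G) => //; rewrite big1.
have TE : (#|T| = \sum_z \sum_v \sum_w [&& z \in level d G s,
   v \in unsat d G, w \in unsat d G, [set v; w] \in G, v != z & w != z])%N.
  rewrite card_set_sum -(pair_big xpredT xpredT (fun (y : 'I_n * 'I_n) z =>
     ([&& z \in level d G s, y.1 \in unsat d G, y.2 \in unsat d G,
        [set y.1; y.2] \in G, y.1 != z & y.2 != z] : nat))) /=.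
  by rewrite exchange_big; apply: eq_bigr => z _; rewrite [RHS]pair_big.
have S1 : (\sum_(v in level d G s) adj d G v = \sum_z \sum_v \sum_w
   (v == z) && [&& z \in level d G s, v \in unsat d G, w \in unsat d G
      & [set v; w] \in G])%N.
  rewrite big_mkcond; apply: eq_bigr => z _.
  rewrite (bigD1 z) //= [X in (_ + X)%N]big1 ?addn0; last first.
    by move=> v /negbTE vz; rewrite big1 // => w _; rewrite vz.
  rewrite /adj card_set_sum; case: ifP => zl; last by rewrite big1 // => w _; rewrite andbF.
  by apply: eq_bigr => w _; rewrite eqxx (level_unsat _ zl).
have S2 : (\sum_(v in level d G s) adj d G v = \sum_z \sum_v \sum_w
   (w == z) && [&& z \in level d G s, v \in unsat d G, w \in unsat d G
      & [set v; w] \in G])%N.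
  rewrite S1; apply: eq_bigr => z _; rewrite exchange_big /=.
  apply: eq_bigr => v _; apply: eq_bigr => w _; rewrite (setUC [set w]).
  by congr nat_of_bool; congr (_ && _); congr (_ && _); rewrite andbCA.
rewrite mul2n -addnn {1}S1 S2 TE LE -!big_split /=.
do 3![apply: leq_sum => ? _; rewrite -?big_split /=].
by do !case: (_ \in _); do !case: eqP => /=.
Qed.

(** The average loss of [risk] in one step, expressed through the numbers of
    configurations of each size. The errors of [share] are bounded by the same
    numbers in [upper_error] and [lower_error]. *)
Lemma risk_gain G : admissible d G -> (u0 <= u G)%N ->
  54 * ((x G 1)%:R + (x G 2)%:R / (u G)%:R + (x G 3)%:R / (u G)%:R ^+ 2)
  <= C * (delta / 2 / (u G)%:R * (A G)%:R * risk d s delta G).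
Proof.
move=> aG uu; have du := leq_trans u0_ge uu.
have u_gt0 : (0 < u G)%N by apply: leq_trans du; rewrite addnS.
have := @risk_ge R d n s delta delta_gt0 delta_le1 G u_gt0.
have := @risk_ge0 R d n s delta delta_gt0 G; set r := risk d s delta G.
move: du; rewrite -(ler_nat R) natrD natrM; set t := (u G)%:R => dt r0.
have d0 : 0 <= d%:R :> R by [].
have t0 : 0 < t by lra.
have d1 : (0 < d)%N.
  by case/card_gt0P: u_gt0 => v; rewrite inE; exact: leq_ltn_trans.
have Alow : t ^+ 2 <= 4 * (A G)%:R.
  have : (u G * (u G - 1) <= 2 * A G + u G * (d - 1))%N.
    rewrite -(card_available R aG) leq_add2l -sum_nat_const; apply: leq_sum => v vS.
    by rewrite -ltnS subn1 prednK //; exact: adj_lt.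
  rewrite -(ler_nat R) natrD !natrM !natrB // -/t => hA.
  have dtt : t * (2 * d%:R) <= t * t by rewrite ler_wpM2l; lra.
  lra.
have Cd : 432 <= C * delta by rewrite -ler_pdivrMr.
set X1 := (x G 1)%:R; set X2 := (x G 2)%:R; set X3 := (x G 3)%:R => rlow.
have a0 : 0 <= (A G)%:R :> R by [].
set a := (A G)%:R in Alow a0 *.
have -> : C * (delta / 2 / t * a * r) = (C * delta) * a * r / (2 * t) by field; lra.
have -> : 54 * (X1 + X2 / t + X3 / t ^+ 2) = 54 * t * (X1 / t + X2 / t ^+ 2 + X3 / t ^+ 3).
  by field; lra.
apply: (@le_trans _ _ (54 * t * r)).
  by rewrite ler_wpM2l // mulr_ge0 // ltW.
rewrite ler_pdivlMr; last by lra.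
have -> : 54 * t * r * (2 * t) = 432 * (t ^+ 2 / 4) * r by field.
rewrite ler_wpM2r //; apply: ler_pM => //.
  by rewrite divr_ge0 // sqr_ge0.
by rewrite ler_pdivrMr // mulrC.
Qed.

Lemma risky_sets_eq0 G : (forall P, ~~ risky d s G P) -> forall j, x G j = 0%N.
Proof.
move=> h j; apply/eqP; rewrite cards_eq0; apply/eqP/setP => P.
by rewrite !inE (negbTE (h P)).
Qed.

Lemma risk_eq0 G : (forall P, ~~ risky d s G P) -> risk d s delta G = 0.
Proof. by move=> h; rewrite /risk big_pred0 // => P; apply/negbTE/h. Qed.

Lemma risk_step_eq0 G e : e \in available d G ->
  (forall P, ~~ risky d s G P) -> risk d s delta (e |: G) = 0.
Proof.
by move=> eA h; apply: risk_eq0 => P; apply: contra (h P); exact: risky_step.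
Qed.

(** The error terms of [share_upper] and [share_lower] count configurations. *)
Lemma upper_error G : admissible d G -> (2 < u G)%N ->
  \sum_(e in available d G) share R d s (e |: G)
    <= (A G)%:R * share R d s G
       + (4 * (x G 2)%:R + (x G 1)%:R * (u G)%:R) / ((u G)%:R - 2).
Proof.
move=> aG u2; apply: le_trans (share_upper R s_gt0 aG u2) _.
rewrite lerD2l ler_wpM2r ?invr_ge0 ?subr_ge0 ?(ler_nat _ 2) ?(ltnW u2) //.
rewrite lerD // -?natrM -?natr_sum ?ler_nat ?card_adj_risky //.
by rewrite leq_mul2r card_level_risky orbT.
Qed.

Lemma lower_error G : admissible d G -> (2 < u G)%N ->
  (A G)%:R * share R d s G
    - (8 * (u G)%:R * (x G 2)%:R + 27 * (x G 3)%:R) / ((u G)%:R * ((u G)%:R - 2))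
  <= \sum_(e in available d G) share R d s (e |: G).
Proof.
move=> aG u2; apply: le_trans (share_lower R s_gt0 aG u2).
have t2 : 2 < (u G)%:R :> R by rewrite (ltr_nat R 2).
rewrite lerD2l lerN2 ler_wpM2r //.
  by rewrite invr_ge0 mulr_ge0 // subr_ge0 ltW.
have h1 : (#|heavy_pairs d s G|)%:R <= 4 * (x G 2)%:R :> R.
  by rewrite -natrM ler_nat card_heavy_risky.
have := card_triple_risky aG; rewrite -(ler_nat R) natrD !natrM natr_sum => h2.
set t := (u G)%:R in t2 *.
have : 2 * (t - 1) * (#|heavy_pairs d s G|)%:R <= 2 * (t - 1) * (4 * (x G 2)%:R).
  by rewrite ler_wpM2l //; lra.
lra.
Qed.

Lemma available_two G e : u G = 2%N -> e \in available d G -> e = unsat d G.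
Proof.
move=> u2 /availableP[e2 _ h]; apply/eqP; rewrite eqEcard u2 e2 leqnn andbT.
by apply/subsetP => v /h; rewrite inE.
Qed.

(** Three cases for one step: with many unsaturated vertices the loss of [risk]
    pays for the error of [share]; with few and a configuration left the bound
    exceeds 1; with few and none left there is no error. *)
Lemma endgame_upper m G : admissible d G -> ('C(n, 2) <= #|G| + m)%N ->
  expect d fail m G <= share R d s G + C * risk d s delta G.
Proof.
move=> aG; have C0 : 0 <= C by apply: le_trans C_large'; rewrite exprn_ge0.
apply: (@expect_le R d n fail (fun=> 0) (fun _ H => admissible d H)
  (fun _ H => share R d s H + C * risk d s delta H) _ _ m 0) => // _ {}G {}aG.
have [A0|A0] := eqVneq (available d G) set0.
  by left=> k _; rewrite expect_stop //; exact: stopped_upper.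
have a0 : 0 < (A G)%:R :> R by rewrite ltr0n card_gt0.
have u1 := available_unsat A0.
have step : 1 <= share R d s G + C * risk d s delta G \/
   \sum_(e in available d G) (share R d s (e |: G) + C * risk d s delta (e |: G))
   <= (A G)%:R * (share R d s G + C * risk d s delta G); last first.
  case: step => [le1|?]; [left => k _|right; split=> // e eA].
    by case/andP: (expect_01 k G failure_01) => _ /le_trans; apply.
  exact: admissible_step.
rewrite big_split /= -mulr_sumr.
have [uu|uu] := leqP (u G) u0; last first.
  right; have u2 : (2 < u G)%N by have := u0_ge; move: uu; clear; lia.
  have decay : \sum_(e in available d G) risk d s delta (e |: G)
      <= (1 - delta / 2 / (u G)%:R) * (A G)%:R * risk d s delta G.
    apply: risk_decay => //; apply: le_trans u0_large _.
    by rewrite ler_pM2l // ler_nat ltnW.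
  have := ler_wpM2l C0 decay; have := upper_error aG u2.
  have := risk_gain aG (ltnW uu).
  have t2 : 48 < (u G)%:R :> R by rewrite (ltr_nat R 48); have := u0_ge; move: uu; clear; lia.
  set t := (u G)%:R in t2 *; set X1 := (x G 1)%:R; set X2 := (x G 2)%:R.
  set X3 := (x G 3)%:R; set a := (A G)%:R; set r := risk d s delta G.
  have X10 : 0 <= X1 by []. have X20 : 0 <= X2 by []. have X30 : 0 <= X3 by [].
  have E : (4 * X2 + X1 * t) / (t - 2) <= 54 * (X1 + X2 / t + X3 / t ^+ 2).
    rewrite ler_pdivrMr; last by lra.
    have -> : 54 * (X1 + X2 / t + X3 / t ^+ 2) * (t - 2) =
       54 * X1 * (t - 2) + 54 * X2 * (1 - 2 / t) + 54 * X3 / t ^+ 2 * (t - 2).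
      by field; lra.
    have i1 : 2 / t <= 1 / 2 by rewrite ler_pdivrMr; lra.
    have p3 : 0 <= 54 * X3 / t ^+ 2 * (t - 2).
      by rewrite mulr_ge0 ?divr_ge0 ?mulr_ge0 ?sqr_ge0 //; lra.
    have p2 : 54 * X2 * (1 / 2) <= 54 * X2 * (1 - 2 / t).
      by rewrite ler_wpM2l ?mulr_ge0 //; lra.
    have p1 : X1 * 48 <= X1 * t by rewrite ler_wpM2l // ltW.
    lra.
  move: E; set Eu := _ / (t - 2); set Eg := 54 * _; set q := delta / 2 / t.
  lra.
case: (boolP [exists P, risky d s G P]) => [/existsP[P rP]|/existsPn nr].
  by left; rewrite -[leLHS]add0r lerD ?share_ge0 // (risky_small rP).
right; rewrite (risk_eq0 nr) mulr0 addr0 [X in _ + C * X]big1 ?mulr0 ?addr0; last first.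
  by move=> e eA; rewrite risk_step_eq0.
have [u2|u2|u2] := ltngtP 2 (u G); last 2 first.
- by rewrite ltnNge u1 in u2.
- rewrite big1 => [|e eA]; first exact: mulr_ge0 (ltW a0) (share_ge0 G).
  rewrite /share.
  rewrite (_ : level d (e |: G) s = set0) ?cards0 ?mul0r //.
  apply/setP => v; rewrite (level_step s_gt0 eA) !inE (available_two (esym u2) eA).
  have := card_level_risky G; rewrite risky_sets_eq0 // leqn0 cards_eq0 => /eqP l0.
  have : v \notin level d G s.+1 by rewrite l0 inE.
  rewrite inE => /negbTE ->; rewrite /= orbF unsat_deficit.
  by case: (deficit d G v) => //= ; rewrite eq_sym (gtn_eqF s_gt0).
by apply: le_trans (upper_error aG u2) _; rewrite !risky_sets_eq0 // mulr0 mul0r addr0 mul0r addr0.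
Qed.

(** As for [endgame_upper]. With two unsaturated vertices and no configuration the
    lower bound would fail for a vertex of deficiency [s] next to one of deficiency
    1, but this contradicts parity. *)
Lemma endgame_lower m G : admissible d G -> ('C(n, 2) <= #|G| + m)%N ->
  share R d s G - C * risk d s delta G <= expect d fail m G.
Proof.
move=> aG cG; have C0 : 0 <= C by apply: le_trans C_large'; rewrite exprn_ge0.
suff : expect d (fun H => - fail H) m G <= - (share R d s G - C * risk d s delta G).
  by rewrite expectN lerN2.
apply: (@expect_le R d n (fun H => - fail H) (fun=> 0) (fun _ H => admissible d H)
  (fun _ H => - (share R d s H - C * risk d s delta H)) _ _ m 0) => // _ {cG}G {}aG.
have [A0|A0] := eqVneq (available d G) set0.
  by left=> k _; rewrite expect_stop // lerN2; exact: stopped_lower.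
have a0 : 0 < (A G)%:R :> R by rewrite ltr0n card_gt0.
have u1 := available_unsat A0.
have step : share R d s G - C * risk d s delta G <= 0 \/
   (A G)%:R * (share R d s G - C * risk d s delta G) <=
   \sum_(e in available d G) (share R d s (e |: G) - C * risk d s delta (e |: G));
   last first.
  case: step => [le1|le]; [left => k _|right; split=> // [e eA|]].
  - rewrite expectN lerN2; apply: le_trans le1 _.
    by case/andP: (expect_01 k G failure_01).
  - exact: admissible_step.
  by rewrite sumrN mulrN lerN2.
rewrite sumrB -mulr_sumr.
have [uu|uu] := leqP (u G) u0; last first.
  right; have u2 : (2 < u G)%N by have := u0_ge; move: uu; clear; lia.
  have decay : \sum_(e in available d G) risk d s delta (e |: G)
      <= (1 - delta / 2 / (u G)%:R) * (A G)%:R * risk d s delta G.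
    apply: risk_decay => //; apply: le_trans u0_large _.
    by rewrite ler_pM2l // ler_nat ltnW.
  have := ler_wpM2l C0 decay; have := lower_error aG u2.
  have := risk_gain aG (ltnW uu).
  have t2 : 48 < (u G)%:R :> R by rewrite (ltr_nat R 48); have := u0_ge; move: uu; clear; lia.
  set t := (u G)%:R in t2 *; set X1 := (x G 1)%:R; set X2 := (x G 2)%:R.
  set X3 := (x G 3)%:R; set a := (A G)%:R; set r := risk d s delta G.
  have X10 : 0 <= X1 by []. have X20 : 0 <= X2 by []. have X30 : 0 <= X3 by [].
  have E : (8 * t * X2 + 27 * X3) / (t * (t - 2)) <= 54 * (X1 + X2 / t + X3 / t ^+ 2).
    have -> : (8 * t * X2 + 27 * X3) / (t * (t - 2))
       = 8 * X2 / (t - 2) + 27 * X3 / (t * (t - 2)) by field; lra.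
    have i1 : (t - 2)^-1 <= 2 / t.
      by rewrite ler_pdivlMr ?(mulrC _ t) ?ler_pdivrMr; lra.
    have i2 : 8 * X2 / (t - 2) <= 8 * X2 * (2 / t) by rewrite ler_wpM2l // mulr_ge0.
    have i3 : 27 * X3 / (t * (t - 2)) <= 27 * X3 * (t^-1 * (2 / t)).
      rewrite invfM; apply: ler_wpM2l; first by rewrite mulr_ge0.
      by apply: ler_wpM2l => //; rewrite invr_ge0; lra.
    have p2 : 0 <= X2 / t by rewrite divr_ge0 //; lra.
    have -> : 54 * (X1 + X2 / t + X3 / t ^+ 2) =
       54 * X1 + 54 * (X2 / t) + 27 * X3 * (t^-1 * (2 / t)) by field; lra.
    move: i2; have -> : 8 * X2 * (2 / t) = 16 * (X2 / t) by field; lra.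
    lra.
  move: E; set Eu := _ / (t * (t - 2)); set Eg := 54 * _; set q := delta / 2 / t.
  lra.
case: (boolP [exists P, risky d s G P]) => [/existsP[P rP]|/existsPn nr].
  left; rewrite subr_le0; apply: le_trans (share_le1 G) _.
  exact: risky_small rP uu.
have [l0|[v vl]] := set_0Vmem (level d G s).
  left; rewrite /share l0 cards0 mul0r sub0r oppr_le0.
  by rewrite mulr_ge0 ?risk_ge0.
right; rewrite (risk_eq0 nr) mulr0 subr0 [X in _ - _ * X]big1 ?mulr0 ?subr0; last first.
  by move=> e eA; rewrite risk_step_eq0.
(* with two unsaturated vertices the deficiencies would be s and 1, whose sum has
   the wrong parity *)
have u2 : (2 < u G)%N.
  rewrite ltn_neqAle u1 andbT; apply/eqP => u2.
  have par := odd_deficits aG; rewrite sum_deficits in par.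
  have vS := level_unsat s_gt0 vl.
  have vs : deficit d G v = s by move: vl; rewrite inE => /eqP.
  move: par; rewrite (bigD1 v) //= vs (eq_bigr (fun=> 1%N)); last first.
    move=> w /andP[wS wv]; move: (wS); rewrite unsat_deficit => w0.
    apply/eqP; rewrite eqn_leq w0 andbT leqNgt; apply/negP => w1.
    have := card_heavy_risky G; rewrite risky_sets_eq0 // muln0 leqn0 cards_eq0 => /eqP h0.
    have : (v, w) \in heavy_pairs d s G by rewrite inE /= vl wS wv.
    by rewrite h0 inE.
  rewrite sum1_card; have -> : #|[pred i | (i \in unsat d G) && (i != v)]| = 1%N.
    have := cardsD1 v (unsat d G); rewrite vS -u2 => -[E].
    by rewrite [RHS]E add0n; apply: eq_card => w; rewrite !inE andbC.
  by rewrite s_def addn1 /= negbK oddb; case: (odd _).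
apply: le_trans (lower_error aG u2).
by rewrite !risky_sets_eq0 // !mulr0 addr0 mul0r subr0.
Qed.

End Endgame.

(** * Drift of the predicted counts *)

(** Up to the factor [expR (- t)], the probability that a Poisson variable of mean
    [t] is [d - k], that is, that a vertex has deficiency [k] at time [t]. *)
Definition poisson_shape (R : realType) (d k : nat) (t : R) : R :=
  if (k <= d)%N then t ^+ (d - k) / (d - k)`!%:R else 0.

Section Numeric.
Context (R : realType).
Implicit Types (t h L : R).

Lemma exprD_taylor t h L j : 0 <= t -> 0 <= h -> t + h <= L -> 1 <= L ->
  0 <= (t + h) ^+ j.+1 - t ^+ j.+1 - j.+1%:R * h * t ^+ j
    <= j.+1%:R ^+ 2 * h ^+ 2 * L ^+ j.+1.
Proof.
move=> t0 h0 tL L1; elim: j => [|j /andP[IH1 IH2]].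
  rewrite expr0 !expr1 mulr1 mul1r (_ : _ - _ - _ = 0); last by ring.
  by rewrite lexx expr1n mul1r mulr_ge0 ?sqr_ge0 //; lra.
have L0 : 0 <= L by lra.
have -> : (t + h) ^+ j.+2 - t ^+ j.+2 - j.+2%:R * h * t ^+ j.+1
  = (t + h) * ((t + h) ^+ j.+1 - t ^+ j.+1 - j.+1%:R * h * t ^+ j)
    + j.+1%:R * h ^+ 2 * t ^+ j.
  by rewrite -[j.+2%:R]natr1 !exprS; ring.
set X := _ - _ - _ in IH1 IH2 *.
have j0 : 0 <= j.+1%:R :> R by [].
have tj0 : 0 <= t ^+ j by rewrite exprn_ge0.
have tj : t ^+ j <= L ^+ j.+2.
  apply: (@le_trans _ _ (L ^+ j)); first by apply: lerXn2r; rewrite ?nnegrE //; lra.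
  by apply: ler_weXn2l => //; rewrite -addn2 leq_addr.
have q0 : 0 <= j.+1%:R * h ^+ 2 by rewrite mulr_ge0 ?sqr_ge0.
apply/andP; split; first by apply: addr_ge0; apply: mulr_ge0 => //; exact: addr_ge0.
have b1 : (t + h) * X <= L * (j.+1%:R ^+ 2 * h ^+ 2 * L ^+ j.+1).
  by apply: ler_pM => //; rewrite addr_ge0.
have b2 : j.+1%:R * h ^+ 2 * t ^+ j <= j.+1%:R * h ^+ 2 * L ^+ j.+2 by exact: ler_wpM2l.
apply: le_trans (lerD b1 b2) _.
have -> : L * (j.+1%:R ^+ 2 * h ^+ 2 * L ^+ j.+1) + j.+1%:R * h ^+ 2 * L ^+ j.+2
  = (j.+1%:R ^+ 2 + j.+1%:R) * (h ^+ 2 * L ^+ j.+2) by rewrite [L ^+ j.+2]exprS; ring.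
rewrite -mulrA ler_wpM2r //; first by rewrite mulr_ge0 ?sqr_ge0 ?exprn_ge0.
rewrite -[j.+2%:R]natr1; nra.
Qed.

Lemma expRN_taylor h : 0 <= h -> 0 <= expR (- h) - (1 - h) <= h ^+ 2.
Proof.
move=> h0; apply/andP; split; first by have := expR_ge1Dx (- h); lra.
have : expR (- h) <= (1 + h)^-1.
  by rewrite expRN lef_pV2 ?posrE ?expR_gt0 ?expR_ge1Dx //; lra.
have : (1 + h)^-1 <= 1 - h + h ^+ 2.
  by rewrite -[leLHS]mul1r ler_pdivrMr; nra.
lra.
Qed.

Lemma poisson_shape_ge0 d k t : 0 <= t -> 0 <= poisson_shape d k t.
Proof.
by move=> t0; rewrite /poisson_shape; case: ifP => // _; rewrite divr_ge0 ?exprn_ge0.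
Qed.

Lemma fact_inv_le1 j : (j`!%:R)^-1 <= 1 :> R.
Proof. by rewrite invf_le1 ?ltr0n ?fact_gt0 // ler1n fact_gt0. Qed.

Lemma poisson_shape_le d k t L : 0 <= t -> t <= L -> 1 <= L ->
  poisson_shape d k t <= L ^+ d.
Proof.
move=> t0 tL L1; rewrite /poisson_shape; case: ifP => // _; last by rewrite exprn_ge0; lra.
apply: (@le_trans _ _ (t ^+ (d - k))); first by rewrite ler_piMr ?exprn_ge0 ?fact_inv_le1.
apply: (@le_trans _ _ (L ^+ (d - k))); first by apply: lerXn2r; rewrite ?nnegrE //; lra.
by apply: ler_weXn2l => //; exact: leq_subr.
Qed.

Lemma poisson_shape_taylor d k t h L : 0 <= t -> 0 <= h -> t + h <= L -> 1 <= L ->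
  0 <= poisson_shape d k (t + h) - poisson_shape d k t - h * poisson_shape d k.+1 t
    <= d%:R ^+ 2 * h ^+ 2 * L ^+ d.
Proof.
move=> t0 h0 tL L1.
have L0 : 0 <= L by lra.
have up0 : 0 <= d%:R ^+ 2 * h ^+ 2 * L ^+ d.
  by rewrite !mulr_ge0 ?sqr_ge0 ?exprn_ge0.
rewrite /poisson_shape; have [kd|kd|->] := ltngtP k d; last first.
- by rewrite subnn !expr0 mulr0 subrr subr0 lexx up0.
- by rewrite mulr0 subrr subr0 lexx up0.
have -> : (d - k)%N = (d - k.+1).+1 by rewrite subnSK.
set j := (d - k.+1)%N.
have jd : (j.+1 <= d)%N by rewrite /j subnSK // leq_subr.
have /andP[lo hi] := exprD_taylor j t0 h0 tL L1.
have -> : (t + h) ^+ j.+1 / j.+1`!%:R - t ^+ j.+1 / j.+1`!%:R - h * (t ^+ j / j`!%:R)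
  = ((t + h) ^+ j.+1 - t ^+ j.+1 - j.+1%:R * h * t ^+ j) / j.+1`!%:R.
  rewrite factS natrM; field; rewrite nat1r !pnatr_eq0 -lt0n fact_gt0 //.
set X := _ - _ - _ in lo hi *.
apply/andP; split; first by rewrite divr_ge0.
apply: (@le_trans _ _ X); first by rewrite ler_piMr ?fact_inv_le1.
apply: le_trans hi _; apply: ler_pM => //.
- by rewrite mulr_ge0 ?sqr_ge0.
- exact: exprn_ge0.
- by rewrite ler_wpM2r ?sqr_ge0 // lerXn2r ?nnegrE // ler_nat.
exact: ler_weXn2l.
Qed.

(** The predicted counts solve [y_k' = y_(k+1) - y_k]; this is the error of one
    Euler step. *)
Lemma poisson_drift d k t h L : 0 <= t -> 0 <= h -> h <= 1 -> t + h <= L -> 1 <= L ->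
  `|expR (- (t + h)) * poisson_shape d k (t + h) - expR (- t) * poisson_shape d k t
    - h * (expR (- t) * poisson_shape d k.+1 t - expR (- t) * poisson_shape d k t)|
  <= (1 + d%:R ^+ 2) * h ^+ 2 * L ^+ d * expR (- t).
Proof.
move=> t0 h0 h1 tL L1.
have /andP[e1 e2] := expRN_taylor h0.
have /andP[p1 p2] := poisson_shape_taylor d k t0 h0 tL L1.
have q0 := poisson_shape_ge0 d k t0; have q'0 := poisson_shape_ge0 d k.+1 t0.
have qL : poisson_shape d k (t + h) <= L ^+ d by apply: poisson_shape_le => //; lra.
have q'L : poisson_shape d k.+1 t <= L ^+ d by apply: poisson_shape_le => //; lra.
have LL : 0 <= L ^+ d by rewrite exprn_ge0 //; lra.
rewrite opprD expRD.
set E := expR (- t); have E0 : 0 <= E by exact: expR_ge0.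
set ep := expR (- h) - (1 - h) in e1 e2.
set q := poisson_shape d k t in q0 p1 p2 *.
set q' := poisson_shape d k.+1 t in q'0 p1 p2 q'L *.
set qh := poisson_shape d k (t + h) in p1 p2 qL *.
have -> : expR (- h) = 1 - h + ep by rewrite /ep; ring.
set rho := qh - q - h * q' in p1 p2.
have -> : E * (1 - h + ep) * qh - E * q - h * (E * q' - E * q)
  = (ep * qh + (1 - h) * rho - h ^+ 2 * q') * E by rewrite /rho; ring.
rewrite normrM (ger0_norm E0) ler_wpM2r //.
have qh0 : 0 <= qh by apply: poisson_shape_ge0; rewrite addr_ge0.
have a1 : 0 <= ep * qh by rewrite mulr_ge0.
have a2 : ep * qh <= h ^+ 2 * L ^+ d by exact: ler_pM.
have a3 : 0 <= (1 - h) * rho by rewrite mulr_ge0 //; lra.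
have a4 : (1 - h) * rho <= rho by rewrite ler_piMl //; lra.
have a5 : 0 <= h ^+ 2 * q' by rewrite mulr_ge0 ?sqr_ge0.
have a6 : h ^+ 2 * q' <= h ^+ 2 * L ^+ d by rewrite ler_wpM2l ?sqr_ge0.
have a7 : 0 <= d%:R ^+ 2 * h ^+ 2 * L ^+ d by rewrite !mulr_ge0 ?sqr_ge0.
rewrite ler_norml; apply/andP; split; lra.
Qed.

End Numeric.

(** * Deviations from the prediction *)
Definition deviation (R : realType) (d n k : nat) (t : R) (G : graph n) : R :=
  #|level d G k|%:R - n%:R * (expR (- t) * poisson_shape d k t).

(** The growing weights make the coupling of a level to the level above small
    compared with its own contraction. *)
Definition energy (R : realType) (d n : nat) (L t : R) (G : graph n) : R :=
  \sum_(1 <= k < d.+1) L ^+ (2 * k) * deviation d k t G ^+ 2.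

Section Step.
Context (R : realType) (d n : nat).
Implicit Types (G : graph n) (e : {set 'I_n}) (v w : 'I_n) (L t : R).
Local Notation u G := #|unsat d G|.
Local Notation A G := #|available d G|.

Lemma available_lower G : admissible d G -> (2 * d + 2 <= u G)%N ->
  (u G)%:R ^+ 2 <= 4 * (A G)%:R :> R.
Proof.
move=> aG du; have u0 : (0 < u G)%N by move: du; clear; lia.
have d1 : (0 < d)%N by case/card_gt0P: u0 => v; rewrite inE; exact: leq_ltn_trans.
have : (u G * (u G - 1) <= 2 * A G + u G * (d - 1))%N.
  rewrite -(card_available R aG) leq_add2l -sum_nat_const; apply: leq_sum => v vS.
  by rewrite -ltnS subn1 prednK //; exact: adj_lt.
move: du; rewrite -!(ler_nat R) !natrD !natrM !natrB //.
set t := (u G)%:R => du hA.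
have t0 : 0 <= t by [].
have dtt : t * (2 * d%:R) <= t * t by rewrite ler_wpM2l; lra.
lra.
Qed.

Lemma level_unsat_subset G k : (0 < k)%N -> (#|level d G k| <= u G)%N.
Proof.
by move=> k0; apply: subset_leq_card; apply/subsetP => v; exact: level_unsat.
Qed.

(** Every unsaturated vertex is hit by the fraction [2 / u] of the available edges
    up to a term of order [d / u ^ 2], since both its own number of partners and the
    average one lie between [u - d] and [u - 1]. *)
Lemma sum_level_step G k : admissible d G -> (0 < k)%N -> (0 < u G)%N ->
  `|\sum_(e in available d G) (#|level d (e |: G) k|%:R - #|level d G k|%:R)
    - 2 / (u G)%:R * (A G)%:R * (#|level d G k.+1|%:R - #|level d G k|%:R)|
  <= 2 * d%:R * (u G)%:R :> R.
Proof.
move=> aG k0 u0; set T := (u G)%:R : R; set a := (A G)%:R : R.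
have T0 : 0 < T by rewrite ltr0n.
have hit_close v : v \in unsat d G -> `|(hits d G v)%:R - 2 / T * a| <= d%:R.
  move=> vS; rewrite (hits_real R aG vS) -/T.
  have /ltnW := adj_lt aG vS; rewrite -(ler_nat R) => h1.
  have h0 : 0 <= (adj d G v)%:R :> R by [].
  have := card_available R aG => /(congr1 (fun k => k%:R : R)).
  rewrite natrD !natrM natrB // -/T -/a => E.
  have S1 : (\sum_(v in unsat d G) adj d G v)%:R <= d%:R * T.
    rewrite -natrM ler_nat mulnC -sum_nat_const; apply: leq_sum => w wS.
    exact/ltnW/adj_lt.
  have S0 : 0 <= (\sum_(v in unsat d G) adj d G v)%:R :> R by [].
  set S := (\sum_(_ in _) _)%:R in E S1 S0.
  have -> : 2 / T * a = T - 1 - S / T.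
    have -> : 2 / T * a = (2 * a) / T by ring.
    by rewrite (_ : 2 * a = T * (T - 1) - S); [field; lra | lra].
  have s0 : 0 <= S / T by rewrite divr_ge0 // ltW.
  have s1 : S / T <= d%:R by rewrite ler_pdivrMr.
  rewrite ler_norml; apply/andP; split; lra.
have sumE (B : {set 'I_n}) : B \subset unsat d G ->
  `|\sum_(v in B) (hits d G v)%:R - 2 / T * a * #|B|%:R| <= d%:R * T.
  move=> BS; rewrite -sum_cst -sumrB.
  apply: le_trans (ler_norm_sum _ _ _) _.
  apply: (@le_trans _ _ (\sum_(v in B) d%:R)).
    by apply: ler_sum => v vB; apply: hit_close; exact: (subsetP BS).
  by rewrite sum_cst ler_wpM2l // ler_nat subset_leq_card.
have sub j : (0 < j)%N -> level d G j \subset unsat d G.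
  by move=> j0; apply/subsetP => v; exact: level_unsat.
have := sumE _ (sub k k0); have := sumE _ (sub k.+1 isT).
have -> : \sum_(e in available d G) (#|level d (e |: G) k|%:R - #|level d G k|%:R)
   = \sum_(v in level d G k.+1) (hits d G v)%:R - \sum_(v in level d G k) (hits d G v)%:R :> R.
  transitivity (\sum_(e in available d G) (\sum_(v in level d G k.+1) (v \in e)%:R
     - \sum_(v in level d G k) (v \in e)%:R) : R).
    apply: eq_bigr => e eA; rewrite card_level_step // -[#|level d G k|%:R]mul1r -sum_cst.
    rewrite addrAC addrC; congr (_ + _); rewrite -sumrB -sumrN; apply: eq_bigr => v _.
    by case: (v \in e); rewrite ?subrr ?subr0 ?sub0r ?oppr0.
  rewrite sumrB exchange_big [X in _ - X]exchange_big /=; congr (_ - _);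
  apply: eq_bigr => v vl; rewrite sum_in // ?hits_real //; exact: (subsetP (sub _ _) _ vl).
set S1 := \sum_(v in _) _; set S2 := \sum_(v in _) _.
set c := 2 / T * a; set U1 := #|level d G k.+1|%:R; set U2 := #|level d G k|%:R.
rewrite !ler_norml => /andP[i1 i2] /andP[i3 i4]; apply/andP; split; lra.
Qed.

Lemma level_step_bound G e k : e \in available d G -> (0 < k)%N ->
  `|#|level d (e |: G) k|%:R - #|level d G k|%:R| <= 2 :> R.
Proof.
move=> eA k0; rewrite (level_step k0 eA).
have c2 (B : {set 'I_n}) : (#|B :&: e| <= 2)%N.
  by case/availableP: eA => <- _ _; apply: subset_leq_card; exact: subsetIr.
have E : (#|(level d G k :\: e) :|: (level d G k.+1 :&: e)| + #|level d G k :&: e|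
   = #|level d G k| + #|level d G k.+1 :&: e|)%N.
  rewrite cardsU (_ : _ :&: (_ :&: e) = set0) ?cards0 ?subn0; last first.
    by apply/setP => v; rewrite !inE; case: (v \in e); rewrite ?andbF.
  by rewrite addnAC addnC -(cardsID e (level d G k)); move: #|_| #|_| #|_|; clear; lia.
have h1 := c2 (level d G k); have h2 := c2 (level d G k.+1).
move: E h1 h2; move: #|_ :|: _| #|level d G k :&: e| #|level d G k| #|level d G k.+1 :&: e|.
clear => x y z w /(congr1 (fun k => k%:R : R)); rewrite !natrD -!(ler_nat R) => E h1 h2.
have : 0 <= y%:R :> R by []. have : 0 <= w%:R :> R by [].
rewrite ler_norml => ? ?; apply/andP; split.
  lra.
lra.
Qed.

Definition noise : R :=
  32 * d%:R + 32 * (1 + d%:R ^+ 2) + 8 + 2 * (16 + 8 * d%:R ^+ 2) ^+ 2.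

(** The drift of a level is that of the prediction plus the linear expression in
    the deviations. All errors are bounded in absolute value, and not merely
    relatively to [n * expR (- t)], because this quantity is at most [2 * u] and a
    step changes a level by at most 2. *)
Lemma deviation_step G t L k : admissible d G -> (2 * d + 2 <= u G)%N -> (0 < k)%N ->
  0 <= t -> t + 2 / (u G)%:R <= L -> 1 <= L ->
  n%:R * expR (- t) <= 2 * (u G)%:R ->
  `|deviation d k t G| <= 2 * (u G)%:R ->
  \sum_(e in available d G) deviation d k (t + 2 / (u G)%:R) (e |: G) ^+ 2
  <= (A G)%:R * (deviation d k t G ^+ 2
        + 2 * (2 / (u G)%:R) * (deviation d k t G
             * (deviation d k.+1 t G - deviation d k t G))
        + noise * L ^+ (2 * d)).
Proof.
move=> aG du k0 t0 tL L1 nuT devT.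
have u0 : (0 < u G)%N by move: du; clear; lia.
have Alow := available_lower aG du.
have := sum_level_step aG k0 u0.
have T2 : 2 <= (u G)%:R :> R by rewrite (ler_nat R 2); move: du; clear; lia.
set T := (u G)%:R in tL nuT devT Alow T2 *; set a := (A G)%:R in Alow *.
set h := 2 / T in tL *.
have T0 : 0 < T by lra.
have h0 : 0 <= h by rewrite divr_ge0 // ltW.
have h1 : h <= 1 by rewrite ler_pdivrMr //; lra.
have a0 : 0 <= a by [].
have LL : 1 <= L ^+ d by rewrite exprn_ege1.
have nn0 : 0 <= n%:R :> R by [].
have E0 : 0 <= expR (- t) by exact: expR_ge0.
have drift := poisson_drift d k t0 h0 h1 tL L1.
set yk := expR (- t) * poisson_shape d k t in drift.
set yk1 := expR (- t) * poisson_shape d k.+1 t in drift.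
set ykh := expR (- (t + h)) * poisson_shape d k (t + h) in drift.
set Y := deviation d k t G in devT *.
have YE : Y = #|level d G k|%:R - n%:R * yk by [].
set Y1 := deviation d k.+1 t G.
have Y1E : Y1 = #|level d G k.+1|%:R - n%:R * yk1 by [].
set Uk := #|level d G k|%:R in YE *; set Uk1 := #|level d G k.+1|%:R in Y1E *.
pose xi e : R := #|level d (e |: G) k|%:R - Uk.
pose D : R := n%:R * (ykh - yk).
have devE e : deviation d k (t + h) (e |: G) = Y + (xi e - D).
  by rewrite /deviation -/ykh YE /xi /D; ring.
rewrite (_ : \sum_(e in available d G) (_ - Uk) = \sum_(e in available d G) xi e) //.
move=> Sxi.
pose r : R := n%:R * (ykh - yk - h * (yk1 - yk)).
have DE : D = h * (n%:R * yk1 - n%:R * yk) + r by rewrite /D /r; ring.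
set c := 1 + d%:R ^+ 2 in drift.
have c1 : 1 <= c by rewrite /c lerDl sqr_ge0.
have c0 : 0 <= c := le_trans ler01 c1.
have LL0 : 0 <= L ^+ d := le_trans ler01 LL.
have Tn0 : T != 0 by rewrite gt_eqF.
have T1 : 1 <= T by exact: le_trans (ler1n _ 2) T2.
have cL0 : 0 <= 8 * c * L ^+ d by rewrite !mulr_ge0.
have rb : `|r| <= 8 * c * L ^+ d / T.
  rewrite /r normrM (ger0_norm nn0).
  apply: le_trans (ler_wpM2l nn0 drift) _.
  have -> : n%:R * (c * h ^+ 2 * L ^+ d * expR (- t))
    = (c * h ^+ 2 * L ^+ d) * (n%:R * expR (- t)) by ring.
  have -> : 8 * c * L ^+ d / T = (c * h ^+ 2 * L ^+ d) * (2 * T).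
    by rewrite /h; field.
  by apply: ler_wpM2l => //; rewrite mulr_ge0 // mulr_ge0 // sqr_ge0.
have rb' : `|r| <= 8 * c * L ^+ d.
  by apply: le_trans rb _; rewrite ler_pdivrMr // ler_peMr.
have Db : `|D| <= (16 + 8 * d%:R ^+ 2) * L ^+ d.
  have yb j : 0 <= n%:R * (expR (- t) * poisson_shape d j t) <= 2 * T * L ^+ d.
    have q0 := poisson_shape_ge0 d j t0.
    have qL : poisson_shape d j t <= L ^+ d by apply: poisson_shape_le => //; lra.
    rewrite mulrA mulr_ge0 ?mulr_ge0 //=.
    by apply: ler_pM => //; rewrite mulr_ge0.
  have /andP[y0 y1] := yb k; have /andP[z0 z1] := yb k.+1.
  rewrite -/yk in y0 y1; rewrite -/yk1 in z0 z1.
  have : `|h * (n%:R * yk1 - n%:R * yk)| <= 8 * L ^+ d.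
    rewrite normrM (ger0_norm h0).
    have -> : 8 * L ^+ d = h * (4 * T * L ^+ d) by rewrite /h; field.
    rewrite ler_wpM2l // ler_norml; apply/andP; split; lra.
  have -> : (16 + 8 * d%:R ^+ 2) * L ^+ d = 8 * L ^+ d + 8 * c * L ^+ d by rewrite /c; ring.
  by rewrite DE => b; apply: le_trans (ler_normD _ _) _; exact: lerD.
have sq e : e \in available d G ->
   (xi e - D) ^+ 2 <= (8 + 2 * (16 + 8 * d%:R ^+ 2) ^+ 2) * L ^+ (2 * d).
  move=> eA; have x2 := level_step_bound eA k0; rewrite -/Uk -/(xi e) in x2.
  have x4 : xi e ^+ 2 <= 4.
    rewrite -real_normK ?num_real //; apply: le_trans (_ : _ <= 2 ^+ 2) _.
      by apply: lerXn2r; rewrite ?nnegrE.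
    by rewrite -natrX.
  have D4 : D ^+ 2 <= (16 + 8 * d%:R ^+ 2) ^+ 2 * L ^+ (2 * d).
    rewrite -real_normK ?num_real // mulnC exprM -exprMn.
    by apply: lerXn2r => //; rewrite nnegrE // mulr_ge0 // addr_ge0 // mulr_ge0 // sqr_ge0.
  have LL2 : 1 <= L ^+ (2 * d) by rewrite exprn_ege1.
  have := sqr_ge0 (xi e + D); lra.
have T2a : T ^+ 2 <= 4 * a by [].
under eq_bigr => e _ do rewrite devE sqrrD.
rewrite !big_split /= sum_cst.
have cross : \sum_(e in available d G) Y * (xi e - D)
     + \sum_(e in available d G) Y * (xi e - D)
   <= a * (2 * h * (Y * (Y1 - Y)) + (32 * d%:R + 32 * c) * L ^+ (2 * d)).
  rewrite -mulr_sumr sumrB sum_cst -/a.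
  set S := \sum_(e in _) xi e in Sxi *.
  pose er := S - h * a * (Uk1 - Uk) - a * r.
  have -> : S - D * a = a * h * (Y1 - Y) + er.
    by rewrite /er DE YE Y1E; ring.
  have erb : `|er| <= 2 * d%:R * T + a * (8 * c * L ^+ d / T).
    rewrite /er; apply: le_trans (ler_normB _ _) _; apply: lerD => //.
    by rewrite normrM (ger0_norm a0) ler_wpM2l.
  have Yer : Y * er <= 2 * T * (2 * d%:R * T + a * (8 * c * L ^+ d / T)).
    apply: le_trans (ler_norm _) _; rewrite normrM; exact: ler_pM.
  have E1 : 2 * T * (2 * d%:R * T + a * (8 * c * L ^+ d / T))
     = 4 * d%:R * T ^+ 2 + 16 * a * c * L ^+ d by field.
  have b1 : 4 * d%:R * T ^+ 2 <= 4 * d%:R * (4 * a) by rewrite ler_wpM2l // mulr_ge0.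
  have LL2 : L ^+ d <= L ^+ (2 * d) by apply: ler_weXn2l => //; rewrite leq_pmull.
  have b2 : 16 * a * c * L ^+ d <= 16 * a * c * L ^+ (2 * d).
    by rewrite ler_wpM2l // !mulr_ge0.
  have b3 : 4 * d%:R * (4 * a) <= 4 * d%:R * (4 * a) * L ^+ (2 * d).
    by rewrite ler_peMr ?mulr_ge0 // exprn_ege1.
  lra.
have last : \sum_(e in available d G) (xi e - D) ^+ 2
   <= a * ((8 + 2 * (16 + 8 * d%:R ^+ 2) ^+ 2) * L ^+ (2 * d)).
  by rewrite mulrC -sum_cst; exact: ler_sum.
rewrite /noise -/c.
lra.
Qed.

End Step.

(** * The first phase *)

(** The rescaled energy plus the largest amount that it can still collect: the
    variance of a step at time [t] is of the order of [expR (2 * t)], and there are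
    about [n * expR (- t)] steps per unit of time, both up to powers of [L], whence
    [expR t]. The factor
    [1 - L^-1] gives up a little contraction to absorb the coupling of the levels; as
    [t <= L], this costs only a constant factor. *)
Definition penalty (R : realType) (d n : nat) (L top t : R) (G : graph n) : R :=
  L ^+ 2 / n%:R ^+ 2 *
  (expR (2 * (1 - L^-1) * t) * energy d L t G
   + 4 * d%:R ^+ 2 * noise R d * n%:R * L ^+ (5 * d) * (expR top - expR t)).

Section BurnIn.
Context (R : realType) (d n : nat).
Implicit Types (G : graph n) (e : {set 'I_n}) (v w : 'I_n) (L t : R).
Local Notation u G := #|unsat d G|.
Local Notation A G := #|available d G|.

Lemma noise_ge0 : 0 <= noise R d.
Proof.
have d0 : 0 <= d%:R :> R by [].
have d2 : 0 <= d%:R ^+ 2 :> R by exact: sqr_ge0.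
rewrite /noise; have := sqr_ge0 (16 + 8 * d%:R ^+ 2 : R); lra.
Qed.

Lemma energy_ge0 L t G : 0 <= L -> 0 <= energy d L t G.
Proof.
by move=> L0; apply: sumr_ge0 => k _; exact: mulr_ge0 (exprn_ge0 _ L0) (sqr_ge0 _).
Qed.

Lemma deviation_out t G : deviation d d.+1 t G = 0.
Proof.
rewrite /deviation /poisson_shape ltnn !mulr0 subr0.
rewrite (_ : level d G d.+1 = set0) ?cards0 //; apply/setP => v; rewrite !inE.
by apply/negbTE; rewrite neq_ltn ltnS leq_subr.
Qed.

(** The level above the top one is empty and its prediction is zero. *)
Lemma energy_shift L t G : (0 < d)%N ->
  \sum_(1 <= k < d.+1) L ^+ (2 * k.+1) * deviation d k.+1 t G ^+ 2 <= energy d L t G.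
Proof.
move=> d0; rewrite /energy.
have -> : \sum_(1 <= k < d.+1) L ^+ (2 * k.+1) * deviation d k.+1 t G ^+ 2
  = \sum_(2 <= k < d.+2) L ^+ (2 * k) * deviation d k t G ^+ 2 by rewrite [RHS]big_add1.
rewrite big_nat_recr //= deviation_out expr0n /= mulr0 addr0 [leRHS]big_ltn //.
by rewrite lerDr (mulr_ge0 _ (sqr_ge0 _)) // exprM exprn_ge0 ?sqr_ge0.
Qed.

(** The cross terms are absorbed by [2 * y * (L * z) <= y ^+ 2 + (L * z) ^+ 2], where
    the factor [L] comes from the weights of neighbouring levels. *)
Lemma energy_step G t L : admissible d G -> (2 * d + 2 <= u G)%N -> (0 < d)%N ->
  0 <= t -> t + 2 / (u G)%:R <= L -> 1 <= L ->
  n%:R * expR (- t) <= 2 * (u G)%:R ->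
  (forall k, (0 < k <= d)%N -> `|deviation d k t G| <= 2 * (u G)%:R) ->
  \sum_(e in available d G) energy d L (t + 2 / (u G)%:R) (e |: G)
  <= (A G)%:R * ((1 - 2 * (2 / (u G)%:R) * (1 - L^-1)) * energy d L t G
        + d%:R * noise R d * L ^+ (4 * d)).
Proof.
move=> aG du d0 t0 tL L1 nuT devT.
have L0 : 0 < L := lt_le_trans ltr01 L1.
have shift := energy_shift L t G d0.
set h := 2 / (u G)%:R in tL *.
have h0 : 0 <= h by rewrite divr_ge0.
rewrite /energy exchange_big /=.
set a := (A G)%:R.
have a0 : 0 <= a by [].
pose X k := L ^+ (2 * k) * deviation d k t G ^+ 2.
have ste k : (0 < k <= d)%N ->
  \sum_(e in available d G) L ^+ (2 * k) * deviation d k (t + h) (e |: G) ^+ 2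
  <= a * (X k - 2 * h * X k + h / L * X k + h / L * X k.+1 + noise R d * L ^+ (4 * d)).
  move=> kd; have [k0 kd'] := andP kd.
  rewrite -mulr_sumr.
  have := deviation_step aG du k0 t0 tL L1 nuT (devT k kd); rewrite -/h.
  have Lk : 0 <= L ^+ (2 * k) by rewrite exprn_ge0 // ltW.
  move=> /(ler_wpM2l Lk) /le_trans; apply.
  rewrite mulrCA ler_wpM2l // /X.
  have -> : L ^+ (2 * k.+1) = L ^+ (2 * k) * L ^+ 2 by rewrite mulnS addnC exprD.
  have nz : L ^+ (2 * k) * (noise R d * L ^+ (2 * d)) <= noise R d * L ^+ (4 * d).
    rewrite mulrCA ler_wpM2l ?noise_ge0 // -exprD; apply: ler_weXn2l => //.
    by move: kd'; clear; lia.
  set Y := deviation d k t G; set Y1 := deviation d k.+1 t G.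
  have cr : 2 * h * (Y * Y1) <= h / L * (Y ^+ 2 + L ^+ 2 * Y1 ^+ 2).
    have -> : 2 * h * (Y * Y1) = h / L * (2 * Y * (L * Y1)) by field; rewrite gt_eqF.
    rewrite ler_wpM2l ?divr_ge0 ?(ltW L0) //; have := sqr_ge0 (Y - L * Y1).
    lra.
  have := ler_wpM2l Lk cr; move: nz; set P := L ^+ (2 * k); set Q := L ^+ (2 * d).
  set N := L ^+ (4 * d); set nn := noise R d; set hL := h / L.
  lra.
have nE : \sum_(1 <= k < d.+1) noise R d * L ^+ (4 * d) = d%:R * noise R d * L ^+ (4 * d).
  by rewrite sumr_const_nat subn1 -[LHS]mulr_natl mulrA.
rewrite big_nat; apply: le_trans (ler_sum _ ste) _.
rewrite -big_nat -mulr_sumr ler_wpM2l // !big_split /= nE sumrN -!mulr_sumr.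
set V := \sum_(1 <= k < d.+1) X k.
have hL0 : 0 <= h / L by rewrite divr_ge0 // ltW.
have := ler_wpM2l hL0 shift.
rewrite -/(energy d L t G) (_ : energy d L t G = V) //.
rewrite (_ : \sum_(1 <= k < d.+1) L ^+ (2 * k.+1) * _ = \sum_(1 <= k < d.+1) X k.+1) //.
set W := \sum_(1 <= k < d.+1) X k.+1; set N := d%:R * _ * _.
lra.
Qed.

Lemma unsat_sum_level G : (u G <= \sum_(1 <= k < d.+1) #|level d G k|)%N.
Proof.
under eq_bigr => k _ do rewrite card_set_sum.
rewrite exchange_big -sum1_card big_mkcond /=; apply: leq_sum => v _.
case: ifP => // vS; rewrite (bigD1_seq (deficit d G v)) ?iota_uniq //= ?eqxx ?leq_addr //.
by rewrite mem_index_iota -unsat_deficit vS ltnS leq_subr.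
Qed.

Lemma expR_le2 (x : R) : x <= 1 / 2 -> expR x <= 2.
Proof.
move=> x2; have : expR (1 / 2 : R) <= 2.
  rewrite -[leRHS]invrK -[leLHS]invrK lef_pV2 ?posrE ?invr_gt0 ?expR_gt0 //.
  by rewrite -expRN; have := expR_ge1Dx (- (1 / 2) : R); lra.
by apply: le_trans; rewrite ler_expR.
Qed.

(** The constant 4 is a bound for [expR (t / L)]. *)
Lemma penalty_small L top t G : 8 <= L -> (0 < n)%N -> 0 <= t -> t <= top -> top <= L ->
  penalty d L top t G < 1 ->
  forall k, (0 < k <= d)%N -> `|deviation d k t G| <= 4 * (n%:R * expR (- t)) / L.
Proof.
move=> L8 n0 t0 ttop topL pen k /andP[k0 kd].
have L0 : 0 < L by lra.
have L1 : 1 <= L by lra.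
have nr : 0 < n%:R :> R by rewrite ltr0n.
have E0 := expR_gt0 t.
have : L ^+ 2 / n%:R ^+ 2 * (expR (2 * (1 - L^-1) * t) * energy d L t G) < 1.
  apply: le_lt_trans pen; rewrite /penalty ler_wpM2l //.
    by rewrite divr_ge0 ?sqr_ge0.
  by rewrite lerDl !mulr_ge0 ?noise_ge0 ?sqr_ge0 ?exprn_ge0 ?subr_ge0 ?ler_expR ?(ltW L0).
have VY : deviation d k t G ^+ 2 <= energy d L t G.
  rewrite /energy (bigD1_seq k) ?iota_uniq ?mem_index_iota ?k0 ?ltnS //=.
  rewrite -[leLHS]addr0; apply: lerD.
    by rewrite ler_peMl ?sqr_ge0 ?exprn_ege1.
  by apply: sumr_ge0 => j _; rewrite mulr_ge0 ?sqr_ge0 ?exprn_ge0 ?(ltW L0).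
set V := energy d L t G in VY *.
have EE : expR t ^+ 2 / 16 <= expR (2 * (1 - L^-1) * t).
  have -> : 2 * (1 - L^-1) * t = 2%:R * t - 2%:R * (t / L) by field; rewrite gt_eqF.
  rewrite expRB expRM_natl; apply: ler_wpM2l; first by rewrite sqr_ge0.
  rewrite lef_pV2 ?posrE ?expR_gt0 //.
  have -> : 2%:R * (t / L) = 2%:R * (2%:R * (t / L / 2)) by field; rewrite gt_eqF.
  rewrite expRM_natl expRM_natl; apply: le_trans (_ : (2 ^+ 2) ^+ 2 <= _).
    apply: lerXn2r; rewrite ?nnegrE ?exprn_ge0 ?expR_ge0 //.
    apply: lerXn2r; rewrite ?nnegrE ?expR_ge0 //; apply: expR_le2.
    have tL1 : t / L <= 1 by rewrite ler_pdivrMr // mul1r; lra.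
    lra.
  by rewrite -!natrX.
move=> lt1; have lt16 : (deviation d k t G * (expR t * L)) ^+ 2 < (4 * n%:R) ^+ 2.
  have : L ^+ 2 / n%:R ^+ 2 * (expR t ^+ 2 / 16 * deviation d k t G ^+ 2) < 1.
    apply: le_lt_trans lt1; apply: ler_wpM2l; first by rewrite divr_ge0 ?sqr_ge0.
    by apply: ler_pM => //; rewrite ?divr_ge0 ?sqr_ge0.
  have -> : L ^+ 2 / n%:R ^+ 2 * (expR t ^+ 2 / 16 * deviation d k t G ^+ 2)
    = (deviation d k t G * (expR t * L)) ^+ 2 / (4 * n%:R) ^+ 2.
    by field; rewrite gt_eqF.
  by rewrite ltr_pdivrMr ?mul1r // exprn_gt0 // mulr_gt0.
have : `|deviation d k t G * (expR t * L)| < 4 * n%:R.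
  rewrite -(@ltr_pXn2r _ 2) ?nnegrE ?normr_ge0 ?mulr_ge0 //.
  by rewrite real_normK ?num_real.
rewrite normrM (gtr0_norm (_ : 0 < expR t * L)) ?mulr_gt0 // => /ltW.
have -> : 4 * (n%:R * expR (- t)) / L = 4 * n%:R / (expR t * L).
  by rewrite expRN; field; rewrite !gt_eqF.
by rewrite ler_pdivlMr // mulr_gt0.
Qed.

End BurnIn.

Section FirstPhase.
Context (R : realType) (d n : nat).
Implicit Types (G : graph n) (e : {set 'I_n}) (v w : 'I_n) (L t : R).
Local Notation u G := #|unsat d G|.
Local Notation A G := #|available d G|.

(** The level of full deficiency alone has prediction [n * expR (- t)]. *)
Lemma unsat_bounds G L t : 8 <= L -> (0 < d)%N -> 0 <= t -> t <= L ->
  (forall k, (0 < k <= d)%N -> `|deviation d k t G| <= 4 * (n%:R * expR (- t)) / L) ->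
  n%:R * expR (- t) <= 2 * (u G)%:R
  /\ (u G)%:R <= 2 * d%:R * L ^+ d * (n%:R * expR (- t)).
Proof.
move=> L8 d0 t0 tL dev; have L0 : 0 < L by lra.
have nu0 : 0 <= n%:R * expR (- t) by rewrite mulr_ge0 ?expR_ge0.
set nu := n%:R * expR (- t) in nu0 dev *.
have dev' k : (0 < k <= d)%N -> `|deviation d k t G| <= nu / 2.
  move=> /dev /le_trans; apply; rewrite ler_pdivrMr //.
  have : nu * 8 <= nu * L by rewrite ler_wpM2l.
  lra.
have yE k : n%:R * (expR (- t) * poisson_shape d k t) = nu * poisson_shape d k t.
  by rewrite mulrA.
split.
  have := dev' d; rewrite d0 leqnn => /(_ isT).
  rewrite /deviation yE /poisson_shape leqnn subnn expr0 divr1 mulr1.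
  have := level_unsat_subset d G d0; rewrite -(ler_nat R) ler_norml => h1 /andP[h2 _].
  lra.
have := unsat_sum_level d G; rewrite -(ler_nat R) natr_sum => /le_trans; apply.
have -> : 2 * d%:R * L ^+ d * nu = \sum_(1 <= k < d.+1) (2 * L ^+ d * nu).
  by rewrite sumr_const_nat subn1 -[RHS]mulr_natl; ring.
rewrite big_nat [leRHS]big_nat; apply: ler_sum => k kd.
have := dev' k kd; rewrite /deviation yE ler_norml => /andP[_ h].
have L1 : 1 <= L by lra.
have q : nu * poisson_shape d k t <= nu * L ^+ d.
  by rewrite ler_wpM2l // poisson_shape_le.
have LL : nu <= nu * L ^+ d by rewrite ler_peMr // exprn_ege1.
lra.
Qed.

(** The noise of a step is proportional to [expR (2 * t)]. Writing 1 as
    [u * (2 / u) / 2] and using the upper bound on [u] turns it into a multiple of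
    [n * expR t] times the increment of the clock, hence of an increment of
    [expR t]. *)
Lemma penalty_step L top t G : admissible d G -> (0 < d)%N -> (0 < n)%N ->
  8 <= L -> 0 <= t -> t + 2 / (u G)%:R <= L -> (2 * d + 4 <= u G)%N ->
  (forall k, (0 < k <= d)%N -> `|deviation d k t G| <= 4 * (n%:R * expR (- t)) / L) ->
  \sum_(e in available d G) penalty d L top (t + 2 / (u G)%:R) (e |: G)
  <= (A G)%:R * penalty d L top t G.
Proof.
move=> aG d0 n0 L8 t0 tL du dev.
have L0 : 0 < L by lra.
have L1 : 1 <= L by lra.
have T4 : 4 <= (u G)%:R :> R by rewrite (ler_nat R 4); move: du; clear; lia.
have tL' : t <= L.
  by apply: le_trans tL; rewrite lerDl divr_ge0.
have [nu2 uU] := unsat_bounds L8 d0 t0 tL' dev.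
have nu0 : 0 <= n%:R * expR (- t) by rewrite mulr_ge0 ?expR_ge0.
have devu k : (0 < k <= d)%N -> `|deviation d k t G| <= 2 * (u G)%:R.
  move=> /dev /le_trans; apply; apply: le_trans nu2.
  rewrite ler_pdivrMr //; have : n%:R * expR (- t) * 8 <= n%:R * expR (- t) * L by rewrite ler_wpM2l.
  lra.
have du' : (2 * d + 2 <= u G)%N by move: du; clear; lia.
have := energy_step aG du' d0 t0 tL L1 nu2 devu.
set T := (u G)%:R in T4 tL uU *.
set h := 2 / T in tL *.
have T0 : 0 < T by lra.
have h0 : 0 < h by rewrite divr_gt0.
have h12 : h <= 1 / 2 by rewrite ler_pdivrMr //; lra.
set a := (A G)%:R; have a0 : 0 <= a by [].
set V := energy d L t G => EV.
have V0 : 0 <= V by apply: energy_ge0; exact: ltW.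
rewrite /penalty -/V -mulr_sumr [leRHS]mulrCA.
apply: ler_wpM2l; first by rewrite divr_ge0 ?sqr_ge0.
rewrite big_split /= -mulr_sumr sum_cst -/a.
set th := 1 - L^-1 in EV *.
have th0 : 0 <= th by rewrite subr_ge0 invf_le1.
have th1 : th <= 1 by rewrite /th lerBlDr lerDl invr_ge0 ltW.
set K := 4 * d%:R ^+ 2 * noise R d.
have K0 : 0 <= K by rewrite /K mulr_ge0 ?noise_ge0 // mulr_ge0 ?sqr_ge0.
set F := expR (2 * th * (t + h)); have F0 : 0 <= F by exact: expR_ge0.
have FE : F * (1 - 2 * h * th) <= expR (2 * th * t).
  have -> : F = expR (2 * th * t) * expR (2 * th * h) by rewrite /F -expRD; congr expR; ring.
  rewrite -mulrA ler_piMr ?expR_ge0 //.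
  have := expR_ge1Dx (- (2 * th * h)); rewrite expRN => le.
  have p0 := expR_gt0 (2 * th * h).
  apply: (@le_trans _ _ (expR (2 * th * h) * (expR (2 * th * h))^-1)).
    by rewrite ler_wpM2l ?(ltW p0) //; lra.
  by rewrite mulfV // gt_eqF.
have Fb : F <= 4 * expR t ^+ 2.
  apply: (@le_trans _ _ (expR (2%:R * (t + h)))).
    rewrite ler_expR -mulrA; apply: ler_wpM2l => //.
    by rewrite ler_piMl // addr_ge0 // ltW.
  rewrite expRM_natl expRD exprMn mulrC ler_wpM2r ?sqr_ge0 //.
  have -> : 4 = 2 ^+ 2 :> R by rewrite -natrX.
  by apply: lerXn2r; rewrite ?nnegrE ?expR_ge0 //; exact: expR_le2.
have eh : h * expR t <= expR (t + h) - expR t.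
  rewrite expRD; have := expR_ge1Dx h; have := expR_gt0 t; nra.
have Lp : 0 <= L ^+ (4 * d) by rewrite exprn_ge0 // ltW.
have pay : F * (d%:R * noise R d * L ^+ (4 * d))
    <= K * n%:R * L ^+ (5 * d) * (expR (t + h) - expR t).
  have p0 : 0 <= d%:R * noise R d * L ^+ (4 * d).
    by rewrite mulr_ge0 // mulr_ge0 ?noise_ge0.
  apply: le_trans (ler_wpM2r p0 Fb) _.
  have -> : 4 * expR t ^+ 2 * (d%:R * noise R d * L ^+ (4 * d))
     = (2 * h * d%:R * noise R d * L ^+ (4 * d) * expR t ^+ 2) * T.
    by rewrite /h; field; rewrite gt_eqF.
  apply: (@le_trans _ _ ((2 * h * d%:R * noise R d * L ^+ (4 * d) * expR t ^+ 2) *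
     (2 * d%:R * L ^+ d * (n%:R * expR (- t))))).
    apply: ler_wpM2l => //; apply: mulr_ge0 (sqr_ge0 _).
    apply: mulr_ge0 => //; apply: mulr_ge0 (noise_ge0 R d).
    by apply: mulr_ge0 => //; apply: mulr_ge0 => //; exact: ltW.
  have -> : 2 * h * d%:R * noise R d * L ^+ (4 * d) * expR t ^+ 2 *
     (2 * d%:R * L ^+ d * (n%:R * expR (- t)))
    = K * n%:R * L ^+ (5 * d) * (h * expR t).
    have -> : (5 * d = 4 * d + d)%N by rewrite mulSn addnC.
    rewrite exprD expRN /K; have En : expR t != 0 by rewrite gt_eqF ?expR_gt0.
    move: (L ^+ (4 * d)) (L ^+ d) (noise R d) (expR t) En => x y z E En.
    by field.
  apply: ler_wpM2l eh; apply: mulr_ge0; first exact: mulr_ge0.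
  by rewrite exprn_ge0 // ltW.
have := ler_wpM2l F0 EV; rewrite -/h.
move: pay FE; set P := d%:R * noise R d * L ^+ (4 * d).
set Q := K * n%:R * L ^+ (5 * d); set S := \sum_(_ in _) _.
move=> pay FE FS.
have := ler_wpM2l a0 pay; have := ler_wpM2l a0 (ler_wpM2r V0 FE).
lra.
Qed.

(** To bound an expectation it is enough to bound it at the graphs that are close
    to the prediction at some time between [ts] and [ts + 1]. A graph that strays
    from the prediction has penalty at least 1, so that the claim is trivial
    there. *)
Lemma burn_in (g : graph n -> R) (T L ts : R) :
  (0 < d)%N -> (0 < n)%N -> 8 <= L -> 0 <= ts -> ts + 1 <= L ->
  2 * (2 * d%:R + 4) <= n%:R * expR (- (ts + 1)) ->
  (forall H, g H <= T + 1) ->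
  (forall m G t, admissible d G -> ts <= t -> t <= ts + 1 ->
    (forall k, (0 < k <= d)%N -> `|deviation d k t G| <= 4 * (n%:R * expR (- t)) / L) ->
    ('C(n, 2) <= #|G| + m)%N -> expect d g m G <= T) ->
  expect d g 'C(n, 2) set0
    <= T + 4 * d%:R ^+ 2 * noise R d * L ^+ (5 * d + 2) * expR (ts + 1) / n%:R.
Proof.
move=> d0 n0 L8 ts0 tsL nlarge gT late.
have L0 : 0 < L by lra.
have nr : 0 < n%:R :> R by rewrite ltr0n.
have expT m G : expect d g m G <= T + 1.
  elim: m G => [|m IH] G //=.
  apply: (@le_trans _ _ (\sum_H step_prob R d G H * (T + 1))).
    by apply: ler_sum => H _; rewrite ler_wpM2l ?step_prob_ge0.
  by rewrite -mulr_suml sum_step_prob mul1r.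
set K := 4 * d%:R ^+ 2 * noise R d.
have K0 : 0 <= K by rewrite /K mulr_ge0 ?noise_ge0 // mulr_ge0 ?sqr_ge0.
pose I t G := admissible d G /\ 0 <= t <= ts + 1.
have pen0 t G : I t G -> 0 <= penalty d L (ts + 1) t G.
  move=> [_ /andP[_ tt]]; rewrite /penalty mulr_ge0 ?divr_ge0 ?sqr_ge0 //.
  rewrite addr_ge0 ?mulr_ge0 ?expR_ge0 ?energy_ge0 ?exprn_ge0 ?subr_ge0 ?ler_expR ?noise_ge0 ?sqr_ge0 ?(ltW L0) //.
have start : penalty d L (ts + 1) 0 (set0 : graph n) <= K * L ^+ (5 * d + 2) * expR (ts + 1) / n%:R.
  have -> : penalty d L (ts + 1) 0 (set0 : graph n)
     = K * L ^+ (5 * d + 2) * (expR (ts + 1) - 1) / n%:R.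
    rewrite /penalty expR0 (_ : energy d L 0 set0 = 0) ?mulr0 ?add0r; last first.
      rewrite /energy big_nat big1 // => k /andP[k0]; rewrite ltnS => kd.
      rewrite /deviation oppr0 expR0 mul1r /poisson_shape kd expr0n.
      have degE v : degree (set0 : graph n) v = 0%N.
        by apply/eqP; rewrite cards_eq0; apply/eqP/setP => e; rewrite !inE.
      have levE : level d (set0 : graph n) k = if k == d then setT else set0.
        apply/setP => v; rewrite !inE /deficit degE subn0 eq_sym.
        by case: ifP => _; rewrite inE.
      rewrite levE; case: (eqVneq k d) => [->|kd'].
        by rewrite subnn eqxx fact0 divr1 mulr1 cardsT card_ord subrr expr0n mulr0.
      rewrite subn_eq0 leqNgt ltn_neqAle kd' kd /=.
      by rewrite mul0r mulr0 cards0 subrr expr0n mulr0.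
    rewrite -/K exprD; field; by rewrite gt_eqF.
  rewrite ler_pM2r ?invr_gt0 //; apply: ler_wpM2l.
    by apply: mulr_ge0 => //; rewrite exprn_ge0 // ltW.
  by rewrite lerBlDr lerDl.
apply: le_trans (_ : T + penalty d L (ts + 1) 0 (set0 : graph n) <= _); last first.
  by rewrite lerD2l.
apply: (@expect_le R d n g (fun G => 2 / (u G)%:R) I
   (fun t G => T + penalty d L (ts + 1) t G)) => [t G [] //|||]; last 2 first.
- by split; [exact: admissible0 | rewrite lexx /=; lra].
- by rewrite cards0.
move=> t G IG; have [aG /andP[t0 tt]] := IG.
(* a large penalty makes the bound trivial, and at a late time the hypothesis
   applies; otherwise one more step is taken *)
have [big|small] := leP 1 (penalty d L (ts + 1) t G).
  by left=> m _; apply: le_trans (expT m G) _; rewrite lerD2l.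
have dev := penalty_small L8 n0 t0 tt tsL small.
have [late_t|early] := leP ts t.
  by left=> m cG; apply: le_trans (late m G t _ _ _ _ _) _ => //; rewrite lerDl pen0.
have tL : t <= L by lra.
have [nu2 _] := unsat_bounds L8 d0 t0 tL dev.
have du : (2 * d + 4 <= u G)%N.
  rewrite -(ler_nat R) natrD natrM.
  have : n%:R * expR (- (ts + 1)) <= n%:R * expR (- t).
    by rewrite ler_wpM2l // ler_expR lerN2.
  lra.
have u4 : 4 <= (u G)%:R :> R by rewrite (ler_nat R 4); move: du; clear; lia.
have h1 : 2 / (u G)%:R <= 1 :> R by rewrite ler_pdivrMr; lra.
have h0 : 0 <= 2 / (u G)%:R :> R by rewrite divr_ge0.
have a0 : available d G != set0.
  have du' : (2 * d + 2 <= u G)%N by move: du; clear; lia.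
  rewrite -cards_eq0 -lt0n -(ltr_nat R); have := available_lower R aG du'.
  have : 0 < (u G)%:R ^+ 2 :> R by rewrite exprn_gt0 //; lra.
  lra.
right; split=> // [e eA|].
  by split; [exact: admissible_step | apply/andP; split; lra].
rewrite big_split /= sum_cst mulrDr mulrC lerD2l.
by apply: penalty_step => //; lra.
Qed.

End FirstPhase.

(** * The risk in terms of the level counts *)
Definition atleast (d n : nat) (G : graph n) (j : nat) : {set 'I_n} :=
  [set v | (j <= deficit d G v)%N].

Section RiskBound.
Context (R : realType) (d n s : nat) (delta : R).
Hypotheses (delta_gt0 : 0 < delta) (delta_le1 : delta <= 1).
Hypothesis s23 : (1 < s <= 3)%N.
Implicit Types (G : graph n) (P : {set 'I_n}) (v w z : 'I_n).
Local Notation u G := #|unsat d G|.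
Local Notation x G j := #|risky_sets d s G j|.

Definition adjacent_pairs G : {set 'I_n * 'I_n} :=
  [set y | [&& y.1 \in unsat d G, y.2 \in unsat d G & [set y.1; y.2] \in G]].

Lemma card_adjacent_pairs G : admissible d G -> (#|adjacent_pairs G| <= d * u G)%N.
Proof.
move=> aG; rewrite card_set_sum -(pair_big xpredT xpredT (fun v w =>
     ([&& v \in unsat d G, w \in unsat d G & [set v; w] \in G] : nat))) /=.
rewrite mulnC -sum_nat_const [leqRHS]big_mkcond; apply: leq_sum => v _.
case: (boolP (v \in unsat d G)) => vS; last by rewrite big1.
by apply: leq_trans (ltnW (adj_lt aG vS)); rewrite /adj card_set_sum.
Qed.

Lemma risky1_count G : (x G 1 <= #|atleast d G s.+1|)%N.
Proof.
rewrite -[leqRHS](card_imset _ (@set1_inj _)); apply: subset_leq_card; apply/subsetP => P.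
rewrite inE => /andP[/andP[_ rP] P1].
case/or3P: rP => [/existsP[v /andP[/eqP -> sv]]|
   /existsP[v /existsP[w /and4P[vw /eqP PE _ _]]]|
   /existsP[v /existsP[w /existsP[z /and4P[/and3P[vw vz wz] /eqP PE _ _]]]]].
- by apply: imset_f; rewrite inE.
- by move: P1; rewrite PE cards2 vw.
- by move: P1; rewrite PE cards3.
Qed.

Lemma linkedP G v w : linked d G v w ->
  [set v; w] \in G \/ (v \in atleast d G 2 /\ w \in atleast d G 2).
Proof. by case/orP => [|/andP[]]; [left | rewrite !inE; right]. Qed.

(** One vertex of a risky pair that is not adjacent has deficiency at least [s]:
    two deficiencies at most 2 add up to less than [3 + 2]. *)
Lemma risky2_count G : admissible d G ->
  (x G 2 <= d * u G + #|atleast d G 2| * #|atleast d G s|)%N.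
Proof.
move=> aG; rewrite -cardsX.
apply: leq_trans (leq_add (card_adjacent_pairs aG) (leqnn _)).
apply: leq_trans (leq_card_setU _ _).
apply: leq_trans (leq_imset_card (fun y : 'I_n * 'I_n => [set y.1; y.2]) _).
apply: subset_leq_card; apply/subsetP => P.
rewrite inE => /andP[/andP[/subsetP Psub rP] P2].
case/or3P: rP => [/existsP[v /andP[/eqP PE sv]]|
   /existsP[v /existsP[w /and4P[vw /eqP PE lvw svw]]]|
   /existsP[v /existsP[w /existsP[z /and4P[/and3P[vw vz wz] /eqP PE _ _]]]]].
- by move: P2; rewrite PE cards1.
- have [vS wS] : v \in unsat d G /\ w \in unsat d G.
    by split; apply: Psub; rewrite PE !inE eqxx ?orbT.
  case: (boolP ([set v; w] \in G)) => vwG.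
    by apply/imsetP; exists (v, w); rewrite // in_setU [_ \in adjacent_pairs G]inE /= vS wS vwG.
  move: svw; rewrite vwG /= => svw.
  case: (linkedP lvw) => [E|[v2 w2]]; first by rewrite E in vwG.
  have [ws|ws] := leqP s (deficit d G w).
    by apply/imsetP; exists (v, w); rewrite // in_setU in_setX /= v2 [_ \in atleast d G s]inE ws orbT.
  apply/imsetP; exists (w, v); last by rewrite PE setUC.
  rewrite in_setU in_setX /= w2 [v \in atleast d G s]inE.
  apply/orP; right => /=; move: svw ws s23; clear; lia.
- by move: P2; rewrite PE cards3.
Qed.

(** A risky triple contains an adjacent pair, or all its deficiencies are at
    least 2. *)
Lemma risky3_count G : admissible d G ->
  (x G 3 <= d * u G * u G + #|atleast d G 2| ^ 3)%N.
Proof.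
move=> aG; have -> : (#|atleast d G 2| ^ 3 =
   #|setX (setX (atleast d G 2) (atleast d G 2)) (atleast d G 2)|)%N.
  by rewrite !cardsX !expnS expn0 muln1 mulnA.
apply: (@leq_trans (#|setX (adjacent_pairs G) (unsat d G)| +
   #|setX (setX (atleast d G 2) (atleast d G 2)) (atleast d G 2)|)); last first.
  by rewrite leq_add2r cardsX leq_mul2r card_adjacent_pairs ?orbT.
apply: leq_trans (leq_card_setU _ _).
apply: leq_trans (leq_imset_card
  (fun y : 'I_n * 'I_n * 'I_n => [set y.1.1; y.1.2; y.2]) _).
apply: subset_leq_card; apply/subsetP => P.
rewrite inE => /andP[/andP[/subsetP Psub rP] P3].
case/or3P: rP => [/existsP[v /andP[/eqP PE sv]]|
   /existsP[v /existsP[w /and4P[vw /eqP PE lvw svw]]]|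
   /existsP[v /existsP[w /existsP[z /and4P[/and3P[vw vz wz] /eqP PE lvw h]]]]].
- by move: P3; rewrite PE cards1.
- by move: P3; rewrite PE cards2 vw.
have [vS wS zS] : [/\ v \in unsat d G, w \in unsat d G & z \in unsat d G].
  by split; apply: Psub; rewrite PE !inE eqxx ?orbT.
have adjP a b c : P = [set a; b; c] -> [set a; b] \in G -> a \in unsat d G ->
    b \in unsat d G -> c \in unsat d G ->
    P \in [set [set y.1.1; y.1.2; y.2] | y in setX (adjacent_pairs G) (unsat d G)
      :|: setX (setX (atleast d G 2) (atleast d G 2)) (atleast d G 2)].
  move=> PE' abG aS bS cS; apply/imsetP; exists (a, b, c) => //.
  by rewrite in_setU !in_setX /= cS [_ \in adjacent_pairs G]inE /= aS bS abG.
case: (linkedP lvw) => [E|[v2 w2]]; first exact: adjP E vS wS zS.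
have heavyP : z \in atleast d G 2 -> P \in [set [set y.1.1; y.1.2; y.2] | y in
   setX (adjacent_pairs G) (unsat d G)
      :|: setX (setX (atleast d G 2) (atleast d G 2)) (atleast d G 2)].
  move=> z2; apply/imsetP; exists (v, w, z) => //.
  by rewrite in_setU !in_setX /= v2 w2 z2 orbT.
case/orP: h => [sz|/andP[lvz lwz]].
  by apply: heavyP; rewrite inE; apply: leq_trans sz; case/andP: s23.
case: (linkedP lvz) => [E|[_ z2]]; last exact: heavyP.
by apply: (adjP v z w) => //; rewrite PE setUAC.
Qed.

(** At the end of the first phase the four terms are, besides the common factor, of
    order [L ^- s], [u ^-1], [L ^- s] and [L ^- 3], with [L = ln n]. *)
Lemma risk_le G : admissible d G -> (0 < u G)%N ->
  risk d s delta G <= (12 / delta) ^+ (3 * d) * slow delta (u G) *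
    (#|atleast d G s.+1|%:R / (u G)%:R + 2 * d%:R / (u G)%:R
     + (#|atleast d G 2|%:R / (u G)%:R) * (#|atleast d G s|%:R / (u G)%:R)
     + (#|atleast d G 2|%:R / (u G)%:R) ^+ 3).
Proof.
move=> aG u0; have dl1 : delta <= 1 by [].
have gam1 : 1 <= 12 / delta by rewrite ler_pdivlMr // mul1r; lra.
set gam := 12 / delta in gam1 *.
have gam0 : 0 <= gam by lra.
have T0 : 0 < (u G)%:R :> R by rewrite ltr0n.
set T := (u G)%:R in T0 *.
have sl0 := slow_gt0 delta_gt0 (u G).
apply: (@le_trans _ _ (gam ^+ (3 * d) * slow delta (u G) *
   \sum_(P | risky d s G P) (T ^+ #|P|)^-1)).
  rewrite mulr_sumr; apply: ler_sum => P rP; rewrite -mulrA /weight -/gam -/T.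
  apply: ler_wpM2r; first by rewrite divr_ge0 ?exprn_ge0 // ltW.
  apply: ler_weXn2l => //.
  apply: (@leq_trans (\sum_(v in P) d)); first by apply: leq_sum => v _; exact: leq_subr.
  by rewrite sum_nat_const leq_mul2r; case/andP: (risky_card rP) => _ ->; rewrite orbT.
rewrite ler_wpM2l ?mulr_ge0 ?exprn_ge0 ?(ltW sl0) //.
have E j : #|risky_sets d s G j|%:R / T ^+ j
   = \sum_(P | risky d s G P) (#|P| == j)%:R / T ^+ j :> R.
  rewrite -mulr_suml; congr (_ / _); rewrite card_set_sum natr_sum [RHS]big_mkcond.
  by apply: eq_bigr => P _; case: (risky d s G P).
have -> : \sum_(P | risky d s G P) (T ^+ #|P|)^-1 =
   (x G 1)%:R / T ^+ 1 + (x G 2)%:R / T ^+ 2 + (x G 3)%:R / T ^+ 3.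
  rewrite !E -!big_split /=; apply: eq_bigr => P rP.
  have := risky_card rP; case: #|P| => [|[|[|[|//]]]] //= _;
    by rewrite ?mul0r ?mul1r ?addr0 ?add0r.
have h1 : (x G 1)%:R <= #|atleast d G s.+1|%:R :> R by rewrite ler_nat risky1_count.
have h2 : (x G 2)%:R <= d%:R * T + #|atleast d G 2|%:R * #|atleast d G s|%:R.
  by rewrite -!natrM -natrD ler_nat risky2_count.
have h3 : (x G 3)%:R <= d%:R * T * T + #|atleast d G 2|%:R ^+ 3.
  by rewrite -natrX -!natrM -natrD ler_nat risky3_count.
set X1 := (x G 1)%:R in h1 *; set X2 := (x G 2)%:R in h2 *; set X3 := (x G 3)%:R in h3 *.
set a := #|atleast d G 2|%:R in h2 h3 *; set b := #|atleast d G s|%:R in h2 *.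
set c := #|atleast d G s.+1|%:R in h1 *.
have Tn : T != 0 by rewrite gt_eqF.
have -> : c / T + 2 * d%:R / T + a / T * (b / T) + (a / T) ^+ 3
  = c / T ^+ 1 + (d%:R * T + a * b) / T ^+ 2 + (d%:R * T * T + a ^+ 3) / T ^+ 3 by field.
by apply: lerD; [apply: lerD|]; rewrite ler_wpM2r // invr_ge0 exprn_ge0 // ltW.
Qed.

End RiskBound.

(** * Proportions at the end of the first phase *)

(** A lower bound for the proportion that the unsaturated vertices bear to
    [n * expR (- t) * L ^+ d.-1], valid for [L / 2 <= t]. *)
Definition unsat_const (R : realType) (d : nat) : R := (2 ^+ d * (d.-1)`!%:R)^-1.

Definition limit_const (R : realType) (d r : nat) : R :=
  (d.-1)`!%:R / (d.-1 - r)`!%:R.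

Section Late.
Context (R : realType) (d n : nat) (G : graph n) (L t : R).
Local Notation u := (#|unsat d G|%:R : R).
Local Notation nu := (n%:R * expR (- t)).
Local Notation c1 := (unsat_const R d).
Hypotheses (d_gt1 : (1 < d)%N) (n_gt0 : (0 < n)%N) (L8 : 8 <= L).
Hypotheses (t_lo : L / 2 <= t) (t_hi : t <= L) (L_large : 4 / L <= c1).
Hypothesis dev : forall k, (0 < k <= d)%N -> `|deviation d k t G| <= 4 * nu / L.

Let L0 : 0 < L. Proof. by have := L8; lra. Qed.
Let L1 : 1 <= L. Proof. by have := L8; lra. Qed.
Let t0 : 0 <= t. Proof. by have := t_lo; have := L0; lra. Qed.
Let nu0 : 0 < nu. Proof. by rewrite mulr_gt0 ?ltr0n ?expR_gt0. Qed.
Let c10 : 0 < c1. Proof. by rewrite invr_gt0 mulr_gt0 ?exprn_gt0 // ltr0n fact_gt0. Qed.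
Let d1 : (0 < d)%N. Proof. exact: ltnW. Qed.

Let Ld : L ^+ d = L * L ^+ d.-1. Proof. by rewrite -exprS prednK. Qed.

Lemma level_approx k : (0 < k <= d)%N ->
  `|#|level d G k|%:R - nu * (t ^+ (d - k) / (d - k)`!%:R)| <= 4 * nu / L.
Proof.
move=> kd; have := dev kd; rewrite /deviation /poisson_shape mulrA.
by case/andP: kd => _ ->.
Qed.

Lemma late_unsat : c1 * nu * L ^+ d.-1 <= u.
Proof.
have := level_approx (k := 1); rewrite d1 => /(_ isT); rewrite subn1 => h.
have U1 : #|level d G 1|%:R <= u by rewrite ler_nat level_unsat_subset.
move: h; rewrite ler_norml => /andP[h _].
have LL : 1 <= L ^+ d.-1 by rewrite exprn_ege1 // L1.
have tt : 2 * c1 * L ^+ d.-1 <= t ^+ d.-1 / (d.-1)`!%:R.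
  rewrite ler_pdivlMr ?ltr0n ?fact_gt0 //.
  have -> : 2 * c1 * L ^+ d.-1 * (d.-1)`!%:R = (L / 2) ^+ d.-1.
    rewrite /unsat_const -{1}(prednK d1) exprS expr_div_n; field.
    by rewrite expf_neq0 ?pnatr_eq0 //= -lt0n fact_gt0.
  apply: lerXn2r; rewrite ?nnegrE ?t0 //.
  by rewrite divr_ge0 // ltW // L0.
have q : 4 / L <= c1 * L ^+ d.-1.
  by apply: le_trans L_large _; rewrite ler_peMr // ltW // c10.
have := ler_wpM2l (ltW nu0) tt; have := ler_wpM2l (ltW nu0) q.
set P := t ^+ _ / _ in h *; set Q := L ^+ _.
have -> : nu * (4 / L) = 4 * nu / L by rewrite mulrCA mulrA.
lra.
Qed.

Lemma late_level k : (0 < k <= d)%N -> #|level d G k|%:R <= 5 * nu * L ^+ d / L ^+ k.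
Proof.
move=> kd; have := level_approx kd; case/andP: kd => k0 kd; rewrite ler_norml => /andP[_ h].
have -> : 5 * nu * L ^+ d / L ^+ k = 5 * nu * L ^+ (d - k).
  by rewrite -mulrA; congr (_ * _); rewrite -expfB_cond // gt_eqF ?L0 //; lia.
have tt : t ^+ (d - k) / (d - k)`!%:R <= L ^+ (d - k).
  apply: (@le_trans _ _ (t ^+ (d - k))).
    by rewrite ler_piMr ?exprn_ge0 ?fact_inv_le1 // t0.
  by apply: lerXn2r; rewrite ?nnegrE ?t0 ?(ltW L0) ?t_hi.
have i1 : L^-1 <= L ^+ (d - k).
  by apply: (@le_trans _ _ 1); [rewrite invf_le1 ?L1 ?L0 | rewrite exprn_ege1 ?L1].
have := ler_wpM2l (ltW nu0) tt; have := ler_wpM2l (ltW nu0) i1; lra.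
Qed.

Lemma late_atleast j : (0 < j)%N ->
  #|atleast d G j|%:R <= 5 * d%:R * nu * L ^+ d / L ^+ j.
Proof.
move=> j0.
have sub : (#|atleast d G j| <= \sum_(1 <= k < d.+1 | (j <= k)%N) #|level d G k|)%N.
  under eq_bigr => k _ do rewrite card_set_sum.
  rewrite exchange_big card_set_sum /=; apply: leq_sum => v _.
  case: (boolP (j <= deficit d G v)%N) => // jv.
  rewrite big_mkcond (bigD1_seq (deficit d G v)) ?iota_uniq //=.
    by rewrite jv eqxx leq_addr.
  by rewrite mem_index_iota (leq_trans j0 jv) ltnS leq_subr.
move: sub; rewrite -(ler_nat R) natr_sum => /le_trans; apply.
have p0 : 0 <= 5 * nu * L ^+ d / L ^+ j.
  by rewrite mulr_ge0 ?invr_ge0 ?mulr_ge0 ?exprn_ge0 ?(ltW L0) ?expR_ge0.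
apply: (@le_trans _ _ (\sum_(1 <= k < d.+1) (5 * nu * L ^+ d / L ^+ j))); last first.
  by rewrite sumr_const_nat subn1 -[leLHS]mulr_natl le_eqVlt; apply/orP; left; apply/eqP; rewrite /=; ring.
rewrite big_mkcond big_nat [leRHS]big_nat; apply: ler_sum => k kd.
case: ifP => // jk; apply: le_trans (late_level kd) _.
rewrite ler_wpM2l ?mulr_ge0 ?exprn_ge0 ?(ltW L0) ?expR_ge0 //.
by rewrite lef_pV2 ?posrE ?exprn_gt0 ?L0 //; apply: ler_weXn2l; rewrite ?L1.
Qed.

Lemma late_atleast_share j : (0 < j)%N ->
  #|atleast d G j|%:R / u <= 5 * d%:R / c1 * (L / L ^+ j).
Proof.
move=> j0; have ub := late_unsat.
have LL : 0 < L ^+ d.-1 by rewrite exprn_gt0 ?L0.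
have u0 : 0 < u by apply: lt_le_trans ub; rewrite mulr_gt0 // mulr_gt0 ?c10.
rewrite ler_pdivrMr //; apply: le_trans (late_atleast j0) _.
have -> : 5 * d%:R * nu * L ^+ d / L ^+ j
  = 5 * d%:R / c1 * (L / L ^+ j) * (c1 * nu * L ^+ d.-1).
  rewrite Ld; move: c10 (exprn_gt0 j L0); move: (L ^+ j) (L ^+ d.-1) c1 => a b c ? ?.
  by field; rewrite !gt_eqF.
have L0' := ltW L0; have c10' := ltW c10.
apply: ler_wpM2l ub; apply: mulr_ge0; first by apply: divr_ge0 => //; exact: mulr_ge0.
by apply: divr_ge0 => //; exact: exprn_ge0.
Qed.

Lemma pow_deficit (y eta : R) r : 0 <= y -> y <= 1 -> 1 - y <= eta ->
  0 <= 1 - y ^+ r <= r%:R * eta.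
Proof.
move=> y0 y1 yeta; have := @bernoulli R (1 - y) r; rewrite opprB addrCA subrr addr0 => b.
have b' := b (ltac:(lra)).
have : y ^+ r <= 1 by rewrite exprn_ile1.
have : r%:R * (1 - y) <= r%:R * eta by rewrite ler_wpM2l.
by move=> ? ?; apply/andP; split; lra.
Qed.

(** Multiplying numerator and denominator by suitable constants, their main terms
    cancel up to the factor [(t / L) ^+ r], which is close to 1. *)
Lemma late_share eta r : (0 < r < d)%N -> L - t <= eta * L ->
  `|share R d r.+1 G * L ^+ r - limit_const R d r|
  <= c1^-1 * (r%:R * eta + (4 + limit_const R d r * (4 + 5 * d%:R)) / L).
Proof.
move=> /andP[r0 rd] teta.
have ub := late_unsat.
have LL : 0 < L ^+ d.-1 by rewrite exprn_gt0 ?L0.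
have u0 : 0 < u by apply: lt_le_trans ub; rewrite mulr_gt0 // mulr_gt0 ?c10.
set cs := limit_const R d r.
have f0 : 0 < (d.-1 - r)`!%:R :> R by rewrite ltr0n fact_gt0.
have g0 : 0 < (d.-1)`!%:R :> R by rewrite ltr0n fact_gt0.
have cs0 : 0 <= cs by rewrite divr_ge0 // ltW.
have Lr : 0 < L ^+ r by rewrite exprn_gt0 ?L0.
have dr : (d - r.+1 = d.-1 - r)%N by rewrite -subn1 subnAC -subnDA addn1.
have Ldr : L ^+ d.-1 = L ^+ (d.-1 - r) * L ^+ r by rewrite -exprD subnK // -ltnS prednK.
have hs : `|#|level d G r.+1|%:R - nu * (t ^+ (d.-1 - r) / (d.-1 - r)`!%:R)| <= 4 * nu / L.
  by rewrite -dr; apply: level_approx; rewrite rd.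
have hu : `|u - nu * (t ^+ d.-1 / (d.-1)`!%:R)| <= (4 + 5 * d%:R) * nu * L ^+ d.-1 / L.
  have h1 := level_approx (k := 1); rewrite d1 subn1 in h1; have {}h1 := h1 isT.
  have U : u = #|level d G 1|%:R + #|atleast d G 2|%:R.
    rewrite -natrD; congr (_%:R).
    rewrite -(cardsID (level d G 1) (unsat d G)); congr addn.
      by apply: eq_card => v; rewrite in_setI unsat_deficit inE; case: (deficit d G v) => [|[]].
    apply: eq_card => v; rewrite in_setD unsat_deficit [v \in level _ _ _]inE.
    by rewrite [v \in atleast _ _ _]inE; case: (deficit d G v) => [|[]].
  have h2 := late_atleast (j := 2) isT.
  have i1 : 1 <= L ^+ d.-1 by rewrite exprn_ege1 ?L1.
  have E2 : 5 * d%:R * nu * L ^+ d / L ^+ 2 = 5 * d%:R * nu * L ^+ d.-1 / L.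
    by rewrite Ld; field; rewrite gt_eqF ?L0.
  rewrite E2 in h2.
  have i2 : 4 * nu / L <= 4 * nu * L ^+ d.-1 / L.
    by rewrite ler_wpM2r ?invr_ge0 ?(ltW L0) // ler_peMr // mulr_ge0 // ltW.
  have a0 : 0 <= #|atleast d G 2|%:R :> R by [].
  rewrite U; move: h1; rewrite !ler_norml => /andP[h3 h4].
  set X := t ^+ _ / _ in h3 h4 *; set Y := L ^+ d.-1 in h2 i2 *.
  by apply/andP; split; lra.
have /andP[p0 p1] : 0 <= 1 - (t / L) ^+ r <= r%:R * eta.
  apply: pow_deficit; first by rewrite divr_ge0 ?t0 // ltW // L0.
    by rewrite ler_pdivrMr ?L0 // mul1r t_hi.
  by rewrite -(ler_pM2r L0) mulrBl divfK ?gt_eqF ?L0 // mul1r.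
set X := nu * (t ^+ (d.-1 - r) / (d.-1 - r)`!%:R) in hs *.
set Z := nu * (t ^+ d.-1 / (d.-1)`!%:R) in hu *.
have XZ : cs * Z = X * (t / L) ^+ r * L ^+ r.
  have E : (t / L) ^+ r * L ^+ r = t ^+ r by rewrite -exprMn divfK ?gt_eqF ?L0.
  rewrite -[RHS]mulrA E /cs /limit_const /Z /X.
  have -> : t ^+ d.-1 = t ^+ (d.-1 - r) * t ^+ r by rewrite -exprD subnK // -ltnS prednK.
  by field; rewrite !gt_eqF.
have X0 : 0 <= X by rewrite /X mulr_ge0 ?divr_ge0 ?exprn_ge0 ?t0 // ltW.
have XL : X * L ^+ r <= nu * L ^+ d.-1.
  rewrite Ldr mulrA ler_pM2r // /X ler_pM2l //.
  apply: (@le_trans _ _ (t ^+ (d.-1 - r))).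
    by rewrite ler_piMr ?exprn_ge0 ?fact_inv_le1 // t0.
  by apply: lerXn2r; rewrite ?nnegrE ?t0 ?(ltW L0) ?t_hi.
clearbody X Z cs.
have key : `|#|level d G r.+1|%:R * L ^+ r - cs * u|
   <= nu * L ^+ d.-1 * (r%:R * eta + (4 + cs * (4 + 5 * d%:R)) / L).
  set U := #|level d G r.+1|%:R in hs *.
  have -> : U * L ^+ r - cs * u
     = (U - X) * L ^+ r + X * L ^+ r * (1 - (t / L) ^+ r) - cs * (u - Z).
    by rewrite [cs * (_ - Z)]mulrBr XZ; ring.
  apply: le_trans (ler_normB _ _) _.
  apply: le_trans (lerD (ler_normD _ _) (lexx _)) _.
  rewrite !normrM (ger0_norm p0) (gtr0_norm Lr) (ger0_norm X0) (ger0_norm cs0).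
  have b1 : `|U - X| * L ^+ r <= nu * L ^+ d.-1 * (4 / L).
    apply: le_trans (ler_wpM2r (ltW Lr) hs) _.
    have -> : 4 * nu / L * L ^+ r = nu * (4 / L) * L ^+ r by ring.
    have -> : nu * L ^+ d.-1 * (4 / L) = nu * (4 / L) * L ^+ d.-1 by ring.
    rewrite ler_wpM2l ?mulr_ge0 ?invr_ge0 ?(ltW L0) ?expR_ge0 //.
    by apply: ler_weXn2l; rewrite ?L1 // -ltnS prednK.
  have b2 : X * L ^+ r * (1 - (t / L) ^+ r) <= nu * L ^+ d.-1 * (r%:R * eta).
    by apply: ler_pM => //; rewrite mulr_ge0 // ltW.
  have b3 := ler_wpM2l cs0 hu.
  have -> : nu * L ^+ d.-1 * (r%:R * eta + (4 + cs * (4 + 5 * d%:R)) / L)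
    = nu * L ^+ d.-1 * (4 / L) + nu * L ^+ d.-1 * (r%:R * eta)
      + cs * ((4 + 5 * d%:R) * nu * L ^+ d.-1 / L) by field; rewrite gt_eqF ?L0.
  by rewrite lerD // lerD.
have -> : share R d r.+1 G * L ^+ r - cs = (#|level d G r.+1|%:R * L ^+ r - cs * u) / u.
  by rewrite /share; field; rewrite gt_eqF.
rewrite normrM [`|u^-1|]gtr0_norm ?invr_gt0 // ler_pdivrMr //.
apply: le_trans key _.
set Q := _ + _ / L.
have Q0 : 0 <= Q.
  rewrite /Q addr_ge0 ?divr_ge0 ?(ltW L0) ?addr_ge0 ?mulr_ge0 ?addr_ge0 //.
    by rewrite -(pmulr_lge0 _ L0); apply: le_trans teta; rewrite subr_ge0 t_hi.
  by rewrite mulr_ge0.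
have -> : nu * L ^+ d.-1 * Q = c1^-1 * Q * (c1 * nu * L ^+ d.-1).
  by field; rewrite gt_eqF.
by apply: ler_wpM2l ub; apply: mulr_ge0 => //; rewrite invr_ge0 ltW // c10.
Qed.

End Late.

Section Constants.
Context (R : realType) (d : nat).

(** * The failure probability up to a relative error *)

(** The first phase ends when [n * expR (- t)] is about [ln n ^+ burn_exp]. The
    exponent makes the initial penalty of order [ln n ^- 4]. *)
Definition burn_exp : nat := (5 * d + 6)%N.
(** Small enough for [slow slope u] to be at most of order [sqrt (ln n)] at the end
    of the first phase. *)
Definition slope : R := (2 * (burn_exp + d)%:R)^-1.
Definition cutoff : nat := (24 * (d + 4) * (burn_exp + d))%N.
Definition risk_const : R := 432 / slope + cutoff%:R ^+ 3.
Definition share_const : R := 5 * d%:R / unsat_const R d.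
Definition risk_bound : R :=
  risk_const * ((12 / slope) ^+ (3 * d) * expR (slope * (1 + ln (2 * d%:R))))
  * (share_const + share_const ^+ 2 + share_const ^+ 3 + 8 * d%:R / unsat_const R d).
Definition share_bound : R :=
  (unsat_const R d)^-1 * (4 * burn_exp%:R + (4 + (d.-1)`!%:R * (4 + 5 * d%:R))).
Definition total_bound : R :=
  risk_bound + share_bound + 16 * d%:R ^+ 2 * noise R d.
Definition root_large : R :=
  4 * burn_exp%:R + 8 + 4 / unsat_const R d + (d.-1)`!%:R + 8 * (2 * d%:R + 4).

End Constants.

Section Estimate.
Context (R : realType) (d n : nat) (W : R).
Hypotheses (d_gt1 : (1 < d)%N) (W_large : root_large R d <= W).
Hypothesis lnn : ln (n%:R : R) = W ^+ 2.
Local Notation r := (odd (d * n)).+1.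
Hypothesis r_lt : (r < d)%N.
Local Notation K := (burn_exp d).
Local Notation L := (W ^+ 2).
Local Notation c1 := (unsat_const R d).
Local Notation dl := (slope R d).
Local Notation ts := (W ^+ 2 - (burn_exp d)%:R * ln (W ^+ 2)).

Lemma unsat_const_gt0 : 0 < c1.
Proof. by rewrite invr_gt0 mulr_gt0 ?exprn_gt0 // ltr0n fact_gt0. Qed.

Lemma W_bounds : [/\ 4 * K%:R <= W, 8 <= W, 4 / c1 <= W, (d.-1)`!%:R <= W
   & 8 * (2 * d%:R + 4) <= W].
Proof.
have := W_large; rewrite /root_large.
have h1 : 0 <= 4 / c1 by rewrite divr_ge0 // ltW // unsat_const_gt0.
have h2 : 0 <= (d.-1)`!%:R :> R by [].
have h3 : 0 <= d%:R :> R by [].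
have h4 : 0 <= K%:R :> R by [].
by move=> h; split; lra.
Qed.

Lemma W_le_L : W <= L.
Proof. have [_ h _ _ _] := W_bounds; rewrite expr2 ler_peMr; lra. Qed.

Lemma L8 : 8 <= L.
Proof. by have [_ h _ _ _] := W_bounds; exact: le_trans W_le_L. Qed.

Lemma ln_L : ln L = 2 * ln W.
Proof.
have [_ h _ _ _] := W_bounds; rewrite lnXn; last by lra.
by rewrite mulr2n mulrDl mul1r.
Qed.

Lemma expR1_le4 : expR (1 : R) <= 4.
Proof.
have -> : expR 1 = expR (1 / 2) ^+ 2 :> R by rewrite -expRM_natl; congr expR; field.
have -> : 4 = 2 ^+ 2 :> R by rewrite -natrX.
by apply: lerXn2r; rewrite ?nnegrE ?expR_ge0 //; exact: expR_le2.
Qed.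

Lemma KlnL : 1 <= K%:R * ln L <= 2 * K%:R * W.
Proof.
have [_ h _ _ _] := W_bounds; have W0 : 0 < W by lra.
have K1 : 1 <= K%:R :> R by rewrite ler1n /burn_exp addn_gt0 orbT.
have L0 : 0 < L by rewrite exprn_gt0.
have l1 : 1 <= ln L.
  rewrite -ler_expR lnK ?posrE //; apply: le_trans expR1_le4 _; have := L8; lra.
apply/andP; split; first by rewrite -[leLHS]mul1r ler_pM.
rewrite ln_L; have := ln_sublinear W0 => /ltW h'.
have := ler_wpM2l (le_trans ler01 K1) h'; lra.
Qed.

Lemma ts_half : L / 2 <= ts.
Proof.
have [h4 h8 _ _ _] := W_bounds; have /andP[_ h] := KlnL.
have : 4 * K%:R * W <= W * W by rewrite ler_wpM2r //; lra.
rewrite expr2; rewrite expr2 in h; lra.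
Qed.

Lemma n_gt0 : (0 < n)%N.
Proof.
case: n lnn => // h; have := L8; rewrite -h ln0 //; lra.
Qed.

Lemma expR_ts : expR ts = n%:R / L ^+ K.
Proof.
have [_ h _ _ _] := W_bounds.
rewrite expRB -lnn lnK ?posrE ?ltr0n ?n_gt0 // expRM_natl lnn lnK // posrE exprn_gt0 //; lra.
Qed.

Lemma LK_gt0 : 0 < L ^+ K.
Proof. by rewrite exprn_gt0 //; have := L8; lra. Qed.

Lemma nu_bounds t : ts <= t -> t <= ts + 1 ->
  L ^+ K / 4 <= n%:R * expR (- t) <= L ^+ K.
Proof.
move=> t1 t2; have n0 : 0 < n%:R :> R by rewrite ltr0n n_gt0.
have E : n%:R * expR (- ts) = L ^+ K.
  by rewrite expRN expR_ts invf_div mulrCA divff ?mulr1 // gt_eqF.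
apply/andP; split; last by rewrite -E ler_pM2l // ler_expR lerN2.
apply: (@le_trans _ _ (n%:R * expR (- (ts + 1)))); last by rewrite ler_pM2l // ler_expR lerN2.
rewrite opprD expRD mulrA E ler_wpM2l ?(ltW LK_gt0) // expRN.
by rewrite lef_pV2 ?posrE ?expR_gt0 // expR1_le4.
Qed.

(** From [1 + x <= expR x] and the bound of the harmonic sum by the logarithm. *)
Lemma slow_le delta u : 0 < delta -> (0 < u)%N ->
  slow delta u <= expR (delta * (1 + ln u%:R)) :> R.
Proof.
move=> d0; elim: u => // -[|u] IH _.
  rewrite slowS /slow big_ord0 mul1r ln1 addr0 mulr1 divr1; exact: expR_ge1Dx.
rewrite slowS; apply: le_trans (_ : expR (delta * (1 + ln u.+1%:R)) * expR (delta / u.+2%:R) <= _).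
  apply: ler_pM; rewrite ?IH ?expR_ge1Dx //; first exact: ltW (slow_gt0 d0 _).
  by rewrite addr_ge0 // divr_ge0 // ltW.
rewrite -expRD ler_expR -mulrDr; apply: ler_wpM2l; first exact: ltW.
rewrite -addrA lerD2l.
have u1 : 0 < u.+1%:R :> R by rewrite ltr0n.
have u2 : 0 < u.+2%:R :> R by rewrite ltr0n.
have : ln (1 + - (u.+2%:R)^-1) <= - (u.+2%:R)^-1 :> R.
  by apply: le_ln1Dx; rewrite ltrN2 invf_lt1 // (ltr_nat R 1).
have -> : 1 + - (u.+2%:R)^-1 = u.+1%:R / u.+2%:R :> R.
  have -> : u.+1%:R = u.+2%:R - 1 :> R by rewrite -[u.+2%:R]natr1 addrK.
  by rewrite mulrBl divff ?gt_eqF // mul1r.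
rewrite ln_div ?posrE //; move: (ln u.+1%:R) (ln u.+2%:R) (u.+2%:R^-1) => a b c.
lra.
Qed.

Lemma Kd_neq0 : (K + d)%:R != 0 :> R.
Proof. by rewrite pnatr_eq0 -lt0n addn_gt0 /burn_exp addn_gt0 orbT. Qed.

Lemma slope_gt0 : 0 < dl.
Proof.
by rewrite invr_gt0 mulr_gt0 // ltr0n addn_gt0 /burn_exp addn_gt0 orbT.
Qed.

Lemma slope_le1 : dl <= 1.
Proof.
rewrite invf_le1 ?mulr_gt0 // ?ltr0n ?addn_gt0 /burn_exp ?addn_gt0 ?orbT //.
by rewrite -natrM ler1n muln_gt0 /= addn_gt0 addn_gt0 orbT.
Qed.

Section Stop.
Context (G : graph n) (t : R).
Hypotheses (aG : admissible d G) (t_lo : ts <= t) (t_hi : t <= ts + 1).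
Hypothesis dev : forall k, (0 < k <= d)%N ->
  `|deviation d k t G| <= 4 * (n%:R * expR (- t)) / L.
Local Notation u := (#|unsat d G|%:R : R).
Local Notation nu := (n%:R * expR (- t)).

Let t_half : L / 2 <= t. Proof. exact: le_trans ts_half t_lo. Qed.
Let t_L : t <= L.
Proof. by apply: le_trans t_hi _; have /andP[h _] := KlnL; lra. Qed.
Let L_large : 4 / L <= c1.
Proof.
have [_ h8 h _ _] := W_bounds; have c0 := unsat_const_gt0.
have L0 : 0 < L by have := L8; lra.
rewrite ler_pdivrMr // mulrC -ler_pdivrMr //; exact: le_trans W_le_L.
Qed.

Lemma slow_stop : slow dl #|unsat d G| <= expR (dl * (1 + ln (2 * d%:R))) * W.
Proof.
have [_ h8 _ _ _] := W_bounds; have W0 : 0 < W by lra.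
have L0 : 0 < L by rewrite exprn_gt0.
have d0 : (0 < d)%N by exact: ltnW.
have t0 : 0 <= t by apply: le_trans t_half; rewrite divr_ge0 // ltW.
have [lo hi] := unsat_bounds L8 d0 t0 t_L dev.
have /andP[nu1 nu2] := nu_bounds t_lo t_hi.
have u0 : (0 < #|unsat d G|)%N.
  by rewrite -(ltr_nat R); have := LK_gt0; lra.
apply: le_trans (slow_le slope_gt0 u0) _.
have ub : u <= 2 * d%:R * L ^+ (K + d).
  apply: le_trans hi _; rewrite exprD (mulrC (L ^+ K)) [leRHS]mulrA.
  by rewrite ler_wpM2l // !mulr_ge0 // exprn_ge0 // ltW.
have ub' : ln u <= ln (2 * d%:R) + 2 * (K + d)%:R * ln W.
  have p1 : 0 < 2 * d%:R :> R by rewrite mulr_gt0 // ltr0n.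
  have p2 : 0 < L ^+ (K + d) by rewrite exprn_gt0.
  have -> : 2 * (K + d)%:R * ln W = ln (L ^+ (K + d)).
    by rewrite lnXn // ln_L -mulr_natr; ring.
  by rewrite -lnM ?posrE // ler_ln ?posrE ?mulr_gt0 ?ltr0n.
have WE : W = expR (dl * (2 * (K + d)%:R * ln W)).
  rewrite mulrA mulVf ?mul1r ?lnK ?posrE //.
  by rewrite mulf_neq0 ?Kd_neq0 ?pnatr_eq0.
rewrite [in leRHS]WE -expRD ler_expR -mulrDr; apply: ler_wpM2l.
  exact: ltW slope_gt0.
lra.
Qed.

Lemma risk_stop :
  risk_const R d * risk d r.+1 dl G * L ^+ r <= risk_bound R d / W.
Proof.
have [_ h8 _ _ _] := W_bounds; have W0 : 0 < W by lra.
have L0 : 0 < L by rewrite exprn_gt0.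
have L1 : 1 <= L by have := L8; lra.
have c0 := unsat_const_gt0.
have d0 : (0 < d)%N by exact: ltnW.
have q0 : 0 <= share_const R d by rewrite divr_ge0 ?mulr_ge0 // ltW.
have at_ j : (0 < j)%N -> #|atleast d G j|%:R / u <= share_const R d * (L / L ^+ j).
  exact: late_atleast_share d_gt1 n_gt0 L8 t_half t_L L_large dev j.
have powS j : L / L ^+ j.+1 * L ^+ j = 1.
  by rewrite [L ^+ j.+1]exprS invfM mulrA divff ?gt_eqF // mul1r mulVf // gt_eqF // exprn_gt0.
have ulo := late_unsat d_gt1 n_gt0 L8 t_half L_large dev.
have /andP[nu1 nu2] := nu_bounds t_lo t_hi.
have LL : 1 <= L ^+ d.-1 by rewrite exprn_ege1.
have LK := LK_gt0.
have ulo' : c1 * L ^+ K / 4 <= u.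
  apply: le_trans ulo; have -> : c1 * L ^+ K / 4 = c1 * (L ^+ K / 4) * 1 by ring.
  apply: ler_pM => //; first by rewrite mulr_ge0 ?divr_ge0 // ltW.
  by rewrite ler_wpM2l // ltW.
have u0' : 0 < u by apply: lt_le_trans ulo'; rewrite divr_gt0 // mulr_gt0.
have u0 : (0 < #|unsat d G|)%N by rewrite -(ltr_nat R).
have s23 : (1 < r.+1 <= 3)%N by rewrite !ltnS /=; case: odd.
have := risk_le slope_gt0 slope_le1 s23 aG u0.
set A1 := #|atleast d G r.+2|%:R / u; set A2 := #|atleast d G 2|%:R / u.
set A3 := #|atleast d G r.+1|%:R / u.
set q := share_const R d in q0 *.
have iL : 0 <= L^-1 by rewrite invr_ge0 ltW.
have a1 : A1 * L ^+ r <= q / L.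
  apply: le_trans (ler_wpM2r (exprn_ge0 _ (ltW L0)) (at_ r.+2 isT)) _.
  have E : L / L ^+ r.+2 * L ^+ r = L^-1.
    have := powS r.+1; rewrite [L ^+ r.+1]exprSr mulrA => /(canRL (mulfK _)) ->.
      by rewrite mul1r.
    by rewrite gt_eqF.
  by rewrite -mulrA E.
have a2 : A2 <= q / L.
  apply: le_trans (at_ 2%N isT) _.
  by rewrite [L ^+ 2]expr2 invfM [L * _]mulrA divff ?gt_eqF // mul1r.
have a3 : A3 * L ^+ r <= q.
  apply: le_trans (ler_wpM2r (exprn_ge0 _ (ltW L0)) (at_ r.+1 isT)) _.
  by rewrite -mulrA powS mulr1.
have A20 : 0 <= A2 by rewrite divr_ge0.
have A30 : 0 <= A3 by rewrite divr_ge0.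
have a23 : A2 * A3 * L ^+ r <= q ^+ 2 / L.
  rewrite -mulrA; have -> : q ^+ 2 / L = q / L * q by ring.
  by apply: ler_pM => //; rewrite mulr_ge0 // exprn_ge0 // ltW.
have a222 : A2 ^+ 3 * L ^+ r <= q ^+ 3 / L.
  have Lr : L ^+ r <= L ^+ 2 by apply: ler_weXn2l => //; case: odd.
  apply: (@le_trans _ _ ((q / L) ^+ 3 * L ^+ 2)).
    apply: ler_pM (exprn_ge0 _ A20) (exprn_ge0 _ (ltW L0)) _ Lr.
    by apply: lerXn2r; rewrite ?nnegrE // divr_ge0 // ltW.
  have -> : (q / L) ^+ 3 * L ^+ 2 = q ^+ 3 / L.
    by move: (gt_eqF L0); move: L => l l0; field; rewrite l0.
  exact: lexx.
have au : 2 * d%:R / u * L ^+ r <= 8 * d%:R / c1 / L.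
  have Lr : L ^+ r * L <= L ^+ K.
    rewrite -exprSr; apply: ler_weXn2l => //; rewrite /burn_exp.
    by apply: leq_trans (leq_addl _ _); case: odd.
  rewrite mulrAC ler_pdivrMr //; apply: (@le_trans _ _ (8 * d%:R / c1 / L * (c1 * L ^+ K / 4))).
    have -> : 8 * d%:R / c1 / L * (c1 * L ^+ K / 4) = 2 * d%:R * (L ^+ K / L).
      by field; rewrite !gt_eqF.
    by rewrite ler_wpM2l ?mulr_ge0 // ler_pdivlMr.
  apply: ler_wpM2l => //; apply: divr_ge0 (ltW L0); apply: divr_ge0 (ltW c0).
  exact: mulr_ge0.
set Gm := (12 / dl) ^+ (3 * d); set sl := slow _ _.
have Gm0 : 0 <= Gm by rewrite exprn_ge0 // divr_ge0 // ltW // slope_gt0.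
have sl0 : 0 < sl by exact: slow_gt0 slope_gt0 _.
have ss := slow_stop; rewrite -/sl in ss.
set S := expR _ in ss.
have S0 : 0 < S by exact: expR_gt0.
set Q := A1 + _ + _ + _ => rle.
have QL : Q * L ^+ r <= (q + q ^+ 2 + q ^+ 3 + 8 * d%:R / c1) / L.
  rewrite /Q; set e := L ^+ r in a1 a23 a222 au *; set i := L^-1 in a1 a2 a23 a222 au *.
  lra.
have C00 : 0 <= risk_const R d.
  by rewrite /risk_const addr_ge0 ?exprn_ge0 // divr_ge0 // ltW // slope_gt0.
set B := q + _ + _ + _ in QL.
have B0 : 0 <= B.
  by rewrite /B addr_ge0 ?divr_ge0 ?mulr_ge0 ?(ltW c0) // addr_ge0 ?exprn_ge0 // addr_ge0 ?exprn_ge0.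
have st1 : risk d r.+1 dl G * L ^+ r <= Gm * (S * W) * (B / L).
  apply: le_trans (ler_wpM2r (exprn_ge0 _ (ltW L0)) rle) _.
  rewrite -[leLHS]mulrA.
  apply: le_trans (ler_wpM2l (mulr_ge0 Gm0 (ltW sl0)) QL) _.
  apply: ler_wpM2r; first by rewrite divr_ge0 // ltW.
  by apply: ler_wpM2l.
rewrite -mulrA; apply: le_trans (ler_wpM2l C00 st1) _.
rewrite le_eqVlt; apply/orP; left; apply/eqP; rewrite /risk_bound -/Gm -/S -/q -/B.
by field; rewrite gt_eqF.
Qed.

Lemma share_stop :
  `|share R d r.+1 G * L ^+ r - limit_const R d r| <= share_bound R d / W.
Proof.
have [_ h8 _ _ _] := W_bounds; have W0 : 0 < W by lra.
have L0 : 0 < L by rewrite exprn_gt0.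
have c0 := unsat_const_gt0.
have /andP[_ hK] := KlnL.
have eta : L - t <= 2 * K%:R / W * L.
  have -> : 2 * K%:R / W * L = 2 * K%:R * W by field; rewrite gt_eqF.
  have := t_lo; lra.
apply: le_trans (late_share d_gt1 n_gt0 L8 t_half t_L L_large dev (r := r) _ eta) _.
  exact: r_lt.
rewrite /share_bound -[leRHS]mulrA; apply: ler_wpM2l; first by rewrite invr_ge0 ltW.
have K0 : 0 <= K%:R :> R by [].
have r2 : r%:R <= 2 :> R by rewrite (ler_nat R _ 2); case: odd.
have c2 : limit_const R d r <= (d.-1)`!%:R.
  by rewrite ler_piMr // fact_inv_le1.
have iW : 0 <= W^-1 by rewrite invr_ge0 ltW.
have iL : L^-1 <= W^-1 by rewrite lef_pV2 ?posrE // W_le_L.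
have d0 : 0 <= d%:R :> R by [].
have p1 : r%:R * (2 * K%:R / W) <= 4 * K%:R / W.
  have : 0 <= 2 * K%:R / W by rewrite divr_ge0 ?mulr_ge0 // ltW.
  move=> h; have := ler_wpM2r h r2; lra.
have p2 : 4 + limit_const R d r * (4 + 5 * d%:R) <= 4 + (d.-1)`!%:R * (4 + 5 * d%:R).
  by rewrite lerD2l ler_wpM2r // addr_ge0 // mulr_ge0.
have p3 : (4 + limit_const R d r * (4 + 5 * d%:R)) / L
    <= (4 + (d.-1)`!%:R * (4 + 5 * d%:R)) / W.
  apply: ler_pM => //; last by rewrite invr_ge0 ltW.
  by rewrite addr_ge0 // mulr_ge0 ?divr_ge0 // addr_ge0 // mulr_ge0.
by rewrite [leRHS]mulrDl; exact: lerD.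
Qed.

Lemma expect_stop_share m : ('C(n, 2) <= #|G| + m)%N ->
  `|expect d (@failure R d n) m G * L ^+ r - limit_const R d r|
  <= (risk_bound R d + share_bound R d) / W.
Proof.
move=> cG.
have hcut : 12 * (d%:R + 4) <= dl * (cutoff d)%:R.
  rewrite /slope /cutoff !natrM [(d + 4)%:R]natrD.
  have n0 := Kd_neq0.
  by rewrite le_eqVlt; apply/orP; left; apply/eqP; field; rewrite -?natrD ?n0.
have C1 : 432 / dl <= risk_const R d.
  by rewrite /risk_const lerDl exprn_ge0.
have C2 : (cutoff d)%:R ^+ 3 <= risk_const R d.
  by rewrite /risk_const lerDr divr_ge0 // ltW // slope_gt0.
have up := endgame_upper slope_gt0 slope_le1 (erefl r.+1) hcut C1 C2 aG cG.
have lo := endgame_lower slope_gt0 slope_le1 (erefl r.+1) hcut C1 C2 aG cG.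
have Lr : 0 <= L ^+ r by rewrite exprn_ge0 //; have := L8; lra.
have := ler_wpM2r Lr up; have := ler_wpM2r Lr lo.
have := risk_stop; have := share_stop.
rewrite !ler_norml [(_ + _) / W]mulrDl.
set X := expect _ _ _ _; set Y := share _ _ _ _; set Z := risk_const R d * _.
set e := L ^+ r; set c := limit_const _ _ _; set a := risk_bound R d / W.
set b := share_bound R d / W.
by move=> /andP[h1 h2] h3 h4 h5; apply/andP; split; lra.
Qed.

End Stop.

Lemma late_const_bounds : 0 <= limit_const R d r <= W.
Proof.
have [_ _ _ h _] := W_bounds.
by rewrite divr_ge0 //= (le_trans _ h) // ler_piMr // fact_inv_le1.
Qed.

(** The lower bound is the upper bound for the opposite of the indicator. *)
Lemma failure_estimate :
  `|prob_final R d (not_saturating d n) * L ^+ r - limit_const R d r|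
  <= total_bound R d / W.
Proof.
have [h4 h8 _ _ hd] := W_bounds; have W0 : 0 < W by lra.
have L0 : 0 < L by rewrite exprn_gt0.
have L1 : 1 <= L by have := L8; lra.
have d0 : (0 < d)%N by exact: ltnW.
have /andP[lc0 lc1] := late_const_bounds.
have Lr0 : 0 < L ^+ r by rewrite exprn_gt0.
set b := (risk_bound R d + share_bound R d) / W.
have c0 := unsat_const_gt0.
have q0 : 0 <= share_const R d by rewrite divr_ge0 ?mulr_ge0 // ltW.
have b0 : 0 <= b.
  apply: divr_ge0 (ltW W0); apply: addr_ge0.
    rewrite /risk_bound; apply: mulr_ge0.
      apply: mulr_ge0; last by rewrite mulr_ge0 ?expR_ge0 // exprn_ge0 // divr_ge0 // ltW // slope_gt0.
      by rewrite /risk_const addr_ge0 ?exprn_ge0 // divr_ge0 // ltW // slope_gt0.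
    apply: addr_ge0; last by rewrite divr_ge0 ?mulr_ge0 // ltW.
    by rewrite addr_ge0 ?exprn_ge0 // addr_ge0 ?exprn_ge0.
  rewrite /share_bound; apply: mulr_ge0; first by rewrite invr_ge0 ltW.
  by do ![apply: addr_ge0 | apply: mulr_ge0].
have ts0 : 0 <= ts by apply: le_trans ts_half; rewrite divr_ge0 // ltW.
have tsL : ts + 1 <= L by have /andP[h _] := KlnL; lra.
have nlarge : 2 * (2 * d%:R + 4) <= n%:R * expR (- (ts + 1)).
  have tt : ts <= ts + 1 by rewrite lerDl.
  have /andP[h _] := nu_bounds tt (lexx _).
  apply: le_trans h; rewrite ler_pdivlMr //.
  have LKL : L <= L ^+ K by apply: ler_eXnr => //; rewrite /burn_exp addn_gt0 orbT.
  have := W_le_L; lra.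
set fail := @failure R d n.
have fail01 H : 0 <= fail H <= 1 by exact: failure_01.
set pen := 4 * d%:R ^+ 2 * noise R d * L ^+ (5 * d + 2) * expR (ts + 1) / n%:R.
have penL : pen * L ^+ r <= 16 * d%:R ^+ 2 * noise R d / W.
  have n0 : 0 < n%:R :> R by rewrite ltr0n n_gt0.
  rewrite /pen expRD expR_ts.
  have nz0 := noise_ge0 R d.
  have -> : 4 * d%:R ^+ 2 * noise R d * L ^+ (5 * d + 2) * (n%:R / L ^+ K * expR 1) / n%:R * L ^+ r
    = 4 * d%:R ^+ 2 * noise R d * expR 1 * (L ^+ (5 * d + 2) * L ^+ r / L ^+ K).
    by field; rewrite !gt_eqF // LK_gt0.
  have i1 : L ^+ (5 * d + 2) * L ^+ r / L ^+ K <= W^-1.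
    rewrite -exprD ler_pdivrMr ?LK_gt0 // mulrC ler_pdivlMr //.
    apply: (@le_trans _ _ (L ^+ (5 * d + 2 + r) * L)).
      apply: ler_wpM2l; last exact: W_le_L.
      by apply: exprn_ge0; exact: ltW.
    rewrite -exprSr; apply: ler_weXn2l => //; rewrite /burn_exp -addnS -addnA leq_add2l.
    by case: odd.
  have -> : 16 * d%:R ^+ 2 * noise R d / W = 4 * d%:R ^+ 2 * noise R d * 4 * W^-1 by ring.
  have K0 : 0 <= 4 * d%:R ^+ 2 * noise R d by rewrite mulr_ge0 // mulr_ge0 // exprn_ge0.
  apply: ler_pM => //.
  - by rewrite mulr_ge0 ?expR_ge0.
  - by rewrite divr_ge0 ?mulr_ge0 ?exprn_ge0 // ltW.
  - by rewrite ler_wpM2l // expR1_le4.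
have up : expect d fail 'C(n, 2) set0 <= (limit_const R d r + b) / L ^+ r + pen.
  apply: (burn_in d0 n_gt0 L8 ts0 tsL nlarge) => [H|m G t aG t1 t2 dev cG].
    have /andP[_ h] := fail01 H; apply: le_trans h _.
    by rewrite lerDr divr_ge0 ?addr_ge0 // ltW.
  rewrite ler_pdivlMr //; have := expect_stop_share aG t1 t2 dev cG.
  by rewrite ler_norml -/b => /andP[_]; lra.
have lo : expect d (fun H => - fail H) 'C(n, 2) set0 <= - ((limit_const R d r - b) / L ^+ r) + pen.
  apply: (burn_in d0 n_gt0 L8 ts0 tsL nlarge) => [H|m G t aG t1 t2 dev cG].
    have /andP[h _] := fail01 H.
    have : (limit_const R d r - b) / L ^+ r <= 1.
      rewrite ler_pdivrMr // mul1r.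
      have LrL : L <= L ^+ r by apply: ler_eXnr.
      have := W_le_L; lra.
    lra.
  rewrite expectN lerN2 ler_pdivrMr //; have := expect_stop_share aG t1 t2 dev cG.
  by rewrite ler_norml -/b => /andP[h _]; move: h; rewrite -/fail; lra.
rewrite expectN in lo; rewrite prob_final_expect -/fail.
have E1 : (limit_const R d r + b) / L ^+ r * L ^+ r = limit_const R d r + b.
  by rewrite divfK // gt_eqF.
have E2 : (limit_const R d r - b) / L ^+ r * L ^+ r = limit_const R d r - b.
  by rewrite divfK // gt_eqF.
have := ler_wpM2r (ltW Lr0) up; have := ler_wpM2r (ltW Lr0) lo.
rewrite /total_bound [(_ + _ + _) / W]mulrDl -/b.
move: E1 E2 penL; set A1 := (_ + b) / _; set A2 := (_ - b) / _.
set X := expect _ _ _ _; set p := 16 * _ * _ / W; set e := L ^+ r.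
set c := limit_const _ _ _ => E1 E2 penL h1 h2.
rewrite ler_norml; apply/andP; split; lra.
Qed.

End Estimate.

From mathcomp Require Import all_classical all_reals all_analysis.
Import numFieldNormedType.Exports.
Unset Implicit Arguments.

Local Open Scope classical_set_scope.
Local Open Scope ring_scope.

Lemma limit_const_gt0 (R : realType) (d r : nat) : 0 < limit_const R d r.
Proof. by rewrite divr_gt0 // ltr0n fact_gt0. Qed.

(** * Asymptotics *)

(** [failure_estimate] for [W = sqrt (ln n)], which tends to infinity. *)
Lemma relative_error (R : realType) (d : nat) (e : R) : (1 < d)%N -> 0 < e ->
  exists N, forall n, (N <= n)%N -> ((odd (d * n)).+1 < d)%N ->
    `|1 - prob_final R d (not_saturating d n)
            / (limit_const R d (odd (d * n)).+1 / ln n%:R ^+ (odd (d * n)).+1)| <= e.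
Proof.
move=> d1 e0.
(* 1 / limit_const is bounded by the sum of its values for the two parities *)
pose M : R := `|root_large R d| + `|total_bound R d| / e
  * ((limit_const R d 1)^-1 + (limit_const R d 2)^-1).
have c1 := limit_const_gt0 R d 1; have c2 := limit_const_gt0 R d 2.
have tb0 : 0 <= `|total_bound R d| / e by rewrite divr_ge0 // ltW.
have M0 : 0 <= M.
  by rewrite addr_ge0 // mulr_ge0 // addr_ge0 // invr_ge0 ltW.
exists (Num.bound (expR (M ^+ 2))) => n nN rd.
have nM : expR (M ^+ 2) <= n%:R.
  apply: le_trans (_ : (Num.bound (expR (M ^+ 2)))%:R <= _); last by rewrite ler_nat.
  exact/ltW/archi_boundP/expR_ge0.
have n0 : 0 < n%:R :> R by apply: lt_le_trans nM; exact: expR_gt0.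
have lnM : M ^+ 2 <= ln n%:R by rewrite -ler_expR lnK.
pose W := Num.sqrt (ln n%:R : R).
have ln0' : 0 <= ln n%:R :> R by apply: le_trans lnM; exact: sqr_ge0.
have W2 : ln n%:R = W ^+ 2 by rewrite sqr_sqrtr.
have MW : M <= W by rewrite -(@ler_pXn2r _ 2) ?nnegrE ?sqrtr_ge0 // -W2.
have rootW : root_large R d <= W.
  apply: le_trans MW; rewrite /M; apply: le_trans (ler_norm _) _.
  by rewrite lerDl mulr_ge0 // addr_ge0 // invr_ge0 ltW.
have est := failure_estimate d1 rootW W2 rd; rewrite -W2 in est.
set r := (odd (d * n)).+1 in rd est *.
set c := limit_const R d r in est *.
have c0 : 0 < c := limit_const_gt0 R d r.
have W0 : 0 < W.
  apply: lt_le_trans rootW; have := unsat_const_gt0 R d => dg.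
  rewrite /root_large; have h1 : 0 <= 4 / unsat_const R d by rewrite divr_ge0 // ltW.
  have h2 : 0 <= (d.-1)`!%:R :> R by [].
  have h3 : 0 <= d%:R :> R by [].
  have h4 : 0 <= (burn_exp d)%:R :> R by [].
  lra.
have l0 : 0 < ln n%:R :> R by rewrite W2 exprn_gt0.
set p := prob_final _ _ _ in est *.
set l := ln n%:R ^+ r in est *.
have l0' : 0 < l by rewrite exprn_gt0.
have -> : 1 - p / (c / l) = - ((p * l - c) / c) by field; rewrite !gt_eqF.
rewrite normrN normrM [`|c^-1|]gtr0_norm ?invr_gt0 // ler_pdivrMr //.
apply: le_trans est _; rewrite ler_pdivrMr // -ler_pdivrMl ?mulr_gt0 //.
apply: le_trans MW; rewrite /M.
have cc : c^-1 <= (limit_const R d 1)^-1 + (limit_const R d 2)^-1.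
  rewrite /c /r; case: odd; first by rewrite lerDr invr_ge0 ltW.
  by rewrite lerDl invr_ge0 ltW.
apply: (@le_trans _ _ (`|total_bound R d| / e * c^-1)).
  have -> : (e * c)^-1 * total_bound R d = total_bound R d / e * c^-1.
    by field; rewrite !gt_eqF.
  rewrite ler_wpM2r ?invr_ge0 ?(ltW c0) // ler_wpM2r ?invr_ge0 ?(ltW e0) //.
  exact: ler_norm.
by rewrite -[leLHS]add0r lerD // ler_wpM2l.
Qed.

Lemma limit_const1 (R : realType) (d : nat) : (1 < d)%N ->
  limit_const R d 1 = d%:R - 1.
Proof.
case: d => [|[|d]] // _; rewrite /limit_const /= subn1 /= factS natrM.
by rewrite mulfK ?pnatr_eq0 -?lt0n ?fact_gt0 // -[d.+2%:R]natr1 addrK.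
Qed.

Lemma limit_const2 (R : realType) (d : nat) : (2 < d)%N ->
  limit_const R d 2 = (d%:R - 1) * (d%:R - 2).
Proof.
case: d => [|[|[|d]]] // _; rewrite /limit_const /= subn2 /= !factS !natrM mulrA.
rewrite mulfK ?pnatr_eq0 -?lt0n ?fact_gt0 //.
by rewrite -[d.+3%:R]natr1 addrK -[d.+2%:R]natr1; congr (_ * _); ring.
Qed.

Theorem theorem1p2 (R : realType) (d : nat) (hd : (2 <= d)%N) :
  asymp_equiv (within [set n | ~~ odd (d * n)] \oo)
    (fun n => prob_final R d (not_saturating d n))
    (fun n => (d%:R - 1) / ln n%:R)
  /\
  asymp_equiv (within [set n | odd (d * n)] \oo)
    (fun n => prob_final R d (not_saturating d n))
    (fun n => (d%:R - 1) * (d%:R - 2) / ln n%:R ^+ 2).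
Proof.
split; apply/cvgrPdist_le => e e0; have [N hN] := relative_error R d e hd e0;
  exists N => // n /= Nn par; have := hN n Nn.
  by rewrite (negbTE par) limit_const1 // expr1; apply.
have d2 : (2 < d)%N.
  rewrite ltn_neqAle hd andbT; apply/eqP => d2.
  by move: par; rewrite -d2 oddM.
by rewrite par limit_const2 //; apply.
Qed.
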